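(* Let $I\subset\mathbb{R}_{\ge 0}$ be either $[0,T]$ for some $T>0$ or $[0,\infty)$. For every initial state $X_0\in\mathcal{L}^2(0,1;\mathbb{R}^n)$ and every $d\in \mathcal{L}^1(I;\mathcal{L}^2(0,1;\mathbb{R}^q))$, the closed-loop system $\dot X=\mathcal{A}X+\mathcal{N}d$ admits a unique mild solution pair $(X,d)\in\mathcal{C}(I;\mathcal{L}^2(0,1;\mathbb{R}^n))\times\mathcal{L}^1(I;\mathcal{L}^2(0,1;\mathbb{R}^q))$ with $X(0)=X_0$.
   Context: Data: $\Lambda\in\mathbb{R}^{n\times n}$ is diagonal positive definite, $H\in\mathbb{R}^{n\times n}$, $B\in\mathbb{R}^{n\times m}$, $N\in\mathbb{R}^{n\times q}$, $K\in\mathbb{R}^{m\times n}$, and $H_{cl}:=H+BK$. Saturation levels $\overline u_1,\dots,\overline u_m>0$ are given; $\sigma:\mathbb{R}^m\to\mathbb{R}^m$ is defined by $\sigma(u)_i=\min(|u_i|,\overline u_i)\,\mathrm{sign}(u_i)$, and $\phi(u):=\sigma(u)-u$. Operators: $\mathcal{A}X:=-\Lambda X_z$ with domain $\mathcal{D}(\mathcal{A}):=\{X\in\mathcal{H}^1(0,1;\mathbb{R}^n):\ X(0)=H_{cl}X(1)+B\phi(KX(1))\}$, viewed as an operator from $\mathcal{D}(\mathcal{A})$ to $\mathcal{L}^2(0,1;\mathbb{R}^n)$ (the nonlinearity is in the domain); $\mathcal{N}:\mathcal{L}^2(0,1;\mathbb{R}^q)\to\mathcal{L}^2(0,1;\mathbb{R}^n)$,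 $(\mathcal{N}d)(z)=Nd(z)$. The abstract system $\dot X=\mathcal{A}X+\mathcal{N}d$ represents the PDE $X_t(t,z)+\Lambda X_z(t,z)=Nd(t,z)$ on $z\in(0,1)$, with boundary condition $X(t,0)=H_{cl}X(t,1)+B\phi(KX(t,1))$ and initial condition $X(0,z)=X_0(z)$. $\epsilon$-approximate solution on $[0,T]$, for $\epsilon>0$ and $f:=\mathcal{N}d\in\mathcal{L}^1(0,T;\mathcal{L}^2(0,1;\mathbb{R}^n))$: choose a partition $0=t_0<t_1<\dots<t_M\le T$ with $t_i-t_{i-1}<\epsilon$ for all $i$ and $T-\epsilon<t_M\le T$, and elements $f_1,\dots,f_M\in\mathcal{L}^2(0,1;\mathbb{R}^n)$ with $\sum_{i=1}^M\int_{t_{i-1}}^{t_i}\|f(s)-f_i\|\,ds<\epsilon$. An $\epsilon$-approximate solution with initial condition $X_0$ is a piecewise constant function $w:[0,t_M]\to\mathcal{L}^2(0,1;\mathbb{R}^n)$ with $w(0)=w_0$, $w=w_i$ on $(t_{i-1},t_i]$, where $w_i\in\mathcal{D}(\mathcal{A})$ and $\frac{w_i-w_{i-1}}{t_i-t_{i-1}}=\mathcal{A}w_i+f_i$ for $i=1,\dots,M$, and $\|w_0-X_0\|\le\epsilon$. Mild solution pair: a pair $(X,d)$ with $X\in\mathcal{C}(I;\mathcal{L}^2(0,1;\mathbb{R}^n))$, $d\in\mathcal{L}^1(I;\mathcal{L}^2(0,1;\mathbb{R}^q))$, $X(0)=X_0$, such that for each $\epsilon>0$ there is an $\epsilon$-approximate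 solution $w$ of $\dot X=\mathcal{A}X+\mathcal{N}d$ with $\|X(t)-w(t)\|\le\epsilon$ for all $t$ in the domain of $w$ (when $I=[0,\infty)$, this is required of the restriction of $(X,d)$ to $[0,T]$, for every $T>0$). *)

(* Defs.v *)
From HB Require Import structures.
From mathcomp Require Import all_boot all_order all_algebra.
From mathcomp Require Import all_classical all_reals all_analysis.

Set Implicit Arguments.
Unset Strict Implicit.
Unset Printing Implicit Defensive.

Import Order.TTheory GRing.Theory Num.Theory.
Import numFieldNormedType.Exports.

Local Open Scope classical_set_scope.
Local Open Scope ring_scope.

Section L2.
Context {R : realType} {n : nat}.

Local Notation leb := (@lebesgue_measure R).

(* Elements of L^2(0,1; R^n) are handled through representatives defined on R;
   their values outside ]0, 1[ are irrelevant, and equality in L^2 is [eqL2]. *)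
Definition inL2 (X : R -> 'cV[R]_n) : Prop :=
  forall i, (((fun z => X z i 0) : R -> R) \_ `]0, 1[%classic)
    \in Lfun leb 2%:E.

Definition eqL2 (X Y : R -> 'cV[R]_n) : Prop := ae_eq leb `]0, 1[%classic X Y.

Definition normL2 (X : R -> 'cV[R]_n) : R :=
  Num.sqrt (\int[leb]_(z in `]0, 1[%classic) \sum_i X z i 0 ^+ 2).

(* Test functions: the class C^1_c(]0, 1[). *)
Definition test_function (phi : R -> R) : Prop :=
  [/\ forall z, derivable phi z 1,
      continuous (derive1 phi) &
      exists a b, [/\ 0 < a, b < 1 & forall z, z \notin `[a, b] -> phi z = 0]].

Definition weak_derivative (X G : R -> 'cV[R]_n) : Prop :=
  forall i phi, test_function phi ->
    (\int[leb]_(z in `]0, 1[%classic) (X z i 0 * derive1 phi z) =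
     - \int[leb]_(z in `]0, 1[%classic) (G z i 0 * phi z))%R.

Definition inH1 (X : R -> 'cV[R]_n) : Prop :=
  inL2 X /\ exists2 G, inL2 G & weak_derivative X G.

(* [Xc] is the representative of [X] that is continuous on [0, 1]; the boundary
   values of an element of H^1 are those of this representative. *)
Definition continuous_representative (X Xc : R -> 'cV[R]_n) : Prop :=
  (forall i, {within `[0, 1]%classic, continuous (fun z => Xc z i 0)}) /\
  eqL2 X Xc.

Definition step_function (s : R -> R -> 'cV[R]_n) : Prop :=
  exists (r : nat) (A : 'I_r -> set (measurableTypeR R))
         (v : 'I_r -> R -> 'cV[R]_n),
    [/\ forall j, measurable (A j), forall j, inL2 (v j) &
        forall t z, s t z = \sum_j \1_(A j) t *: v j z].

(* C(I; L^2) *)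
Definition continuousL2 (I : set R) (X : R -> R -> 'cV[R]_n) : Prop :=
  (forall t, I t -> inL2 (X t)) /\
  (forall t, I t ->
    (fun s => normL2 (X s \- X t)) @ within I (nbhs t) --> (0 : R)).

(* The Bochner space L^1(I; L^2).  Every class has a representative that is
   everywhere on I the limit of step functions; only those are considered. *)
Definition L1L2 (I : set R) (d : R -> R -> 'cV[R]_n) : Prop :=
  [/\ forall t, I t -> inL2 (d t),
      exists2 s : nat -> R -> R -> 'cV[R]_n,
        forall k, step_function (s k) &
        forall t, I t -> (fun k => normL2 (d t \- s k t)) @ \oo --> (0 : R) &
      (\int[leb]_(t in I) (normL2 (d t))%:E < +oo)%E].

End L2.

Definition posdef_mx {R : realType} {n : nat} (A : 'M[R]_n) : Prop :=
  A^T = A /\ forall v : 'cV[R]_n, v != 0 -> 0 < (v^T *m A *m v) 0 0.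

Section System.
Context {R : realType} {n m q : nat}.
Variables (Lam Hcl : 'M[R]_n) (B : 'M[R]_(n, m)) (N : 'M[R]_(n, q))
          (K : 'M[R]_(m, n)) (ubar : 'cV[R]_m).

Local Notation leb := (@lebesgue_measure R).

Definition sat (u : 'cV[R]_m) : 'cV[R]_m :=
  \col_i (Num.min `|u i 0| (ubar i 0) * Num.sg (u i 0)).

Definition deadzone (u : 'cV[R]_m) : 'cV[R]_m := sat u - u.

Definition domA (X : R -> 'cV[R]_n) : Prop :=
  inH1 X /\ exists2 Xc, continuous_representative X Xc &
    Xc 0 = Hcl *m Xc 1 + B *m deadzone (K *m Xc 1).

(* The graph of the operator A: [X] is in D(A) and [Y] represents A X. *)
Definition graphA (X Y : R -> 'cV[R]_n) : Prop :=
  domA X /\ exists G, [/\ inL2 G, weak_derivative X G &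
    eqL2 Y (fun z => - (Lam *m G z))].

Definition opN (d : R -> 'cV[R]_q) : R -> 'cV[R]_n := fun z => N *m d z.

(* [w] is an eps-approximate solution of X' = A X + f on [0, T] with initial
   condition [X0]; its domain is [0, tM], with [tM] the last partition point.
   The index i of the partition is shifted by one. *)
Definition eps_approx_solution (T eps : R) (f : R -> R -> 'cV[R]_n)
    (X0 : R -> 'cV[R]_n) (tM : R) (w : R -> R -> 'cV[R]_n) : Prop :=
  exists (M : nat) (t : nat -> R) (fi wi : nat -> R -> 'cV[R]_n),
    [/\ [/\ (0 < M)%N, t 0%N = 0, t M = tM &
            (forall i, (i < M)%N -> t i < t i.+1 /\ t i.+1 - t i < eps)
            /\ T - eps < tM <= T],
        (forall i, (i < M)%N -> inL2 (fi i.+1)) /\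
        (\sum_(i < M) \int[leb]_(s in `]t i, t i.+1]%classic)
            (normL2 (f s \- fi i.+1))%:E < eps%:E)%E,
        w 0 = wi 0%N /\
        (forall i, (i < M)%N ->
          forall s, t i < s <= t i.+1 -> w s = wi i.+1),
        forall i, (i < M)%N -> exists2 Y, graphA (wi i.+1) Y &
          eqL2 (fun z => (t i.+1 - t i)^-1 *: (wi i.+1 z - wi i z))
               (Y \+ fi i.+1) &
        inL2 (wi 0%N) /\ normL2 (wi 0%N \- X0) <= eps].

(* [0, T] is I itself if I is bounded, and any initial segment otherwise. *)
Definition horizon (I : set R) (T : R) : Prop :=
  0 < T /\ (I = `[0, T]%classic \/ I = `[0, +oo[%classic).

Definition mild_solution_pair (I : set R) (X0 : R -> 'cV[R]_n)
    (X : R -> R -> 'cV[R]_n) (d : R -> R -> 'cV[R]_q) : Prop :=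
  [/\ continuousL2 I X, L1L2 I d, eqL2 (X 0) X0 &
      forall T, horizon I T -> forall eps, 0 < eps ->
        exists tM w, eps_approx_solution T eps (fun t => opN (d t)) X0 tM w /\
          forall t, 0 <= t <= tM -> normL2 (X t \- w t) <= eps].

End System.

(* Main.v *)
Require Import Defs.
From HB Require Import structures.
From mathcomp Require Import all_boot all_order all_algebra.
From mathcomp Require Import all_classical all_reals all_analysis.
From mathcomp Require Import measurable_realfun.
From mathcomp Require Import ring lra.
Set Implicit Arguments.
Unset Strict Implicit.
Unset Printing Implicit Defensive.
Import Order.TTheory GRing.Theory Num.Theory.
Import numFieldNormedType.Exports.
Local Open Scope classical_set_scope.
Local Open Scope ring_scope.

(** Mild solutions are limits of implicit Euler schemes, and the proof is that of
    the generation theorem for quasi-dissipative operators, in the special case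
    of a Hilbert norm.

    The operator. In the norm with weights [exp (nu z) / lam_k] the pairing of
    the difference [d] of two elements of the domain with the difference of
    their images is, after integration by parts ([weighted_energy]), the boundary
    term [sum (d_k(0) ^ 2 - exp nu d_k(1) ^ 2) / 2] plus a term of size [|d| ^ 2].
    Saturation is clipping, so that the boundary condition expresses the inflow
    values [d(0)] as a Lipschitz function of the outflow values [d(1)]; with [nu]
    a squared Lipschitz constant the boundary term is at most zero, and the
    operator is quasi-dissipative ([operatorA_dissipative]). The resolvent
    equation [w + h Lam w' = v] is solved by variation of constants, and for small
    [h] the inflow values are found by a contraction, as [exp (- 1 / (h lam_k))]
    is small ([operatorA_range]). The domain is dense because it contains the
    [H^1] functions that vanish at both end points ([operatorA_dense]). These
    arguments need the boundary values of an element of the domain, hence that a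
    continuous function with an integrable weak derivative is absolutely
    continuous ([weak_abs_continuous]).

    The scheme. Two implicit Euler schemes on the same grid stay close
    ([euler_stability]). On two different grids, the squared distances
    [|w_i - w'_j| ^ 2] satisfy a discrete hyperbolic inequality in [(i, j)], which
    has an explicit supersolution when the initial value is in the domain and the
    forcing is Lipschitz ([kobayashi_estimate]). General data are approximated by
    such data in [L^1], so that any two fine approximate solutions are close
    ([approximation_close]); they converge to a curve to which all of them are
    close ([mild_limit]).

    Mild solution pairs. This curve is continuous and is approached by
    approximate solutions, hence it is a mild solution. Conversely a mild solution
    is approached by approximate solutions, which are close to the curve as well:
    this is uniqueness, up to continuity at the right end point of a bounded time
    interval. *)

(** * Semi-inner products *)

(** A semi-definite form suffices: square-integrable functions that agree
    almost everywhere are at distance zero, and representatives are used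
    without passing to a quotient. *)
Record semidot (R : realType) (V : lmodType R) := Semidot {
  dot :> V -> V -> R;
  dotC : forall x y, dot x y = dot y x;
  dotDl : forall x y z, dot (x + y) z = dot x z + dot y z;
  dotZl : forall (a : R) x y, dot (a *: x) y = a * dot x y;
  dot_ge0 : forall x, 0 <= dot x x }.

Definition snorm (R : realType) (V : lmodType R) (b : semidot V) (x : V) : R :=
  Num.sqrt (b x x).

Section SemidotTheory.
Context (R : realType) (V : lmodType R) (b : semidot V).
Implicit Types (x y z : V) (a : R).

Local Notation nrm := (snorm b).

Lemma dotDr x y z : b x (y + z) = b x y + b x z.
Proof. by rewrite dotC dotDl !(dotC b x). Qed.

Lemma dotZr a x y : b x (a *: y) = a * b x y.
Proof. by rewrite dotC dotZl (dotC b x). Qed.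

Lemma dotNl x y : b (- x) y = - b x y.
Proof. by rewrite -scaleN1r dotZl mulN1r. Qed.

Lemma dotNr x y : b x (- y) = - b x y.
Proof. by rewrite dotC dotNl dotC. Qed.

Lemma dot0l x : b 0 x = 0.
Proof. by rewrite -(scale0r x) dotZl mul0r. Qed.

Definition dotE := (dotDl, dotDr, dotNl, dotNr, dotZl, dotZr).

Lemma snorm_ge0 x : 0 <= nrm x.
Proof. exact: sqrtr_ge0. Qed.

Lemma sqr_snorm x : nrm x ^+ 2 = b x x.
Proof. by rewrite sqr_sqrtr// dot_ge0. Qed.

Lemma dot_le x y : b x y <= nrm x * nrm y.
Proof.
have [nx ny] := (snorm_ge0 x, snorm_ge0 y).
have key s t : 0 <= s ^+ 2 * b x x - 2 * s * t * b x y + t ^+ 2 * b y y.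
  have := dot_ge0 b (s *: x - t *: y).
  by rewrite !dotE (dotC b y x); congr (_ <= _); ring.
have [|xy] := leP (b x y) 0; first by move/le_trans; apply; rewrite mulr_ge0.
(* If a factor vanished, the quadratic form [key] would be unbounded below. *)
have [x0|x0] := eqVneq (nrm x) 0.
  have bx0 : b x x = 0 by rewrite -sqr_snorm x0 expr0n.
  have := key ((b y y + 1) / b x y) 1; rewrite bx0.
  rewrite (_ : _ + _ = - b y y - 2); first by have := dot_ge0 b y; lra.
  by field; rewrite gt_eqF.
have [y0|y0] := eqVneq (nrm y) 0.
  have by0 : b y y = 0 by rewrite -sqr_snorm y0 expr0n.
  have := key 1 ((b x x + 1) / b x y); rewrite by0.
  rewrite (_ : _ + _ = - b x x - 2); first by have := dot_ge0 b x; lra.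
  by field; rewrite gt_eqF.
have := key (nrm y) (nrm x); rewrite -!sqr_snorm => k.
have xy0 : 0 < nrm x * nrm y by rewrite mulr_gt0// lt_def ?x0 ?y0.
have : 0 <= 2 * (nrm x * nrm y) * (nrm x * nrm y - b x y).
  by move: k; congr (_ <= _); ring.
have xy2 : 0 < 2 * (nrm x * nrm y) by rewrite mulr_gt0.
by rewrite (pmulr_rge0 _ xy2) subr_ge0.
Qed.

Lemma snormD x y : nrm (x + y) <= nrm x + nrm y.
Proof.
rewrite -(ler_pXn2r (ltn0Sn 1)) ?nnegrE ?addr_ge0 ?snorm_ge0//.
rewrite sqr_snorm !dotE sqrrD !sqr_snorm (dotC b y x) mulr2n.
have := dot_le x y; lra.
Qed.

Lemma snormZ a x : nrm (a *: x) = `|a| * nrm x.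
Proof.
by rewrite /snorm dotZl dotZr mulrA -expr2 sqrtrM ?sqr_ge0// sqrtr_sqr.
Qed.

Lemma snormN x : nrm (- x) = nrm x.
Proof. by rewrite -scaleN1r snormZ normrN1 mul1r. Qed.

Lemma snorm0 : nrm 0 = 0.
Proof. by rewrite -(scale0r 0) snormZ normr0 mul0r. Qed.

Lemma snormB x y : nrm (x - y) = nrm (y - x).
Proof. by rewrite -snormN opprB. Qed.

Lemma snorm_triang z x y : nrm (x - y) <= nrm (x - z) + nrm (z - y).
Proof. by rewrite -[x in X in X <= _](subrK z) -addrA snormD. Qed.

Lemma snorm_distB x y : `|nrm x - nrm y| <= nrm (x - y).
Proof.
rewrite ler_norml; apply/andP; split.
  have := snorm_triang 0 (y - x) (- x); have := snormD x (y - x).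
  by rewrite subrKC (snormB y); lra.
by have := snormD (x - y) y; rewrite subrK; lra.
Qed.

Lemma dot_null x y : nrm x = 0 -> b x y = 0.
Proof.
move=> x0; apply/eqP; rewrite eq_le; apply/andP; split.
  by have := dot_le x y; rewrite x0 mul0r.
by have := dot_le (- x) y; rewrite snormN x0 mul0r dotNl; lra.
Qed.

End SemidotTheory.

(** * Implicit Euler schemes for dissipative operators *)

Definition dissipative (R : realType) (V : lmodType R) (b : semidot V) (om : R)
    (A : V -> V -> Prop) :=
  forall x y x' y', A x y -> A x' y' -> b (x - x') (y - y') <= om * b (x - x') (x - x').

Section Euler.
Context (R : realType) (V : lmodType R) (b : semidot V).
Variables (A : V -> V -> Prop).
Implicit Types (x y u f : V) (h k : R).

Local Notation nrm := (snorm b).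

(** The resolvent step [(x - u) / h = A x + f]; it holds up to a null vector,
    which is all that a semi-definite form can see. *)
Definition euler_step h f u x :=
  exists2 y, A x y & nrm (x - u - h *: (y + f)) = 0.

Definition euler (M : nat) (t : nat -> R) (f w : nat -> V) :=
  forall i, (i < M)%N ->
    t i < t i.+1 /\ euler_step (t i.+1 - t i) (f i.+1) (w i) (w i.+1).

Lemma euler_step_test h f u x : euler_step h f u x -> exists2 y, A x y &
  forall v, b (x - u) v = h * (b y v + b f v).
Proof.
move=> [y Axy xuh]; exists y => // v.
have := dot_null v xuh; rewrite dotDl dotNl dotZl (dotDl _ y) => /eqP.
by rewrite subr_eq0 => /eqP.
Qed.

(** With the forcing [- y0], a point of the graph is stationary. Comparison
    with this constant scheme bounds the speed at which a scheme leaves a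
    point of the domain. *)
Lemma euler_const x0 y0 h : A x0 y0 -> euler_step h (- y0) x0 x0.
Proof. by move=> Axy; exists y0 => //; rewrite !subrr scaler0 subrr snorm0. Qed.

Lemma euler_exists (h0 : R) M (t : nat -> R) (f : nat -> V) (w0 : V) :
  (forall h f u, 0 < h < h0 -> exists x, euler_step h f u x) ->
  (forall i, (i < M)%N -> t i < t i.+1 /\ t i.+1 - t i < h0) ->
  exists2 w, w 0%N = w0 & euler M t f w.
Proof.
move=> range tM.
have /choice[next nextP] : forall p : R * V * V, exists x,
    0 < p.1.1 < h0 -> euler_step p.1.1 p.1.2 p.2 x.
  move=> [[h g] u]/=; have [hh|_] := boolP (0 < h < h0); last by exists 0.
  by have [x xP] := range h g u hh; exists x.
pose w := fix w i := if i is j.+1 then next (t j.+1 - t j, f j.+1, w j) else w0.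
exists w => // i iM; have [ti hi] := tM _ iM; split => //.
by apply: nextP => /=; rewrite subr_gt0 ti.
Qed.

Variable (om : R).
Hypotheses (om0 : 0 <= om) (A_diss : dissipative b om A).

(** Test the difference of the two steps against [x - x']. *)
Lemma euler_step_stable h f u x f' u' x' : 0 < h ->
  euler_step h f u x -> euler_step h f' u' x' ->
  (1 - h * om) * nrm (x - x') <= nrm (u - u') + h * nrm (f - f').
Proof.
move=> h0 /euler_step_test[y Axy xE] /euler_step_test[y' Axy' xE'].
have dis := A_diss Axy Axy'.
set v := x - x' in dis *.
have e : b v v = b (u - u') v + h * b (y - y') v + h * b (f - f') v.
  have := xE v; have := xE' v; rewrite {2}/v !dotE; lra.
have [v0|v0] := eqVneq (nrm v) 0.
  by rewrite v0 mulr0 addr_ge0 ?mulr_ge0 ?snorm_ge0// ltW.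
have {}v0 : 0 < nrm v by rewrite lt_def v0 snorm_ge0.
have e1 := dot_le b (u - u') v; have e2 := dot_le b (f - f') v.
have e3 : h * b (y - y') v <= h * (om * b v v) by rewrite ler_pM2l// dotC.
have e4 : h * b (f - f') v <= h * (nrm (f - f') * nrm v) by rewrite ler_pM2l.
rewrite -(ler_pM2r v0).
have : nrm v * nrm v = b v v by rewrite -expr2 sqr_snorm.
move: e e1 e3 e4.
set q := b v v; set n := nrm v => e e1 e3 e4 nq.
have -> : (1 - h * om) * n * n = q - h * (om * q) by rewrite -nq; ring.
have -> : (nrm (u - u') + h * nrm (f - f')) * n =
  nrm (u - u') * n + h * (nrm (f - f') * n) by ring.
lra.
Qed.

(** Testing both steps against [x - x'] and using [2 (x - u, x - x') >=
    |x - x'|^2 - |u - x'|^2]; this is where the Hilbert structure makes it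
    possible to compare steps of different lengths. *)
Lemma euler_step_cross h f u x k f' u' x' : 0 < h -> 0 < k ->
  euler_step h f u x -> euler_step k f' u' x' ->
  (nrm (x - x') ^+ 2 - nrm (u - x') ^+ 2) / h
    + (nrm (x - x') ^+ 2 - nrm (x - u') ^+ 2) / k
  <= (2 * om + 1) * nrm (x - x') ^+ 2 + nrm (f - f') ^+ 2.
Proof.
move=> h0 k0 /euler_step_test[y Axy xE] /euler_step_test[y' Axy' xE'].
have dis := A_diss Axy Axy'.
have {xE} e1 := xE (x - x'); have {xE'} e2 := xE' (x' - x).
have p1 : (nrm (x - x') ^+ 2 - nrm (u - x') ^+ 2) / h
    <= 2 * (b y (x - x') + b f (x - x')).
  rewrite ler_pdivrMr// -mulrA (mulrC _ h) -e1 !sqr_snorm.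
  have := dot_ge0 b (x - u); rewrite !dotE (dotC b u x) (dotC b x' x) (dotC b x' u).
  lra.
have p2 : (nrm (x - x') ^+ 2 - nrm (x - u') ^+ 2) / k
    <= 2 * (b y' (x' - x) + b f' (x' - x)).
  rewrite ler_pdivrMr// -mulrA (mulrC _ k) -e2 !sqr_snorm.
  have := dot_ge0 b (x' - u'); rewrite !dotE (dotC b u' x) (dotC b x' x) (dotC b u' x').
  lra.
apply: le_trans (lerD p1 p2) _; rewrite !sqr_snorm.
have e3 : b y (x - x') + b f (x - x') + (b y' (x' - x) + b f' (x' - x))
    = b (x - x') (y - y') + b (x - x') (f - f').
  by rewrite -!(opprB x x') (dotC b _ (y - y')) (dotC b _ (f - f')) !dotDl !dotNl !dotNr; ring.
have := dot_ge0 b (f - f' - (x - x')).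
rewrite -mulrDr e3 (dotDl _ (f - f')) !(dotDr _ _ (f - f')) dotNl !dotNr.
rewrite (dotC b (f - f') (x - x')) [(2 * om + 1) * _]mulrDl mul1r -mulrA.
rewrite dotNl; move: dis; set v := x - x'; set c := om * _; lra.
Qed.

End Euler.

Definition grid (R : realType) (T : R) (M : nat) (t : nat -> R) :=
  t 0%N = 0 /\ t M <= T /\ forall i, (i < M)%N -> t i < t i.+1.

Section EulerEstimates.
Context (R : realType) (V : lmodType R) (b : semidot V).
Variables (A : V -> V -> Prop) (om : R).
Hypotheses (om0 : 0 <= om) (A_diss : dissipative b om A).

Local Notation nrm := (snorm b).

Definition consistency (M : nat) (t : nat -> R) (f f' : nat -> V) : R :=
  \sum_(i < M) (t i.+1 - t i) * nrm (f i.+1 - f' i.+1).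

Lemma grid_ge (M : nat) (t : nat -> R) i j :
  (forall i, (i < M)%N -> t i < t i.+1) -> (i <= j <= M)%N -> t i <= t j.
Proof.
move=> tM /andP[]; elim: j => [|j IH]; first by rewrite leqn0 => /eqP->.
rewrite leq_eqVlt => /predU1P[->//|ij jM].
by rewrite (le_trans (IH ij (ltnW jM)))// ltW// tM.
Qed.

Lemma consistency_le (M : nat) (t : nat -> R) f f' i :
  (forall i, (i < M)%N -> t i < t i.+1) -> (i <= M)%N ->
  0 <= consistency i t f f' <= consistency M t f f'.
Proof.
move=> tM; elim: M i tM => [|M IH] i tM.
  by rewrite leqn0 => /eqP->; rewrite /consistency big_ord0 lexx.
have ge0 : 0 <= (t M.+1 - t M) * nrm (f M.+1 - f' M.+1).
  by rewrite mulr_ge0 ?snorm_ge0// subr_ge0 ltW// tM.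
have tM' j : (j < M)%N -> t j < t j.+1 by move=> jM; apply: tM; exact: ltnW.
have rec : consistency M.+1 t f f' =
    consistency M t f f' + (t M.+1 - t M) * nrm (f M.+1 - f' M.+1).
  by rewrite /consistency big_ord_recr.
rewrite leq_eqVlt => /predU1P[->|].
  by have /andP[+ _] := IH M tM' (leqnn _); rewrite lexx andbT rec; lra.
rewrite ltnS => iM; have /andP[-> /=] := IH i tM' iM.
by rewrite rec; lra.
Qed.

(** Each implicit step is Lipschitz with constant
    [1 / (1 - h om) <= exp (2 h om)], and the defects of the forcing add up. *)
Lemma euler_stability (M : nat) t f w f' w' :
  t 0%N = 0 -> (forall i, (i < M)%N -> (t i.+1 - t i) * om <= 2^-1) ->
  euler b A M t f w -> euler b A M t f' w' ->
  forall i, (i <= M)%N -> nrm (w i - w' i) <=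
    expR (2 * om * t i) * (nrm (w 0%N - w' 0%N) + consistency i t f f').
Proof.
move=> t0 hM ew ew'; elim=> [|i IH] iM.
  by rewrite /consistency t0 mulr0 expR0 mul1r big_ord0 addr0.
have {IH} := IH (ltnW iM).
rewrite /consistency big_ord_recr/= addrA -/(consistency i t f f').
have [ti si] := ew _ iM; have [_ si'] := ew' _ iM; have := hM _ iM.
set h := t i.+1 - t i in si si' *; have h0 : 0 < h by rewrite subr_gt0.
have := euler_step_stable A_diss h0 si si'.
set S := _ + consistency _ _ _ _; set a := nrm (f _ - _).
set n1 := nrm _; set n := nrm _ => st hom IH.
have -> : 2 * om * t i.+1 = 2 * om * t i + 2 * (h * om) by rewrite /h; ring.
rewrite expRD; set e := expR (2 * om * t i) in IH *; set e1 := expR _.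
have e_gt0 : 0 < e by exact: expR_gt0.
have e1_ge : 1 + 2 * (h * om) <= e1 by exact: expR_ge1Dx.
have a0 : 0 <= h * a by rewrite mulr_ge0 ?snorm_ge0 1?ltW.
have n10 : 0 <= n1 by exact: snorm_ge0.
have ti0 : 0 <= t i.
  by rewrite -t0 (grid_ge (M := M)) ?(ltnW iM)// => j jM; have [] := ew _ jM.
have e_ge1 : 1 <= e.
  by rewrite (le_trans _ (expR_ge1Dx _))// lerDl !mulr_ge0.
have h1 : 0 <= h * om by rewrite mulr_ge0// ltW.
have st2 : (1 - h * om) * n1 <= e * (S + h * a).
  have := ler_wpM2r a0 e_ge1; lra.
have : n1 <= e1 * ((1 - h * om) * n1).
  rewrite mulrA ler_peMl//.
  have := @ler_wpM2r _ (1 - h * om) ltac:(lra) _ _ e1_ge.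
  have := mulr_ge0 h1 (_ : 0 <= 1 - 2 * (h * om)); lra.
move/le_trans; apply; rewrite (mulrC e) -mulrA ler_pM2l//.
by rewrite (lt_le_trans _ e1_ge)//; lra.
Qed.

Section TwoGrids.
Variables (x0 y0 : V) (g : R -> V) (l T : R).
Hypotheses (Axy0 : A x0 y0) (l0 : 0 <= l) (T0 : 0 < T)
  (g_lip : forall s t, 0 <= s <= T -> 0 <= t <= T -> nrm (g s - g t) <= l * `|s - t|).

(* [C0 * t] bounds the distance travelled up to time [t]; [al] is large
   enough for the right-hand side of the two-grid estimate to be a
   supersolution. *)
Let C0 : R := expR (2 * om * T) * (nrm (g 0 + y0) + l * T).
Let C : R := 1 + C0 ^+ 2.
Let al : R := 4 * (2 * om + 1) + 2 * l ^+ 2.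

Lemma grid_itv M t i : grid T M t -> (i <= M)%N -> 0 <= t i <= T.
Proof.
move=> [t0 [tM tlt]] iM; apply/andP; split.
  by rewrite -t0 (grid_ge tlt).
by rewrite (le_trans _ tM)// (grid_ge tlt)// iM leqnn.
Qed.

Lemma euler_nice_start M t w : grid T M t -> w 0%N = x0 ->
  (forall i, (i < M)%N -> (t i.+1 - t i) * om <= 2^-1) ->
  euler b A M t (g \o t) w ->
  forall i, (i <= M)%N -> nrm (w i - x0) <= C0 * t i.
Proof.
move=> gt w0 hM ew i iM; have [t0 [tM tlt]] := gt.
have ec : euler b A M t (fun=> - y0) (fun=> x0).
  by move=> j jM; split; [exact: tlt|exact: euler_const].
apply: le_trans (euler_stability t0 hM ew ec iM) _.
rewrite w0 subrr snorm0 add0r.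
have /andP[ti0 tiT] := grid_itv gt iM.
have : consistency i t (g \o t) (fun=> - y0) <= t i * (nrm (g 0 + y0) + l * T).
  rewrite /consistency (le_trans (ler_sum _ (G := fun j : 'I_i =>
     (t j.+1 - t j) * (nrm (g 0 + y0) + l * T)) _))//.
    move=> j _; rewrite ler_pM2l ?subr_gt0 ?tlt ?(leq_trans (ltn_ord j))//=.
    rewrite opprK.
    have /andP[tj0 tjT] : 0 <= t j.+1 <= T.
      by apply: grid_itv gt _; rewrite (leq_trans (ltn_ord j)).
    have -> : g (t j.+1) + y0 = (g (t j.+1) - g 0) + (g 0 + y0).
      by rewrite addrA subrK.
    rewrite (le_trans (snormD _ _ _))// addrC lerD2l.
    rewrite (le_trans (g_lip _ _)) ?lexx ?tj0 ?tjT ?(ltW T0)//.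
    by rewrite ler_wpM2l// subr0 ger0_norm.
  by rewrite -mulr_suml -(big_mkord xpredT (fun j => t j.+1 - t j)) telescope_sumr// t0 subr0.
move=> cle.
have -> : C0 * t i = expR (2 * om * T) * (t i * (nrm (g 0 + y0) + l * T)).
  by rewrite /C0 -mulrA (mulrC (t i)).
rewrite ler_pM ?expR_ge0//.
  by have /andP[] := consistency_le (g \o t) (fun=> - y0) tlt iM.
by rewrite ler_expR ler_wpM2l// mulr_ge0.
Qed.

(** The right-hand side is a discrete supersolution: with [P] the polynomial
    factor, the backward difference quotients of [P] in its two arguments sum
    to a nonnegative number, and the exponential absorbs the growth and the
    forcing term; the term [4 eta^2] dominates the cross term [h (t - s)]. *)
Lemma kobayashi_step h k t s eta q q1 q2 : 0 < h -> 0 < k -> h <= eta -> k <= eta ->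
  0 <= t - h -> 0 <= s - k -> al * eta <= 2^-1 ->
  let P t s := (t - s) ^+ 2 + eta * t + eta * s + 4 * eta ^+ 2 in
  q1 <= C * expR (al * (t - h)) * P (t - h) s ->
  q2 <= C * expR (al * t) * P t (s - k) ->
  (q - q1) / h + (q - q2) / k <= (2 * om + 1) * q + (l * `|t - s|) ^+ 2 ->
  q <= C * expR (al * t) * P t s.
Proof.
move=> h0 k0 he ke th sk ale P.
have al0 : 0 < al.
  by rewrite /al ltr_wpDr ?mulr_ge0 ?sqr_ge0// mulr_gt0// ltr_wpDl// mulr_ge0.
have C1 : 1 <= C by rewrite /C lerDl sqr_ge0.
set r1 := expR (al * (t - h)).
have -> : expR (al * t) = r1 * expR (al * h) by rewrite -expRD; congr expR; ring.
set E := expR (al * h).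
have E1 : 1 + al * h <= E by exact: expR_ge1Dx.
have alh : 0 < al * h by rewrite mulr_gt0.
have alh2 : al * h <= 2^-1 by rewrite (le_trans _ ale)// ler_pM2l.
have E2 : E <= 2.
  have := expR_ge1Dx (- (al * h)); rewrite expRN -/E => e.
  have E0 : 0 < E by exact: expR_gt0.
  have : (1 - al * h) * E <= 1 by rewrite -ler_pdivlMr// div1r.
  nra.
have r11 : 1 <= r1 by rewrite -expR0 ler_expR mulr_ge0// ltW.
rewrite exprMn real_normK ?num_real//.
have eta0 : 0 < eta by exact: lt_le_trans he.
set D := (t - s) ^+ 2; set p := P t s.
have [et es] : 0 <= eta * t /\ 0 <= eta * s.
  by split; rewrite mulr_ge0 ?(ltW eta0)//; lra.
have e2 : 0 < eta ^+ 2 by rewrite exprn_gt0.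
have D0 : 0 <= D by exact: sqr_ge0.
have pD : D <= p by rewrite /p /P -/D; lra.
have p0 : 0 < p by rewrite /p /P -/D; lra.
have hh : h * h <= eta * h by rewrite ler_pM2r.
have kk : k * k <= eta * k by rewrite ler_pM2r.
have p1 : P (t - h) s <= p - 2 * h * (t - s).
  rewrite /p /P -subr_ge0 (_ : _ - _ = eta * h - h * h) ?subr_ge0//; ring.
have p2 : P t (s - k) <= p + 2 * k * (t - s).
  rewrite /p /P -subr_ge0 (_ : _ - _ = eta * k - k * k) ?subr_ge0//; ring.
have pd : 2 * h * (t - s) <= p / 2.
  have : 2 * h * (t - s) <= D / 2 + 2 * h ^+ 2.
    rewrite -subr_ge0.
    have -> : D / 2 + 2 * h ^+ 2 - 2 * h * (t - s) = (t - s - 2 * h) ^+ 2 / 2 by rewrite /D; field.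
    by rewrite divr_ge0 ?sqr_ge0.
  have : h ^+ 2 <= eta ^+ 2 by rewrite ler_pXn2r// nnegrE ltW.
  by rewrite /p /P -/D; lra.
set c := C * r1; have c1 : 1 <= c by rewrite /c -[1]mulr1 ler_pM.
move=> q1P q2P hq; rewrite leNgt; apply/negP => Qq.
set Q := _ * p in Qq; set be := 2 * om + 1 in hq.
have be0 : 1 <= be by rewrite lerDr mulr_ge0.
have alE : al = 4 * be + 2 * l ^+ 2 by [].
have hbe : h * be <= 2^-1 by have := sqr_ge0 l; nra.
have hV : 0 < h^-1 by rewrite invr_gt0.
have kV : 0 < k^-1 by rewrite invr_gt0.
have hbe2 : be <= h^-1.
  by rewrite -[be]mul1r -(mulVf (lt0r_neq0 h0)) -mulrA ger_pMr//; lra.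
have m : Q * (h^-1 + k^-1 - be) < q * (h^-1 + k^-1 - be) by rewrite ltr_pM2r// subr_gt0 (le_lt_trans hbe2)// ltrDl.
have m1 : q1 / h <= c * (p - 2 * h * (t - s)) / h.
  by rewrite ler_pM2r// (le_trans q1P)// ler_pM2l// (lt_le_trans _ c1).
have c0 : 0 < c by exact: lt_le_trans c1.
have E0 : 0 < E by exact: expR_gt0.
have m2 : q2 / k <= c * E * (p + 2 * k * (t - s)) / k.
  by rewrite ler_pM2r// (le_trans q2P)// !mulrA -/c ler_pM2l// mulr_gt0.
have QE : Q = c * E * p by rewrite /Q /c !mulrA.
have f1 : Q / h - c * (p - 2 * h * (t - s)) / h
    = c * ((E - 1) * p / h + 2 * (t - s)).
  by rewrite QE; field; rewrite gt_eqF.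
have f2 : Q / k - c * E * (p + 2 * k * (t - s)) / k = - c * E * (2 * (t - s)).
  by rewrite QE; field; rewrite gt_eqF.
have f3 : al * p / 2 <= (E - 1) * (p / h - 2 * (t - s)).
  have -> : al * p / 2 = (al * h) * (p / 2 / h) by field; rewrite gt_eqF.
  have -> : p / h - 2 * (t - s) = (p - 2 * h * (t - s)) / h by field; rewrite gt_eqF.
  have php : p / 2 <= p - 2 * h * (t - s) by lra.
  rewrite ler_pM ?(ltW alh) ?divr_ge0 ?(ltW p0) ?(ltW h0)//.
    by rewrite lerBrDl.
  by rewrite ler_pM2r.
have f4 : c * (al * p / 2) <= Q / h - c * (p - 2 * h * (t - s)) / h
    + (Q / k - c * E * (p + 2 * k * (t - s)) / k).
  rewrite f1 f2.
  have -> : c * ((E - 1) * p / h + 2 * (t - s)) + - c * E * (2 * (t - s))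
    = c * ((E - 1) * (p / h - 2 * (t - s))) by ring.
  by rewrite ler_pM2l.
have f5 : be * Q <= 2 * be * (c * p).
  have -> : 2 * be * (c * p) = (be * (c * p)) * 2 by ring.
  have -> : be * Q = (be * (c * p)) * E by rewrite QE; ring.
  have bcp : 0 < be * (c * p) by rewrite mulr_gt0 ?(mulr_gt0 c0 p0)// (lt_le_trans ltr01 be0).
  by rewrite (ler_pM2l bcp).
have f6 : l ^+ 2 * D <= l ^+ 2 * (c * p).
  rewrite ler_wpM2l ?sqr_ge0// (le_trans pD)// -[X in X <= _]mul1r.
  by rewrite ler_pM2r.
have f7 : c * (al * p / 2) = 2 * be * (c * p) + l ^+ 2 * (c * p).
  by rewrite alE; field.
have exp z : z * (h^-1 + k^-1 - be) = z / h + z / k - be * z by ring.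
rewrite !exp in m; rewrite (mulrBl _ q q1) (mulrBl _ q q2) in hq.
move: m m1 m2 f4 f5 f6 f7 hq.
set a1 := Q / h; set a2 := Q / k; set a3 := be * Q.
set b1 := q / h; set b2 := q / k; set b3 := be * q.
set c1' := q1 / h; set c2' := q2 / k; set d1 := c * _ / h; set d2 := c * E * _ / k.
set g1 := c * (_ / 2); set g2 := l ^+ 2 * (c * p); set g3 := 2 * be * _.
set g4 := l ^+ 2 * D; clearbody a1 a2 a3 b1 b2 b3 c1' c2' d1 d2 g1 g2 g3 g4.
by move=> *; lra.
Qed.

(** Double induction over the two grids. On the sides [i = 0] and [j = 0] the
    bound comes from the distance travelled; inside, comparing a step of one
    scheme with a step of the other feeds the supersolution. *)
Lemma kobayashi_estimate M t w M' t' w' eta : grid T M t -> grid T M' t' ->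
  (forall i, (i < M)%N -> t i.+1 - t i <= eta) ->
  (forall i, (i < M')%N -> t' i.+1 - t' i <= eta) ->
  0 < eta -> al * eta <= 2^-1 -> w 0%N = x0 -> w' 0%N = x0 ->
  euler b A M t (g \o t) w -> euler b A M' t' (g \o t') w' ->
  forall i j, (i <= M)%N -> (j <= M')%N -> nrm (w i - w' j) ^+ 2 <=
    C * expR (al * t i) *
      ((t i - t' j) ^+ 2 + eta * t i + eta * t' j + 4 * eta ^+ 2).
Proof.
move=> gt gt' mt mt' eta0 ale w0 w0' ew ew'.
have C1 : 1 <= C by rewrite /C lerDl sqr_ge0.
have alom : om * 8 <= al by rewrite /al; have := sqr_ge0 l; lra.
have al0 : 0 <= al by rewrite (le_trans _ alom)// mulr_ge0.
have small h : h <= eta -> h * om <= 2^-1.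
  move=> he; rewrite (le_trans _ ale)// (le_trans (ler_wpM2r om0 he))// mulrC.
  by rewrite ler_wpM2r ?(ltW eta0)//; lra.
have hM i : (i < M)%N -> (t i.+1 - t i) * om <= 2^-1 by move=> /mt; exact: small.
have hM' i : (i < M')%N -> (t' i.+1 - t' i) * om <= 2^-1 by move=> /mt'; exact: small.
have C00 : 0 <= C0.
  by rewrite /C0 mulr_ge0 ?expR_ge0// addr_ge0 ?snorm_ge0// mulr_ge0// ltW.
have side r a e : 0 <= r -> 1 <= e -> (C0 * r) ^+ 2 + a = C0 ^+ 2 * r ^+ 2 + a ->
  0 <= a -> (C0 * r) ^+ 2 <= C * e * (r ^+ 2 + a).
  move=> r0 e1 _ a0; rewrite exprMn ler_pM ?sqr_ge0//; last by rewrite lerDl.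
  rewrite -[X in X <= _]mulr1 ler_pM ?sqr_ge0//.
  by rewrite /C lerDr.
elim=> [|i IHi] j iM jM.
  have [t00 _] := gt; have /andP[tj0 _] := grid_itv gt' jM.
  rewrite w0 t00 mulr0 expR0 snormB sub0r sqrrN mulr0 addr0 -addrA.
  apply: (le_trans (y := (C0 * t' j) ^+ 2)); last first.
    apply: side => //; first by rewrite exprMn.
    by rewrite addr_ge0 ?mulr_ge0 ?sqr_ge0// ltW.
  rewrite ler_pXn2r ?nnegrE ?snorm_ge0 ?(mulr_ge0 C00)//.
  exact: (euler_nice_start gt').
have /andP[ti0 _] := grid_itv gt iM; have /andP[ti0' _] := grid_itv gt (ltnW iM).
have hi : t i.+1 - (t i.+1 - t i) = t i by ring.
elim: j jM => [|j IHj] jM.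
  have [t00 _] := gt'; rewrite w0' t00 subr0 mulr0 addr0 -addrA.
  apply: (le_trans (y := (C0 * t i.+1) ^+ 2)); last first.
    apply: side => //; last by rewrite addr_ge0 ?mulr_ge0 ?sqr_ge0// ltW.
      by rewrite -expR0 ler_expR mulr_ge0.
    by rewrite exprMn.
  rewrite ler_pXn2r ?nnegrE ?snorm_ge0 ?(mulr_ge0 C00)//.
  exact: (euler_nice_start gt).
have /andP[tj0 _] := grid_itv gt' jM; have /andP[tj0' _] := grid_itv gt' (ltnW jM).
have hj : t' j.+1 - (t' j.+1 - t' j) = t' j by ring.
have [ti si] := ew _ iM; have [tj sj] := ew' _ jM.
apply: (@kobayashi_step (t i.+1 - t i) (t' j.+1 - t' j) _ _ eta _
  (nrm (w i - w' j.+1) ^+ 2) (nrm (w i.+1 - w' j) ^+ 2)); rewrite ?subr_gt0 ?hi ?hj//.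
- exact: mt.
- exact: mt'.
- exact: IHi _ (ltnW iM) jM.
- exact: IHj (ltnW jM).
have sti : 0 < t i.+1 - t i by rewrite subr_gt0.
have stj : 0 < t' j.+1 - t' j by rewrite subr_gt0.
apply: le_trans (euler_step_cross A_diss sti stj si sj) _.
rewrite lerD2l ler_pXn2r ?nnegrE ?snorm_ge0 ?mulr_ge0//=.
by apply: g_lip; [exact: grid_itv gt iM|exact: grid_itv gt' jM].
Qed.

(** The nice data are an initial value in the domain and a Lipschitz forcing.
    A scheme whose data are within [k] of them is compared, on its own grid,
    with the scheme driven by the nice data; the latter are compared across
    grids by the two-grid estimate. *)
Lemma euler_close (h0 e : R) : 0 < h0 -> 0 < e ->
  (forall h f u, 0 < h < h0 -> exists x, euler_step b A h f u x) ->
  exists2 del, 0 < del & forall k M t f w M' t' f' w',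
    grid T M t -> grid T M' t' ->
    (forall i, (i < M)%N -> t i.+1 - t i <= del) ->
    (forall i, (i < M')%N -> t' i.+1 - t' i <= del) ->
    euler b A M t f w -> euler b A M' t' f' w' ->
    nrm (w 0%N - x0) <= k -> nrm (w' 0%N - x0) <= k ->
    consistency M t f (g \o t) <= k -> consistency M' t' f' (g \o t') <= k ->
    forall i j, (i <= M)%N -> (j <= M')%N -> `|t i - t' j| <= del ->
      nrm (w i - w' j) <= expR (2 * om * T) * (4 * k) + e.
Proof.
move=> h00 e0 range.
have C1 : 1 <= C by rewrite /C lerDl sqr_ge0.
have alom : om * 8 <= al by rewrite /al; have := sqr_ge0 l; lra.
have al0 : 0 < al.
  by rewrite /al ltr_wpDr ?mulr_ge0 ?sqr_ge0// mulr_gt0// ltr_wpDl// mulr_ge0.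
pose D := C * expR (al * T) * (5 + 2 * T).
have D0 : 0 < D.
  by rewrite !mulr_gt0 ?expR_gt0 ?(lt_le_trans _ C1)// addr_gt0 ?mulr_gt0.
pose del := Num.min (Num.min 1 (h0 / 2)) (Num.min (2 * al)^-1 (e ^+ 2 / D)).
have del0 : 0 < del.
  rewrite !lt_min ltr01 divr_gt0//= invr_gt0 (mulr_gt0 _ al0)//=.
  by rewrite divr_gt0// exprn_gt0.
have [d1 dh da dD] : [/\ del <= 1, del < h0, al * del <= 2^-1 & D * del <= e ^+ 2].
  have d1 : del <= Num.min 1 (h0 / 2) by rewrite /del ge_min lexx.
  have d2 : del <= Num.min (2 * al)^-1 (e ^+ 2 / D) by rewrite /del ge_min lexx orbT.
  move: d1 d2; rewrite !le_min => /andP[d1 d2] /andP[d3 d4]; split => //.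
  - lra.
  - rewrite -ler_pdivlMl// (le_trans d3)// invfM mulrC//.
  - by rewrite -ler_pdivlMl// mulrC.
exists del => // k M t f w M' t' f' w' gt gt' mt mt' ew ew' w0 w0' cf cf' i j iM jM tij.
have small h : h <= del -> h * om <= 2^-1.
  move=> he; rewrite (le_trans _ da)// (le_trans (ler_wpM2r om0 he))// mulrC.
  by rewrite ler_wpM2r ?(ltW del0)//; lra.
have compare N s a u : grid T N s -> (forall i, (i < N)%N -> s i.+1 - s i <= del) ->
    euler b A N s a u -> nrm (u 0%N - x0) <= k -> consistency N s a (g \o s) <= k ->
    exists v, [/\ v 0%N = x0, euler b A N s (g \o s) v &
      forall i, (i <= N)%N -> nrm (u i - v i) <= expR (2 * om * T) * (2 * k)].
  move=> gs ms eu u0 cs; have [s0 [_ sN]] := gs.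
  have [|v v0 ev] := euler_exists (M := N) (t := s) (g \o s) x0 range.
    by move=> n nN; split; [exact: sN|rewrite (le_lt_trans (ms _ nN))].
  exists v; split => // n nN.
  have /andP[_ sT] := grid_itv gs nN; have /andP[sn0 _] := grid_itv gs nN.
  apply: le_trans (euler_stability s0 _ eu ev nN) _.
    by move=> p pN; apply: small; exact: ms.
  have /andP[c0 cN] := consistency_le a (g \o s) sN nN.
  rewrite ler_pM ?expR_ge0 ?addr_ge0 ?snorm_ge0//.
    by rewrite ler_expR ler_wpM2l// mulr_ge0.
  by rewrite v0; lra.
have [v [v0 ev wv]] := compare _ _ _ _ gt mt ew w0 cf.
have [v' [v0' ev' wv']] := compare _ _ _ _ gt' mt' ew' w0' cf'.
have vv' : nrm (v i - v' j) <= e.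
  rewrite -(@ler_pXn2r _ 2%N) ?nnegrE ?snorm_ge0 ?(ltW e0)//.
  apply: le_trans (kobayashi_estimate gt gt' mt mt' del0 da v0 v0' ev ev' iM jM) _.
  rewrite (le_trans _ dD)// /D -mulrA -[X in _ <= X]mulrA -[X in _ <= X]mulrA.
  have /andP[ti0 tiT] := grid_itv gt iM; have /andP[tj0 tjT] := grid_itv gt' jM.
  rewrite ler_pM2l ?(lt_le_trans _ C1)// ler_pM ?expR_ge0//.
  - by have del0' := ltW del0; rewrite !addr_ge0 ?sqr_ge0 ?mulr_ge0 ?sqr_ge0.
  - by rewrite ler_expR ler_pM2l.
  have q1 : (t i - t' j) ^+ 2 <= del ^+ 2.
    by rewrite -real_normK ?num_real// ler_pXn2r ?nnegrE ?(ltW del0)//.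
  have q2 : del ^+ 2 <= del by rewrite expr2 ger_pMl.
  have q3 : del * t i <= del * T by rewrite ler_pM2l.
  have q4 : del * t' j <= del * T by rewrite ler_pM2l.
  lra.
have := wv i iM; have := wv' j jM; rewrite (snormB b (w' j)) => a1 a2.
have := snorm_triang b (v i) (w i) (w' j); have := snorm_triang b (v' j) (v i) (w' j).
have -> : expR (2 * om * T) * (4 * k) =
  expR (2 * om * T) * (2 * k) + expR (2 * om * T) * (2 * k) by ring.
by lra.
Qed.

End TwoGrids.
End EulerEstimates.

(** * Lipschitz approximation in time *)

Section ScalarApprox.
Context (R : realType).
Local Notation leb := (@lebesgue_measure R).
Implicit Types (c : R -> R).

Definition bounded_mfun c :=
  measurable_fun [set: measurableTypeR R] c /\ exists M, forall t, `|c t| <= M.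

Definition lipschitz_fun c := exists l, forall s t, `|c s - c t| <= l * `|s - t|.

Lemma ecvg0_lt (u : nat -> \bar R) (e : R) : u @ \oo --> 0%E -> 0 < e ->
  \forall n \near \oo, (u n < e%:E)%E.
Proof.
move=> u0 e0; have /u0 : nbhs 0%E [set x | (x < e%:E)%E].
  by apply: open_nbhs_nbhs; split => /=; [exact: open_ereal_lt_ereal|rewrite lte_fin].
by [].
Qed.

Lemma harmonic_dnbhs : (fun n : nat => n.+1%:R^-1 : R) @ \oo --> (0 : R)^'.
Proof.
move=> B; rewrite /dnbhs /within/= => B0.
have H : \forall n \near \oo, (n.+1%:R^-1 : R) != 0 -> B (n.+1%:R^-1 : R).
  exact: (@cvg_harmonic R _ B0).
change (\forall n \near \oo, B (n.+1%:R^-1 : R)).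
by apply: filterS H => n; apply; rewrite gt_eqF// invr_gt0.
Qed.

Lemma bounded_mfun_integrable c (B : set R) : bounded_mfun c ->
  compact B -> leb.-integrable B (EFin \o c).
Proof.
move=> [mc [M cM]] cB; have mB : measurable (B : set (measurableTypeR R)) by exact: compact_measurable.
apply: measurable_bounded_integrable => //.
- exact: compact_finite_measure.
- exact: measurable_funTS.
- exists M; split; first exact: num_real.
  by move=> x Mx t _ /=; rewrite (le_trans (cM t))// ltW.
Qed.

Lemma lipschitz_continuous c : lipschitz_fun c -> continuous c.
Proof.
move=> [l cl] t; apply/cvgrPdist_le => e e0; near=> s.
apply: le_trans (cl _ _) _; have l1 : 0 < `|l| + 1 by rewrite ltr_wpDl.
apply: (le_trans (y := (`|l| + 1) * `|t - s|)).
  by rewrite ler_wpM2r// (le_trans (ler_norm l))// lerDl.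
rewrite -ler_pdivlMl//; near: s.
by apply: cvgr_dist_le; [exact: cvg_id|rewrite mulr_gt0// invr_gt0].
Unshelve. all: by end_near. Qed.

Definition primitive c (t : R) : R := (\int[leb]_(s in `[0, t]) c s)%R.

Lemma primitive_lipschitz c M : measurable_fun [set: measurableTypeR R] c ->
  (forall t, `|c t| <= M) -> forall s t, `|primitive c s - primitive c t| <= M * `|s - t|.
Proof.
move=> mc cM.
have M0 : 0 <= M by exact: le_trans (cM 0).
have bc : bounded_mfun c by split => //; exists M.
have ic u : leb.-integrable `[0, u] (EFin \o c).
  by apply: bounded_mfun_integrable => //; exact: segment_compact.
have F0 t : t <= 0 -> primitive c t = 0.
  rewrite le_eqVlt => /predU1P[->|t0]; first by rewrite /primitive set_itv1 Rintegral_set1.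
  by rewrite /primitive set_itv_ge ?Rintegral_set0// bnd_simp -ltNge.
have main s t : 0 <= s -> s <= t -> `|primitive c t - primitive c s| <= M * (t - s).
  move=> s0 st; rewrite /primitive Rintegral_itvB ?bnd_simp//.
  have ist : leb.-integrable `]s, t] (EFin \o c).
    by apply: integrableS (ic t) => //; apply: subset_itvr; rewrite bnd_simp.
  apply: le_trans (le_normr_Rintegral _ ist) _ => //.
  have -> : M * (t - s) = (\int[leb]_(x in `]s, t]) M)%R.
    rewrite Rintegral_cst//= lebesgue_measure_itv/= lte_fin.
    by case: ltgtP st => [||->]//=; rewrite ?subrr ?mulr0//.
  apply: le_Rintegral => //; first exact: integrable_norm.
  apply: (@integrableS _ _ _ leb `[s, t]%classic) => //.
    exact: subset_itv_oc_cc.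
  apply: (@bounded_mfun_integrable (fun=> M)); last exact: segment_compact.
  by split; [exact: measurable_cst|exists `|M|].
have main2 s t : s <= t -> `|primitive c t - primitive c s| <= M * (t - s).
  move=> st; have [s0|s0] := leP 0 s; first exact: main.
  rewrite (F0 s (ltW s0)) -(F0 0 (lexx 0)); have [t0|t0] := leP 0 t.
    by rewrite (le_trans (main _ _ _ t0))// ler_wpM2l// lerB// ltW.
  by rewrite !F0 ?(ltW t0)// subrr normr0 mulr_ge0// subr_ge0.
move=> s t; have [st|/ltW st] := leP s t.
  by rewrite distrC (distrC s) (ger0_norm (x := t - s)) ?subr_ge0// main2.
by rewrite (ger0_norm (x := s - t)) ?subr_ge0// main2.
Qed.

Definition steklov c (h t : R) : R := (primitive c (t + h) - primitive c t) / h.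

Lemma steklov_lipschitz c h : bounded_mfun c -> 0 < h -> lipschitz_fun (steklov c h).
Proof.
move=> [mc [M cM]] h0; have Fl := primitive_lipschitz mc cM.
exists (2 * M / h) => s t; rewrite /steklov -mulrBl normrM.
rewrite [`|h^-1|]ger0_norm ?invr_ge0 ?(ltW h0)// (mulrAC (2 * M)) ler_pM2r ?invr_gt0//.
have := Fl (s + h) (t + h); have := Fl s t.
rewrite (_ : s + h - (t + h) = s - t); last by ring.
rewrite (_ : _ - _ - _ = (primitive c (s + h) - primitive c (t + h)) - (primitive c s - primitive c t)); last by ring.
by have := ler_normB (primitive c (s + h) - primitive c (t + h)) (primitive c s - primitive c t); lra.
Qed.

Lemma steklov_bound c M h t : measurable_fun [set: measurableTypeR R] c ->
  (forall t, `|c t| <= M) -> 0 < h -> `|steklov c h t| <= M.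
Proof.
move=> mc cM h0; have := primitive_lipschitz mc cM (t + h) t.
rewrite addrAC subrr add0r (gtr0_norm h0) /steklov normrM normfV.
by rewrite (gtr0_norm h0) ler_pdivrMr.
Qed.

Lemma steklov_cvg_derivable c t :
  derivable (primitive c) t 1 -> derive1 (primitive c) t = c t ->
  (fun n : nat => steklov c n.+1%:R^-1 t) @ \oo --> c t.
Proof.
move=> dF F't.
have cF : (fun h => h^-1 *: (primitive c (h *: 1 + t) - primitive c t)) @ 0^' --> c t.
  by rewrite -F't derive1E; exact: dF.
have := cvg_comp _ _ harmonic_dnbhs cF; apply: cvg_trans; apply: near_eq_cvg.
by near=> n; rewrite /= /steklov /GRing.scale/= mulr1 mulrC (addrC t).
Unshelve. all: by end_near. Qed.

(** Almost every point is a Lebesgue point. *)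
Lemma steklov_cvg c : bounded_mfun c -> {ae leb, forall t, 0 < t ->
  (fun n : nat => steklov c n.+1%:R^-1 t) @ \oo --> c t}.
Proof.
move=> bc; have [mc _] := bc.
have intc y : leb.-integrable [set` Interval (BLeft 0) (BRight y)] (EFin \o c).
  by apply: bounded_mfun_integrable => //; exact: segment_compact.
have locc : locally_integrable [set: R] c.
  split => //; first exact: openT.
  by move=> K _ cK; have /integrableP[_] := bounded_mfun_integrable bc cK.
have := FTC1 intc locc; apply: filterS.
  exact: (ae_filter_ringOfSetsType leb).
by move=> t /= H t0; have {H}[dF F't] := H t0; exact: steklov_cvg_derivable.
Qed.

(** Steklov means are Lipschitz, obey the bound of [c], and converge at almost
    every point: dominated convergence applies. *)
Lemma lipschitz_approx c (T e : R) : bounded_mfun c -> 0 < e ->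
  exists c', [/\ bounded_mfun c', lipschitz_fun c' &
    (\int[leb]_(t in `]0%R, T]) `|c t - c' t|%:E < e%:E)%E].
Proof.
move=> bc e0; have [mc [M cM]] := bc.
have lc n : lipschitz_fun (steklov c n.+1%:R^-1) by exact: steklov_lipschitz.
have mS n : measurable_fun [set: measurableTypeR R] (steklov c n.+1%:R^-1).
  by apply: continuous_measurable_fun; exact: lipschitz_continuous.
have bS n t : `|steklov c n.+1%:R^-1 t| <= M by exact: steklov_bound.
have [] := @dominated_convergence _ _ _ leb `]0, T]%classic _
  (fun n => EFin \o steklov c n.+1%:R^-1) (EFin \o c) (EFin \o (fun=> M)).
- by [].
- by move=> n; apply/measurable_EFinP; exact: measurable_funTS.
- by apply/measurable_EFinP; exact: measurable_funTS.
- have := steklov_cvg bc; apply: filterS.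
    exact: (ae_filter_ringOfSetsType leb).
  move=> t /= tc; rewrite in_itv/= => /andP[t0 _].
  by apply: cvg_EFin; [exact: nearW|exact: tc].
- apply: (@integrableS _ _ _ leb `[0, T]%classic) => //; first exact: subset_itv_oc_cc.
  apply: (@bounded_mfun_integrable (fun=> M)); last exact: segment_compact.
  by split; [exact: measurable_cst|exists `|M|].
- by apply: aeW => t n _; rewrite lee_fin.
move=> _ + _ => /ecvg0_lt/(_ e0)[n _ /(_ n (leqnn n))] /= ne.
exists (steklov c n.+1%:R^-1); split; [by split; [|exists M]|exact: lc|].
apply: le_lt_trans ne; rewrite le_eqVlt; apply/orP; left; apply/eqP.
by apply: eq_integral => t _; rewrite /= distrC.
Qed.

End ScalarApprox.

Section VectorApprox.
Context (R : realType) (V : lmodType R) (b : semidot V).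
Local Notation leb := (@lebesgue_measure R).
Local Notation nrm := (snorm b).
Local Notation mfunT := (measurable_fun [set: measurableTypeR R]).

(** An inductive presentation of finite sums of scalar functions times
    vectors, so that approximation is done one scalar function at a time. *)
Inductive finite_rank (P : (R -> R) -> Prop) : (R -> V) -> Prop :=
| finite_rank0 : finite_rank P (fun=> 0)
| finite_rankD c v s : P c -> finite_rank P s ->
    finite_rank P (fun t => c t *: v + s t).

Definition strongly_measurable (f : R -> V) :=
  exists2 s : nat -> R -> V, forall k, finite_rank (@bounded_mfun R) (s k) &
    forall t, (fun k => nrm (f t - s k t)) @ \oo --> 0.

Lemma finite_rank_sub s s' : finite_rank (@bounded_mfun R) s ->
  finite_rank (@bounded_mfun R) s' -> finite_rank (@bounded_mfun R) (s \- s').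
Proof.
move=> fs fs'; elim: fs => [|c v {}s cb _ IH].
  elim: fs' => [|c v {}s' cb _ IH].
    by rewrite (_ : _ \- _ = fun=> 0); [constructor|apply/funext => t /=; rewrite subr0].
  rewrite (_ : _ \- _ = fun t => (- c t) *: v + ((fun=> 0) \- s') t).
    constructor => //; have [mc [M cM]] := cb; split; first exact: measurable_funN.
    by exists M => t; rewrite normrN.
  by apply/funext => t /=; rewrite !sub0r opprD scaleNr.
rewrite (_ : _ \- _ = fun t => c t *: v + (s \- s') t); first by constructor.
by apply/funext => t /=; rewrite addrA.
Qed.

Lemma finite_rank_indic (P : R -> bool) s : measurable_fun [set: measurableTypeR R] P ->
  finite_rank (@bounded_mfun R) s ->
  finite_rank (@bounded_mfun R) (fun t => (P t)%:R *: s t).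
Proof.
move=> mP; elim=> [|c v {}s [mc [M cM]] _ IH].
  by under eq_fun do rewrite scaler0; constructor.
rewrite (_ : (fun t => _) = fun t => ((P t)%:R * c t) *: v + (P t)%:R *: s t).
  constructor => //; split.
    rewrite (_ : (fun t => _) = fun t => if P t then c t else 0).
      exact: measurable_fun_ifT.
    by apply/funext => t; case: (P t); rewrite ?mul1r ?mul0r.
  exists M => t; case: (P t); rewrite ?mul1r ?mul0r ?normr0//.
  exact: le_trans (cM t).
by apply/funext => t; rewrite scalerDr scalerA.
Qed.

Lemma finite_rank_measurable_dot s v : finite_rank (@bounded_mfun R) s ->
  mfunT (fun t => b (s t) v).
Proof.
elim=> [|c w {}s [mc _] _ IH].
  by under eq_fun do rewrite dot0l; exact: measurable_cst.
under eq_fun do rewrite dotDl dotZl.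
by apply: measurable_funD => //; apply: measurable_funM.
Qed.

Lemma finite_rank_measurable_snorm s : finite_rank (@bounded_mfun R) s ->
  mfunT (fun t => nrm (s t)).
Proof.
move=> fs; apply: (measurableT_comp (f := @Num.sqrt R)).
  by apply: continuous_measurable_fun; exact: sqrt_continuous.
elim: fs => [|c v {}s [mc cb] fs IH].
  by under eq_fun do rewrite dot0l; exact: measurable_cst.
under eq_fun do rewrite dotDl !dotDr !dotZl !dotZr (dotC b v).
have ms := finite_rank_measurable_dot v fs.
by apply: measurable_funD; apply: measurable_funD => //; apply: measurable_funM => //;
  apply: measurable_funM.
Qed.

Lemma strongly_measurable_sub f s : strongly_measurable f ->
  finite_rank (@bounded_mfun R) s -> strongly_measurable (f \- s).
Proof.
move=> [u fu uf] fs; exists (fun k => u k \- s) => [k|t].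
  exact: finite_rank_sub.
by under eq_fun do rewrite /= opprB addrA subrK; exact: uf.
Qed.

Lemma strongly_measurable_snorm f : strongly_measurable f -> mfunT (fun t => nrm (f t)).
Proof.
move=> [u fu uf]; apply: (measurable_fun_cvg (h := fun k t => nrm (u k t))).
  by move=> k; exact: finite_rank_measurable_snorm.
move=> t _; apply/cvgrPdist_le => e e0.
have := uf t => /cvgrPdist_le/(_ e e0); apply: filterS => k.
rewrite sub0r normrN ger0_norm ?snorm_ge0//; apply: le_trans.
exact: snorm_distB.
Qed.

Lemma finite_rank_strongly_measurable s : finite_rank (@bounded_mfun R) s ->
  strongly_measurable s.
Proof.
move=> fs; exists (fun=> s) => // t; rewrite subrr snorm0; exact: cvg_cst.
Qed.

(** Truncating the approximations where they exceed twice the limit keeps them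
    of finite rank and makes dominated convergence applicable. *)
Lemma finite_rank_approx f (T e : R) : strongly_measurable f ->
  (\int[leb]_(t in `]0%R, T]) (nrm (f t))%:E < +oo)%E -> 0 < e ->
  exists2 s, finite_rank (@bounded_mfun R) s &
    (\int[leb]_(t in `]0%R, T]) (nrm (f t - s t))%:E < e%:E)%E.
Proof.
move=> mf intf e0; have [u fu uf] := mf.
have mnf := strongly_measurable_snorm mf.
pose P k t := nrm (u k t) <= 2 * nrm (f t).
pose s k t := (P k t)%:R *: u k t.
have fs k : finite_rank (@bounded_mfun R) (s k).
  apply: finite_rank_indic => //; apply: measurable_fun_ler.
    exact: finite_rank_measurable_snorm.
  by apply: measurable_funM => //; exact: measurable_cst.
have sf t : (fun k => nrm (f t - s k t)) @ \oo --> 0.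
  have [f0|f0] := eqVneq (nrm (f t)) 0.
    apply: cvg_near_cst; apply: nearW => k; apply/eqP.
    rewrite eq_le snorm_ge0 andbT /s /P f0 mulr0.
    apply: le_trans (snormD _ _ _) _; rewrite f0 add0r snormN.
    by case: (leP (nrm (u k t)) 0) => [|_]; rewrite /= ?mulr1n ?mulr0n ?scale1r// scale0r snorm0.
  apply: cvg_trans (uf t); apply: near_eq_cvg.
  have f0' : 0 < nrm (f t) by rewrite lt_def f0 snorm_ge0.
  have := uf t => /cvgrPdist_le/(_ _ f0'); apply: filterS => k.
  rewrite sub0r normrN ger0_norm ?snorm_ge0// => uk; rewrite /s /P.
  suff -> : nrm (u k t) <= 2 * nrm (f t) by rewrite /= mulr1n scale1r.
  have := snormD b (f t) (u k t - f t).
  by rewrite subrKC (snormB b (u k t)); lra.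
have sb k t : nrm (f t - s k t) <= 3 * nrm (f t).
  apply: le_trans (snormD _ _ _) _; rewrite snormN /s /P.
  have := snorm_ge0 b (f t).
  by case: (leP (nrm (u k t)) (2 * nrm (f t))) => [uf2|_]; rewrite /= ?mulr1n ?mulr0n ?scale1r ?scale0r ?snorm0; lra.
have [] := @dominated_convergence _ _ _ leb `]0, T]%classic _
  (fun n => EFin \o (fun t => nrm (f t - s n t))) (EFin \o (fun=> 0))
  (EFin \o (fun t => 3 * nrm (f t))).
- by [].
- move=> n; apply/measurable_EFinP; apply: measurable_funTS.
  by apply: strongly_measurable_snorm; exact: strongly_measurable_sub.
- exact: measurable_cst.
- by apply: aeW => t _; apply: cvg_EFin; [exact: nearW|exact: sf].
- rewrite (_ : EFin \o _ = fun t => (3%:E * (nrm (f t))%:E)%E).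
    apply: integrableZl => //; apply/integrableP; split.
      by apply/measurable_EFinP; exact: measurable_funTS.
    by under eq_integral do rewrite gee0_abs ?lee_fin ?snorm_ge0//.
  by apply/funext => t; rewrite -EFinM.
- apply: aeW => t n _ /=; rewrite lee_fin ger0_norm ?snorm_ge0//; exact: sb.
move=> _ + _ => /ecvg0_lt/(_ e0)[n _ /(_ n (leqnn n))] /= ne.
exists (s n) => //; apply: le_lt_trans ne; rewrite le_eqVlt; apply/orP; left; apply/eqP.
by apply: eq_integral => t _; rewrite /= subr0 ger0_norm// snorm_ge0.
Qed.

Lemma finite_rank_lipschitz_approx s (T e : R) :
  finite_rank (@bounded_mfun R) s -> 0 < e ->
  exists g, [/\ finite_rank (@bounded_mfun R) g,
    exists2 l, 0 <= l & forall s t, nrm (g s - g t) <= l * `|s - t| &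
    (\int[leb]_(t in `]0%R, T]) (nrm (s t - g t))%:E < e%:E)%E].
Proof.
move=> fs; elim: fs e => [|c v {}s bc fs IH] e e0.
  exists (fun=> 0); split; first by constructor.
    by exists 0 => // p q; rewrite subrr snorm0 mul0r.
  by under eq_integral do rewrite subrr snorm0; rewrite integral0 lte_fin.
have e2 : 0 < e / 2 by rewrite divr_gt0.
have [g [fg [l l0 gl] gs]] := IH _ e2.
have nv : 0 < nrm v + 1 by rewrite ltr_wpDl ?snorm_ge0.
have [c' [bc' [l' cl'] cc']] := lipschitz_approx (c := c) T bc (divr_gt0 e2 nv).
exists (fun t => c' t *: v + g t); split.
- by constructor.
- exists (`|l'| * nrm v + l) => [|p q].
    by rewrite addr_ge0 ?mulr_ge0 ?snorm_ge0.
  rewrite (_ : _ - _ = (c' p - c' q) *: v + (g p - g q)); last first.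
    by rewrite scalerBl opprD addrACA.
  apply: le_trans (snormD _ _ _) _; rewrite mulrDl lerD// snormZ mulrAC.
  rewrite ler_wpM2r ?snorm_ge0// (le_trans (cl' _ _))//.
  by rewrite ler_wpM2r// ler_norm.
have mc : mfunT (fun t => `|c t - c' t|).
  apply: measurableT_comp => //; apply: measurable_funB; first by case: bc.
  by case: bc'.
have msg : mfunT (fun t => nrm (s t - g t)).
  apply: strongly_measurable_snorm; apply: strongly_measurable_sub => //.
  exact: finite_rank_strongly_measurable.
have mn : mfunT (fun t => nrm (c t *: v + s t - (c' t *: v + g t))).
  apply: (strongly_measurable_snorm (f := (fun t => c t *: v + s t) \- (fun t => c' t *: v + g t))).
  apply: strongly_measurable_sub; last by constructor.
  by apply: finite_rank_strongly_measurable; constructor.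
apply: (@le_lt_trans _ _ (\int[leb]_(t in `]0%R, T])
  ((nrm v + 1)%:E * `|c t - c' t|%:E + (nrm (s t - g t))%:E))%E).
  apply: ge0_le_integral => //.
  - by move=> t _; rewrite lee_fin snorm_ge0.
  - by apply/measurable_EFinP; exact: measurable_funTS.
  - apply: emeasurable_funD.
      by apply: measurable_funeM; apply/measurable_EFinP; exact: measurable_funTS.
    by apply/measurable_EFinP; exact: measurable_funTS.
  move=> t _; rewrite -EFinM -EFinD lee_fin.
  rewrite (_ : _ - _ = (c t - c' t) *: v + (s t - g t)); last first.
    by rewrite scalerBl opprD addrACA.
  apply: le_trans (snormD _ _ _) _; rewrite lerD2r snormZ mulrC.
  by rewrite ler_wpM2r// lerDl.
rewrite ge0_integralD//; last 4 first.
- by move=> t _; rewrite mule_ge0// lee_fin ltW.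
- by apply: measurable_funeM; apply/measurable_EFinP; exact: measurable_funTS.
- by move=> t _; rewrite lee_fin snorm_ge0.
- by apply/measurable_EFinP; exact: measurable_funTS.
apply: (@lt_le_trans _ _ ((e / 2)%:E + (e / 2)%:E)%E); last by rewrite -EFinD -splitr.
apply: lteD => //; rewrite ge0_integralZl//; last 2 first.
- by apply/measurable_EFinP; exact: measurable_funTS.
- by rewrite lee_fin ltW.
have -> : e / 2 = (nrm v + 1) * (e / 2 / (nrm v + 1)) by field; rewrite gt_eqF.
by rewrite EFinM lte_pmul2l.
Qed.

Lemma strongly_measurable_lipschitz_approx f (T e : R) : strongly_measurable f ->
  (\int[leb]_(t in `]0%R, T]) (nrm (f t))%:E < +oo)%E -> 0 < e ->
  exists g, [/\ finite_rank (@bounded_mfun R) g,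
    exists2 l, 0 <= l & forall s t, nrm (g s - g t) <= l * `|s - t| &
    (\int[leb]_(t in `]0%R, T]) (nrm (f t - g t))%:E < e%:E)%E].
Proof.
move=> mf intf e0; have e2 : 0 < e / 2 by rewrite divr_gt0.
have [s fs sf] := finite_rank_approx mf intf e2.
have [g [fg lg gs]] := finite_rank_lipschitz_approx T fs e2.
exists g; split => //.
have ms : mfunT (fun t => nrm (f t - s t)).
  by apply: strongly_measurable_snorm; exact: strongly_measurable_sub.
have mg : mfunT (fun t => nrm (f t - g t)).
  by apply: strongly_measurable_snorm; exact: strongly_measurable_sub.
have msg : mfunT (fun t => nrm (s t - g t)).
  apply: strongly_measurable_snorm; apply: strongly_measurable_sub => //.
  exact: finite_rank_strongly_measurable.
apply: (@le_lt_trans _ _ (\int[leb]_(t in `]0%R, T])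
  ((nrm (f t - s t))%:E + (nrm (s t - g t))%:E))%E).
  apply: ge0_le_integral => //.
  - by move=> t _; rewrite lee_fin snorm_ge0.
  - by apply/measurable_EFinP; exact: measurable_funTS.
  - by apply: emeasurable_funD; apply/measurable_EFinP; exact: measurable_funTS.
  - by move=> t _; rewrite -EFinD lee_fin snorm_triang.
rewrite ge0_integralD//; last 4 first.
- by move=> t _; rewrite lee_fin snorm_ge0.
- by apply/measurable_EFinP; exact: measurable_funTS.
- by move=> t _; rewrite lee_fin snorm_ge0.
- by apply/measurable_EFinP; exact: measurable_funTS.
apply: (@lt_le_trans _ _ ((e / 2)%:E + (e / 2)%:E)%E); last by rewrite -EFinD -splitr.
exact: lteD.
Qed.

End VectorApprox.

(** * Mild solutions of dissipative evolution equations *)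

Section GridIntegral.
Context (R : realType).
Local Notation leb := (@lebesgue_measure R).

Lemma integral_itv_cat (F : R -> R) (a m c : R) :
  measurable_fun [set: measurableTypeR R] F -> (forall t, 0 <= F t) ->
  a <= m -> m <= c ->
  (\int[leb]_(t in `]a, c]) (F t)%:E =
   \int[leb]_(t in `]a, m]) (F t)%:E + \int[leb]_(t in `]m, c]) (F t)%:E)%E.
Proof.
move=> mF F0 am mc; rewrite (@itv_bndbnd_setU _ _ (BRight a) (BRight m)) ?bnd_simp//.
rewrite ge0_integral_setU//=.
- by apply: measurable_funTS; apply/measurable_EFinP.
- by move=> t _; rewrite lee_fin.
apply/disj_setPS => t []/=; rewrite !in_itv/= => /andP[_ tm] /andP[mt _].
by have := lt_le_trans mt tm; rewrite ltxx.
Qed.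

Lemma grid_integral (F : R -> R) (M : nat) (t : nat -> R) :
  measurable_fun [set: measurableTypeR R] F -> (forall t, 0 <= F t) ->
  (forall i, (i < M)%N -> t i < t i.+1) ->
  (\sum_(i < M) \int[leb]_(s in `]t i, t i.+1]) (F s)%:E =
   \int[leb]_(s in `]t 0%N, t M]) (F s)%:E)%E.
Proof.
move=> mF F0; elim: M => [|M IH] tM.
  by rewrite big_ord0 set_itvoc0 integral_set0.
rewrite big_ord_recr/= IH => [|i iM]; last by rewrite tM// ltnW.
rewrite -integral_itv_cat//; last by rewrite ltW// tM.
by apply: (grid_ge (M := M)); rewrite ?leqnn// => i iM; rewrite tM// ltnW.
Qed.

Lemma integral_cst_itv (a c k : R) : a <= c ->
  (\int[leb]_(s in `]a, c]) k%:E = ((c - a) * k)%:E)%E.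
Proof.
move=> ac; rewrite integral_cst//= lebesgue_measure_itv/= lte_fin.
case: ltgtP ac => // [ac|->] _; first by rewrite -EFinD -EFinM mulrC.
by rewrite mule0 subrr mul0r.
Qed.

End GridIntegral.

Section Approximation.
Context (R : realType) (V : lmodType R) (b : semidot V).
Variables (A : V -> V -> Prop) (f : R -> V) (x0 : V).
Local Notation leb := (@lebesgue_measure R).
Local Notation nrm := (snorm b).

(** A single parameter [del] controls the mesh, the defect of the forcing and
    the initial error; the horizon is [t M]. *)
Definition approximation (del : R) (M : nat) (t : nat -> R) (fi w : nat -> V) :=
  [/\ t 0%N = 0 /\ forall i, (i < M)%N -> t i < t i.+1 /\ t i.+1 - t i <= del,
      euler b A M t fi w,
      (\sum_(i < M) \int[leb]_(s in `]t i, t i.+1]) (nrm (f s - fi i.+1))%:E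
        <= del%:E)%E &
      nrm (w 0%N - x0) <= del].

Lemma approximation_restrict del M t fi w i : (i <= M)%N ->
  approximation del M t fi w -> approximation del i t fi w.
Proof.
move=> iM [[t0 tM] ew sM w0]; split => //.
- by split=> // j ji; apply: tM; exact: leq_trans iM.
- by move=> j ji; apply: ew; exact: leq_trans iM.
apply: le_trans sM; apply: (@lee_sum_nneg_ord R
  (fun i => \int[leb]_(s in `]t i, t i.+1]) (nrm (f s - fi i.+1))%:E)%E xpredT) => // n _.
by apply: integral_ge0 => s _; rewrite lee_fin snorm_ge0.
Qed.

Lemma approximation_le del del' M t fi w : del <= del' ->
  approximation del M t fi w -> approximation del' M t fi w.
Proof.
move=> dd [[t0 tM] ew sw w0]; split => //; last exact: le_trans dd.
- by split=> // i /tM[ti d]; split=> //; exact: le_trans dd.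
- by rewrite (le_trans sw)// lee_fin.
Qed.

(** A curve to which all fine approximate solutions are close, uniformly on
    bounded time intervals. The time [s] may differ slightly from the grid
    point [t i], so that the definition contains the continuity of [X]. *)
Definition mild_curve (X : R -> V) := forall T e, 0 < T -> 0 < e ->
  exists2 del, 0 < del & forall M t fi w, approximation del M t fi w ->
    forall i s, (i <= M)%N -> 0 <= s -> s <= T -> t i <= T -> `|s - t i| <= del ->
      nrm (X s - w i) <= e.

Lemma finite_rank_cst (v : V) : finite_rank (@bounded_mfun R) (fun=> v).
Proof.
rewrite (_ : (fun=> v) = fun t => 1 *: v + (fun=> 0) t); last first.
  by apply/funext => t; rewrite scale1r addr0.
constructor; last exact: finite_rank0.
split; first exact: measurable_cst.
by exists 1 => t; rewrite normr1.
Qed.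

Hypothesis f_meas : strongly_measurable b f.

Lemma measurable_snormB s : finite_rank (@bounded_mfun R) s ->
  measurable_fun [set: measurableTypeR R] (fun t => nrm (f t - s t)).
Proof.
by move=> fs; apply: strongly_measurable_snorm; exact: strongly_measurable_sub.
Qed.

Section LipschitzData.
Variables (g : R -> V) (l : R).
Hypotheses (g_rank : finite_rank (@bounded_mfun R) g) (l0 : 0 <= l)
  (g_lip : forall s t, nrm (g s - g t) <= l * `|s - t|).

Let mfg := measurable_snormB g_rank.
Let mfc v := measurable_snormB (finite_rank_cst v).

Let mE (D : set R) (h : R -> R) : measurable_fun [set: measurableTypeR R] h ->
  measurable_fun (D : set (measurableTypeR R)) (EFin \o h).
Proof. by move=> mh; apply: measurable_funTS; exact/measurable_EFinP. Qed.

Lemma integral_snormB_le a c : a <= c ->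
  (\int[leb]_(s in `]a, c]) (nrm (f s - g c))%:E <=
   \int[leb]_(s in `]a, c]) (nrm (f s - g s))%:E + ((c - a) * (l * (c - a)))%:E)%E.
Proof.
move=> ac; rewrite -integral_cst_itv// -ge0_integralD//; last 3 first.
- by move=> s _; rewrite lee_fin snorm_ge0.
- exact: mE.
- by move=> s _; rewrite lee_fin mulr_ge0 ?subr_ge0.
apply: ge0_le_integral => //.
- by move=> s _; rewrite lee_fin snorm_ge0.
- exact: mE (mfc (g c)).
- by apply: emeasurable_funD; [exact: mE|exact: measurable_cst].
move=> s /=; rewrite in_itv/= => /andP[sa sc]; rewrite -EFinD lee_fin.
rewrite (le_trans (snorm_triang b (g s) _ _))// lerD2l (le_trans (g_lip _ _))//.
by rewrite ler_wpM2l// ler_norml; apply/andP; split; lra.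
Qed.

Lemma snormB_le_integral a c v : a <= c ->
  (((c - a) * nrm (v - g c))%:E <=
   \int[leb]_(s in `]a, c]) (nrm (f s - v))%:E +
   (\int[leb]_(s in `]a, c]) (nrm (f s - g s))%:E + ((c - a) * (l * (c - a)))%:E))%E.
Proof.
move=> ac; apply: le_trans (leeD (lexx _) (integral_snormB_le ac)).
rewrite -integral_cst_itv// -ge0_integralD//; last 4 first.
- by move=> s _; rewrite lee_fin snorm_ge0.
- exact: mE (mfc v).
- by move=> s _; rewrite lee_fin snorm_ge0.
- exact: mE (mfc (g c)).
apply: ge0_le_integral => //.
- by move=> s _; rewrite lee_fin snorm_ge0.
- by apply: emeasurable_funD; [exact: mE (mfc v)|exact: mE (mfc (g c))].
move=> s _; rewrite -EFinD lee_fin (snormB b (f s) v).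
exact: snorm_triang.
Qed.

Variables (T del : R) (M : nat) (t : nat -> R).
Hypotheses (gt : grid T M t) (del0 : 0 < del)
  (mt : forall i, (i < M)%N -> t i.+1 - t i <= del).

Let mesh_sum : (\sum_(i < M) ((t i.+1 - t i) * (l * (t i.+1 - t i)))%:E
  <= (l * del * T)%:E)%E.
Proof.
have [t0 [tM tlt]] := gt.
rewrite sumEFin lee_fin (le_trans (y := \sum_(i < M) (t i.+1 - t i) * (l * del)))//.
  apply: ler_sum => i _; rewrite ler_wpM2l ?subr_ge0 ?(ltW (tlt _ _))//.
  by rewrite ler_wpM2l// mt.
rewrite -mulr_suml -(big_mkord xpredT (fun j => t j.+1 - t j)) telescope_sumr//.
by rewrite t0 subr0 mulrC ler_wpM2l// mulr_ge0// ltW.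
Qed.

Let fg_sum : (\sum_(i < M) \int[leb]_(s in `]t i, t i.+1]) (nrm (f s - g s))%:E
  <= \int[leb]_(s in `]0%R, T]) (nrm (f s - g s))%:E)%E.
Proof.
have [t0 [tM tlt]] := gt.
rewrite grid_integral//; last by move=> s; exact: snorm_ge0.
rewrite t0; apply: ge0_subset_integral => //=.
- exact: mE.
- by move=> s _; rewrite lee_fin snorm_ge0.
- by apply: subset_itvl; rewrite bnd_simp.
Qed.

Lemma consistency_bound fi :
  ((consistency b M t fi (g \o t))%:E <=
   \sum_(i < M) \int[leb]_(s in `]t i, t i.+1]) (nrm (f s - fi i.+1))%:E +
   (\int[leb]_(s in `]0%R, T]) (nrm (f s - g s))%:E + (l * del * T)%:E))%E.
Proof.
have [t0 [tM tlt]] := gt.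
rewrite /consistency -sumEFin.
apply: le_trans (leeD (lexx _) (leeD fg_sum mesh_sum)).
rewrite -!big_split/=; apply: lee_sum => i _.
by apply: snormB_le_integral; rewrite ltW// tlt.
Qed.

Lemma sampling_bound :
  (\sum_(i < M) \int[leb]_(s in `]t i, t i.+1]) (nrm (f s - g (t i.+1)))%:E <=
   \int[leb]_(s in `]0%R, T]) (nrm (f s - g s))%:E + (l * del * T)%:E)%E.
Proof.
have [t0 [tM tlt]] := gt.
apply: le_trans (leeD fg_sum mesh_sum).
rewrite -!big_split/=; apply: lee_sum => i _.
by apply: integral_snormB_le; rewrite ltW// tlt.
Qed.

End LipschitzData.

Variable (om h0 : R).
Hypotheses (om0 : 0 <= om) (A_diss : dissipative b om A) (h00 : 0 < h0)
  (A_range : forall h v u, 0 < h < h0 -> exists x, euler_step b A h v u x)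
  (A_dense : forall v e, 0 < e -> exists x y, A x y /\ nrm (x - v) <= e)
  (f_int : forall T, (\int[leb]_(t in `]0%R, T]) (nrm (f t))%:E < +oo)%E).

(** Replace [f] by Lipschitz data close to it in [L^1], and sample these on a
    uniform grid. *)
Lemma approximation_exists T del : 0 < T -> 0 < del ->
  exists M t fi w, approximation del M t fi w /\ t M = T.
Proof.
move=> T0 del0; have d2 : 0 < del / 2 by rewrite divr_gt0.
have [x [y [Axy xx0]]] := A_dense x0 del0.
have [g [fg [l l0 gl] fgT]] := strongly_measurable_lipschitz_approx f_meas (f_int T) d2.
have dl : 0 < del / (2 * (l * T + 1)).
  by rewrite divr_gt0// mulr_gt0// ltr_wpDl// mulr_ge0// ltW.
pose d := Num.min (Num.min del (h0 / 2)) (del / (2 * (l * T + 1))).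
have d0 : 0 < d by rewrite /d !lt_min del0 divr_gt0.
have d1 : d <= Num.min del (h0 / 2) by rewrite /d ge_min lexx.
have dd : d <= del / (2 * (l * T + 1)) by rewrite /d ge_min lexx orbT.
move: d1; rewrite le_min => /andP[d1 dh].
pose N := Num.Def.archi_bound (T / d); pose h := T / N.+1%:R.
have h_gt0 : 0 < h by rewrite divr_gt0.
have hd : h <= d.
  rewrite /h ler_pdivrMr// mulrC -ler_pdivrMr//.
  have := archi_boundP (ltW (divr_gt0 T0 d0)); rewrite -/N => /ltW/le_trans; apply.
  by rewrite ler_nat.
pose t i : R := i%:R * h.
have tS i : t i.+1 - t i = h by rewrite /t -mulrBl -natrB// subSnn mul1r.
have tT : t N.+1 = T by rewrite /t /h mulrC divfK.
have gt : grid T N.+1 t.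
  split; first by rewrite /t mul0r.
  by rewrite tT; split=> // i _; rewrite -subr_gt0 tS.
have [|w w0 ew] := euler_exists (M := N.+1) (t := t) (g \o t) x A_range.
  by move=> i iN; split; [rewrite -subr_gt0 tS|rewrite tS; lra].
exists N.+1, t, (g \o t), w; split => //; split => //; last by rewrite w0.
- split; first by rewrite /t mul0r.
  by move=> i _; rewrite -subr_gt0 tS h_gt0; split => //; lra.
- have mt i : (i < N.+1)%N -> t i.+1 - t i <= d by rewrite tS.
  apply: le_trans (sampling_bound fg l0 gl gt d0 mt) _.
  apply: (@le_trans _ _ ((del / 2)%:E + (del / 2)%:E)%E); last by rewrite -EFinD -splitr.
  apply: leeD; first exact: ltW.
  rewrite lee_fin mulrAC.
  have lT0 : 0 <= l * T by rewrite mulr_ge0// ltW.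
  apply: (le_trans (y := (l * T + 1) * (del / (2 * (l * T + 1))))).
    by rewrite ler_pM// ?lerDl// ltW.
  rewrite le_eqVlt; apply/orP; left; apply/eqP; field.
  by rewrite gt_eqF// ltr_wpDl.
Qed.

(** Choose an initial value in the domain and Lipschitz data close to [x0] and
    [f], once and for all: every approximate solution is a scheme whose data
    are close to these. *)
Lemma approximation_close T e : 0 < T -> 0 < e ->
  exists2 del, 0 < del & forall M t fi w M' t' fi' w',
    approximation del M t fi w -> approximation del M' t' fi' w' ->
    forall i j, (i <= M)%N -> (j <= M')%N -> t i <= T -> t' j <= T ->
      `|t i - t' j| <= del -> nrm (w i - w' j) <= e.
Proof.
move=> T0 e0; set K := expR (2 * om * T).
have K0 : 0 < K by exact: expR_gt0.
pose k := e / (8 * K); have k0 : 0 < k by rewrite divr_gt0// mulr_gt0.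
have k2 : 0 < k / 2 by rewrite divr_gt0.
have k4 : 0 < k / 4 by rewrite divr_gt0.
have e2 : 0 < e / 2 by rewrite divr_gt0.
have [x [y [Axy xx0]]] := A_dense x0 k2.
have [g [fg [l l0 gl] fgT]] := strongly_measurable_lipschitz_approx f_meas (f_int T) k4.
have gl' s t : 0 <= s <= T -> 0 <= t <= T -> nrm (g s - g t) <= l * `|s - t|.
  by move=> _ _; exact: gl.
have [d1 d10 close] := euler_close om0 A_diss Axy l0 T0 gl' h00 e2 A_range.
have lT0 : 0 <= l * T by rewrite mulr_ge0// ltW.
have lT1 : 0 < l * T + 1 by rewrite ltr_wpDl.
pose del := Num.min d1 (Num.min (k / 4) (k / (4 * (l * T + 1)))).
have del0 : 0 < del by rewrite /del !lt_min d10 k4 divr_gt0// mulr_gt0.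
have [dd1 dk dl] : [/\ del <= d1, del <= k / 4 & l * del * T <= k / 4].
  have dd1 : del <= d1 by rewrite /del ge_min lexx.
  have : del <= Num.min (k / 4) (k / (4 * (l * T + 1))) by rewrite /del ge_min lexx orbT.
  rewrite le_min => /andP[dk dl]; split => //.
  rewrite mulrAC (le_trans (y := (l * T + 1) * (k / (4 * (l * T + 1)))))//.
    by rewrite ler_pM// ?lerDl// ltW.
  rewrite le_eqVlt; apply/orP; left; apply/eqP; field.
  by rewrite gt_eqF.
exists del => // M t fi w M' t' fi' w' ap ap' i j iM jM tiT tjT tij.
have cons N s a u : s N <= T -> approximation del N s a u ->
    [/\ grid T N s, forall i, (i < N)%N -> s i.+1 - s i <= d1, euler b A N s a u,
     nrm (u 0%N - x) <= k & consistency b N s a (g \o s) <= k].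
  move=> sN [[s0 slt] eu cs u0].
  have gs : grid T N s by split=> //; split=> // p /slt[].
  have ms p : (p < N)%N -> s p.+1 - s p <= del by move=> /slt[].
  split=> // [p pN||].
  - by rewrite (le_trans (ms _ pN)).
  - have := snorm_triang b x0 (u 0%N) x; rewrite (snormB b x0); lra.
  have := consistency_bound fg l0 gl gs del0 ms a.
  move/le_trans => /(_ (k / 4 + (k / 4 + k / 4))%:E); rewrite lee_fin => H.
  apply: le_trans (H _) _; last by lra.
  rewrite !EFinD; apply: leeD; first by rewrite (le_trans cs)// lee_fin.
  by apply: leeD; [exact: ltW|rewrite lee_fin].
have [g1 m1 e1 w1 c1] := cons _ _ _ _ tiT (approximation_restrict iM ap).
have [g2 m2 e2' w2 c2] := cons _ _ _ _ tjT (approximation_restrict jM ap').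
apply: le_trans (close _ _ _ _ _ _ _ _ _ g1 g2 m1 m2 e1 e2' w1 w2 c1 c2
  i j (leqnn _) (leqnn _) _) _.
  exact: le_trans tij dd1.
rewrite -/K le_eqVlt; apply/orP; left; apply/eqP.
by rewrite /k; field; rewrite gt_eqF.
Qed.

End Approximation.

Section MildSolution.
Context (R : realType) (V : lmodType R) (b : semidot V).
Variables (A : V -> V -> Prop) (f : R -> V) (x0 : V) (om h0 : R).
Local Notation leb := (@lebesgue_measure R).
Local Notation nrm := (snorm b).
Hypotheses (om0 : 0 <= om) (A_diss : dissipative b om A) (h00 : 0 < h0)
  (A_range : forall h v u, 0 < h < h0 -> exists x, euler_step b A h v u x)
  (A_dense : forall v e, 0 < e -> exists x y, A x y /\ nrm (x - v) <= e)
  (f_meas : strongly_measurable b f)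
  (f_int : forall T, (\int[leb]_(t in `]0%R, T]) (nrm (f t))%:E < +oo)%E)
  (V_complete : forall u : nat -> V,
    (forall e, 0 < e -> exists N, forall n m, (N <= n)%N -> (N <= m)%N -> nrm (u n - u m) <= e) ->
    exists x, forall e, 0 < e -> exists N, forall n, (N <= n)%N -> nrm (u n - x) <= e).

Lemma grid_cover M (t : nat -> R) s : t 0%N = 0 -> 0 <= s <= t M ->
  s = 0 \/ exists2 i, (i < M)%N & t i < s <= t i.+1.
Proof.
move=> t0; elim: M => [|M IH].
  by rewrite t0 -eq_le => /eqP <-; left.
move=> /andP[s0 sM]; have [sM'|sM'] := leP s (t M).
  have [|->|[i iM si]] := IH; [by rewrite s0|by left|].
  by right; exists i => //; exact: ltnW.
by right; exists M; rewrite ?sM'.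
Qed.

Lemma approximation_index del M t fi w s : 0 < del ->
  approximation b A f x0 del M t fi w -> 0 <= s <= t M ->
  exists2 i, (i <= M)%N & s <= t i <= s + del.
Proof.
move=> del0 [[t0 tM] _ _ _] /(grid_cover t0)[->|[i iM /andP[ts st]]].
  by exists 0%N => //; rewrite t0 lexx add0r ltW.
by exists i.+1 => //; rewrite st; have [_] := tM _ iM; lra.
Qed.

(** Approximate solutions form a Cauchy family by [approximation_close]; their
    limit along a sequence is then close to all of them. *)
Lemma mild_limit : exists X : R -> V, mild_curve b A f x0 X.
Proof.
have /choice[ap apP] : forall n : nat, exists p : nat * (nat -> R) * (nat -> V) * (nat -> V),
    approximation b A f x0 n.+1%:R^-1 p.1.1.1 p.1.1.2 p.1.2 p.2 /\ p.1.1.2 p.1.1.1 = n.+1%:R.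
  move=> n; have n0 : 0 < n.+1%:R^-1 :> R by rewrite invr_gt0.
  have [M [t [fi [w [aw tM]]]]] :=
    approximation_exists x0 f_meas h00 A_range A_dense f_int (ltr0Sn R n) n0.
  by exists (M, t, fi, w).
(* [u (s, n)] is the value of the [n]-th approximate solution at a grid point
   just after [s]. *)
have /choice[u uP] : forall sn : R * nat, exists v : V, 0 <= sn.1 <= sn.2.+1%:R ->
    exists i, [/\ (i <= (ap sn.2).1.1.1)%N, v = (ap sn.2).2 i &
      sn.1 <= (ap sn.2).1.1.2 i <= sn.1 + sn.2.+1%:R^-1].
  move=> [s n] /=; have [sn|_] := boolP (0 <= s <= n.+1%:R); last by exists 0.
  have [apn tM] := apP n.
  have n0 : 0 < n.+1%:R^-1 :> R by rewrite invr_gt0.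
  have [|i iM si] := @approximation_index _ _ _ _ _ s n0 apn; first by rewrite tM.
  by exists ((ap n).2 i) => _; exists i.
have arch (x : R) : exists N : nat, forall n, (N <= n)%N -> x <= n.+1%:R.
  exists (Num.Def.archi_bound `|x|) => n Nn.
  rewrite (le_trans (ler_norm x))// (le_trans (ltW (archi_boundP (normr_ge0 x))))//.
  by rewrite ler_nat ltnW.
have ucl T e : 0 < T -> 0 < e -> exists2 del, 0 < del & exists N, forall n M t fi w,
    (N <= n)%N -> approximation b A f x0 del M t fi w ->
    forall i s, (i <= M)%N -> 0 <= s -> s <= T -> t i <= T -> `|s - t i| <= del ->
      nrm (u (s, n) - w i) <= e.
  move=> T0 e0.
  have T1 : 0 < T + 1 by rewrite addr_gt0.
  have [del del0 close] := approximation_close x0 f_meas om0 A_diss h00 A_range A_dense f_int T1 e0.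
  have [N1 N1P] := arch (2 / del); have [N2 N2P] := arch T.
  exists (del / 2); first by rewrite divr_gt0.
  exists (maxn N1 N2) => n M t fi w; rewrite geq_max => /andP[Nn1 Nn2] aw i s iM s0 sT tiT sti.
  have n0 : 0 < n.+1%:R^-1 :> R by rewrite invr_gt0.
  have nd : n.+1%:R^-1 <= del / 2 :> R.
    rewrite -[del / 2]invrK lef_pV2 ?posrE ?invr_gt0 ?divr_gt0//.
    by rewrite invfM invrK mulrC N1P.
  have n1 : n.+1%:R^-1 <= 1 :> R by rewrite invf_le1// ler1n.
  have [|j [jM -> /= /andP[sj js]]] := uP (s, n); first by rewrite /= s0 (le_trans sT)// N2P.
  have [apn _] := apP n.
  move: (n.+1%:R^-1 : R) n0 nd n1 js apn => q n0 nd n1 js apn.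
  apply: (close _ _ _ _ _ _ _ _ (approximation_le _ apn) (approximation_le _ aw)) => //; try lra.
  move: sti; rewrite !ler_norml => /andP[? ?]; apply/andP; split; lra.
have /choice[X XP] : forall s : R, exists x : V, 0 <= s ->
    forall e, 0 < e -> exists N, forall n, (N <= n)%N -> nrm (u (s, n) - x) <= e.
  move=> s; have [s0|s0] := leP 0 s; last by exists 0.
  have [|x xP] := V_complete (u := fun n => u (s, n)); last by exists x.
  move=> e e0; have T0 : 0 < s + 1 by rewrite ltr_wpDl.
  have [del del0 [N ucl']] := ucl _ _ T0 e0.
  have [N1 N1P] := arch del^-1; have [N2 N2P] := arch s.
  exists (maxn N (maxn N1 N2)) => n m; rewrite !geq_max => /and3P[Nn _ _] /and3P[Nm N1m N2m].
  have [apm _] := apP m.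
  have m0 : 0 < m.+1%:R^-1 :> R by rewrite invr_gt0.
  have md : m.+1%:R^-1 <= del :> R.
    by rewrite -[del]invrK lef_pV2 ?posrE ?invr_gt0// N1P.
  have m1 : m.+1%:R^-1 <= 1 :> R by rewrite invf_le1// ler1n.
  have [|j [jM -> /= /andP[sj js]]] := uP (s, m); first by rewrite /= s0 N2P.
  move: (m.+1%:R^-1 : R) m0 md m1 js apm => q m0 md m1 js apm.
  apply: (ucl' _ _ _ _ _ _ (approximation_le md apm)) => //; try lra.
  by rewrite ler_norml; apply/andP; split; lra.
exists X => T e T0 e0; have e2 : 0 < e / 2 by rewrite divr_gt0.
have [del del0 [N uX]] := ucl _ _ T0 e2.
exists del => // M t fi w aw i s iM s0 sT tiT sti.
have [N' XN] := XP _ s0 _ e2.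
have := uX (maxn N N') M t fi w (leq_maxl _ _) aw i s iM s0 sT tiT sti.
have := XN _ (leq_maxr N N'); rewrite (snormB b _ (X s)).
have := snorm_triang b (u (s, maxn N N')) (X s) (w i); lra.
Qed.

End MildSolution.

(** * Square-integrable functions on the unit interval *)

Section SquareIntegrable.
Context (R : realType).
Local Notation leb := (@lebesgue_measure R).
Local Notation D := (`]0%R, 1%R[%classic : set (measurableTypeR R)).
Implicit Types (x y p : R -> R).

Definition sqint x := measurable_fun D x /\ leb.-integrable D (EFin \o (fun z => x z ^+ 2)).

Let mD : measurable D. Proof. exact: measurable_itv. Qed.

Lemma unit_itv_measure : leb D = 1%E.
Proof. by rewrite lebesgue_measure_itv/= lte_fin ltr01 sube0. Qed.

Lemma Lfun2P x : (x \_ `]0, 1[%classic : R -> R) \in Lfun leb 2%:E <-> sqint x.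
Proof.
split=> [xL|[mx ix]].
  have ix := Lfun2_integrable_sqr xL; move: xL; rewrite inE => /andP[].
  rewrite inE/= => mx _; split; first exact/(measurable_restrictT _ mD).
  apply/(integrable_mkcond (EFin \o _) mD).
  apply: eq_integrable ix => // z _.
  by rewrite /= !patchE; case: ifPn => // _; rewrite expr0n.
rewrite inE; apply/andP; rewrite !inE/=; split; first exact/(measurable_restrictT _ mD).
rewrite /finite_norm unlock; apply: poweR_lty.
have /integrableP[_] := ix; apply: le_lt_trans; rewrite [leRHS]integral_mkcond.
rewrite le_eqVlt; apply/orP; left; apply/eqP/eq_integral => z _.
rewrite /= !patchE; case: ifPn => _ /=; last by rewrite normr0 powR0.
by rewrite powR_mulrn// -normrX.
Qed.

Lemma bounded_integrable x M : measurable_fun D x ->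
  (forall z, D z -> `|x z| <= M) -> leb.-integrable D (EFin \o x).
Proof.
move=> mx xM; have fD : (leb D < +oo)%E by rewrite unit_itv_measure ltry.
apply: measurable_bounded_integrable => //.
exists M; split; first exact: num_real.
by move=> K MK z Dz /=; rewrite (le_trans (xM z Dz))// ltW.
Qed.

Lemma sqint_bounded x M : measurable_fun D x ->
  (forall z, D z -> `|x z| <= M) -> sqint x.
Proof.
move=> mx xM; split => //.
apply: (@bounded_integrable _ (M ^+ 2)); first exact: measurable_funX.
move=> z Dz; have xz := xM z Dz; have M0 : 0 <= M by exact: le_trans xz.
by rewrite normrX ler_pXn2r ?nnegrE.
Qed.

Lemma sqint_mul x y : sqint x -> sqint y -> leb.-integrable D (EFin \o (x \* y)).
Proof.
move=> [mx ix] [my iy].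
have := integrableD mD ix iy; apply: le_integrable => //.
  by apply/measurable_EFinP; exact: measurable_funM.
move=> z _; rewrite /= lee_fin normrM.
rewrite [leRHS]ger0_norm ?addr_ge0 ?sqr_ge0// -(real_normK (num_real (x z))).
rewrite -(real_normK (num_real (y z))).
move: `|x z| `|y z| (normr_ge0 (x z)) (normr_ge0 (y z)) => a c a0 c0.
have := sqr_ge0 (a - c); have := mulr_ge0 a0 c0; rewrite sqrrB mulr2n; lra.
Qed.

Lemma sqint_boundedM p x M : measurable_fun D p -> (forall z, D z -> `|p z| <= M) ->
  sqint x -> sqint (p \* x).
Proof.
move=> mp pM [mx ix]; split; first exact: measurable_funM.
apply: (@le_integrable _ _ _ leb D mD _ (fun z => (M ^+ 2)%:E * (x z ^+ 2)%:E)%E).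
- by apply/measurable_EFinP; apply: measurable_funX; exact: measurable_funM.
- move=> z Dz; have pz := pM z Dz; have M0 : 0 <= M by exact: le_trans pz.
  have xz := sqr_ge0 (x z); rewrite /= lee_fin [leRHS]ger0_norm ?(mulr_ge0 (sqr_ge0 M))//.
  rewrite ger0_norm ?sqr_ge0// exprMn ler_wpM2r// -(real_normK (num_real (p z))).
  by rewrite ler_pXn2r ?nnegrE.
exact: integrableZl.
Qed.

Lemma sqint_cst (k : R) : sqint (fun=> k).
Proof. by apply: (@sqint_bounded _ `|k|) => //; exact: measurable_cst. Qed.

Lemma sqintZ (k : R) x : sqint x -> sqint (fun z => k * x z).
Proof.
by apply: (@sqint_boundedM (fun=> k) _ `|k|) => //; exact: measurable_cst.
Qed.

Lemma sqintD x y : sqint x -> sqint y -> sqint (x \+ y).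
Proof.
move=> sx sy; have [mx ix] := sx; have [my iy] := sy.
split; first exact: measurable_funD.
have := integrableZl mD 2 (integrableD mD ix iy); apply: le_integrable => //.
  by apply/measurable_EFinP; apply: measurable_funX; exact: measurable_funD.
move=> z _; rewrite /= lee_fin !ger0_norm ?sqr_ge0 ?mulr_ge0 ?addr_ge0 ?sqr_ge0//.
move: (x z) (y z) => p q.
by have := sqr_ge0 (p - q); rewrite sqrrB sqrrD mulr2n; lra.
Qed.

Lemma sqintB x y : sqint x -> sqint y -> sqint (x \- y).
Proof.
move=> sx sy; rewrite (_ : _ \- _ = x \+ (fun z => -1 * y z)).
  by apply: sqintD => //; exact: sqintZ.
by apply/funext => z /=; rewrite mulN1r.
Qed.

Lemma sqint_integrable x : sqint x -> leb.-integrable D (EFin \o x).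
Proof.
move=> sx; have := sqint_mul (sqint_cst 1) sx.
by apply: eq_integrable => // z _; rewrite /= mul1r.
Qed.

Lemma sqint_sum I (s : seq I) (F : I -> R -> R) : (forall i, sqint (F i)) ->
  sqint (fun z => \sum_(i <- s) F i z).
Proof.
move=> sF; elim: s => [|i s IH].
  by under eq_fun do rewrite big_nil; exact: sqint_cst.
by under eq_fun do rewrite big_cons; exact: sqintD.
Qed.

Lemma continuous_sqint x : {within `[0%R, 1%R]%classic, continuous x} -> sqint x.
Proof.
move=> cx; have mx : measurable_fun D x.
  apply: (measurable_funS (E := (`[0%R, 1%R]%classic : set (measurableTypeR R)))) => //.
    exact: subset_itv_oo_cc.
  by apply: subspace_continuous_measurable_fun => //; exact: measurable_itv.
have := continuous_compact cx (@segment_compact R 0 1).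
move=> /compact_bounded[M [_ /(_ (M + 1))]]; rewrite ltrDl ltr01 => /(_ isT) xM.
apply: (sqint_bounded mx (M := M + 1)) => z Dz; apply: xM => /=.
by exists z => //; exact: subset_itv_oo_cc.
Qed.

End SquareIntegrable.

(** * Absolutely continuous functions on the unit interval *)

Section TriangleFubini.
Context (R : realType).
Local Notation leb := (@lebesgue_measure R).
Variables (f g : R -> R).
Hypotheses (fi : leb.-integrable [set: R] (EFin \o f))
  (gi : leb.-integrable [set: R] (EFin \o g)).

Let F t := (\int[leb]_(s in `]-oo, t]) f s)%R.
Let G s := (\int[leb]_(t in `]-oo, s[) g t)%R.

Let mf : measurable_fun [set: measurableTypeR R] f.
Proof. by have /integrableP[/measurable_EFinP] := fi. Qed.
Let mg : measurable_fun [set: measurableTypeR R] g.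
Proof. by have /integrableP[/measurable_EFinP] := gi. Qed.

Let H (p : measurableTypeR R * measurableTypeR R) : \bar R := (f p.1 * g p.2)%:E.
Let H1 (p : measurableTypeR R * measurableTypeR R) : \bar R :=
  if p.1 <= p.2 then H p else 0%E.
Let H2 (p : measurableTypeR R * measurableTypeR R) : \bar R :=
  if p.1 <= p.2 then 0%E else H p.

Let mH : measurable_fun [set: measurableTypeR R * measurableTypeR R] H.
Proof.
by apply/measurable_EFinP; apply: measurable_funM; exact: measurableT_comp.
Qed.

Let mle : measurable_fun [set: measurableTypeR R * measurableTypeR R]
  (fun p => p.1 <= p.2).
Proof.
by apply: measurable_fun_ler; [exact: measurable_fst|exact: measurable_snd].
Qed.

Let iH : (leb \x leb)%E.-integrable setT H.
Proof.
apply/integrable12ltyP => //.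
have [_ fy] := integrableP _ _ _ fi; have [_ gy] := integrableP _ _ _ gi.
rewrite (_ : (\int[_]_x _)%E = (\int[leb]_x (`|(f x)%:E| * \int[leb]_y `|(g y)%:E|))%E).
  rewrite ge0_integralZr//; last 2 first.
  - by apply: measurableT_comp => //; exact/measurable_EFinP.
  - by apply: integral_ge0.
  apply: lte_mul_pinfty; [exact: integral_ge0| |exact: gy].
  by rewrite ge0_fin_numE//; exact: integral_ge0.
apply: eq_integral => x _; rewrite -ge0_integralZl//; last first.
  by apply: measurableT_comp => //; exact/measurable_EFinP.
by apply: eq_integral => y _; rewrite /H/= normrM EFinM.
Qed.

Let mH1 : measurable_fun setT H1.
Proof. exact: measurable_fun_ifT. Qed.

Let mH2 : measurable_fun setT H2.
Proof. exact: measurable_fun_ifT. Qed.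

Let iH1 : (leb \x leb)%E.-integrable setT H1.
Proof.
apply: le_integrable iH => // p _; rewrite /H1; case: ifP => // _.
by rewrite abse0.
Qed.

Let iH2 : (leb \x leb)%E.-integrable setT H2.
Proof.
apply: le_integrable iH => // p _; rewrite /H2; case: ifP => // _.
by rewrite abse0.
Qed.

Let inner1 t : (\int[leb]_s H1 (s, t) = (g t * F t)%:E)%E.
Proof.
have ift : leb.-integrable `]-oo, t] (EFin \o f) by exact: integrableS fi.
rewrite EFinM /F /Rintegral fineK; last exact: integrable_fin_num.
rewrite -integralZl// [RHS]integral_mkcond; apply: eq_integral => s _.
rewrite /H1 /H patchE/= mem_setE/= in_itv/=.
by case: ifP => // _; rewrite -EFinM mulrC.
Qed.

Let inner2 s : (\int[leb]_t H2 (s, t) = (f s * G s)%:E)%E.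
Proof.
have igs : leb.-integrable `]-oo, s[ (EFin \o g) by exact: integrableS gi.
rewrite EFinM /G /Rintegral fineK; last exact: integrable_fin_num.
rewrite -integralZl// [RHS]integral_mkcond; apply: eq_integral => t _.
rewrite /H2 /H patchE/= mem_setE/= in_itv/= ltNge.
by case: ifP => // _; rewrite -EFinM.
Qed.

(** Integration by parts is the splitting of the plane along its diagonal. *)
Lemma Rintegral_triangle :
  (\int[leb]_x f x) * (\int[leb]_x g x) =
  \int[leb]_t (g t * F t) + \int[leb]_s (f s * G s).
Proof.
have eH : (\int[(leb \x leb)%E]_p H p = ((\int[leb]_x f x) * (\int[leb]_x g x))%:E)%E.
  rewrite -integral12_prod_meas1// /fubini_F.
  have gE : (\int[leb]_x (g x)%:E = (\int[leb]_x g x)%:E)%E.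
    by rewrite fineK//; exact: integrable_fin_num.
  have fE : (\int[leb]_x (f x)%:E = (\int[leb]_x f x)%:E)%E.
    by rewrite fineK//; exact: integrable_fin_num.
  rewrite EFinM -fE -integralZr//; apply: eq_integral => x _.
  rewrite -gE -integralZl//; apply: eq_integral => y _.
have e1 : (\int[(leb \x leb)%E]_p H1 p = \int[leb]_t (g t * F t)%:E)%E.
  by rewrite -integral21_prod_meas1// /fubini_G; apply: eq_integral => t _.
have e2 : (\int[(leb \x leb)%E]_p H2 p = \int[leb]_s (f s * G s)%:E)%E.
  by rewrite -integral12_prod_meas1// /fubini_F; apply: eq_integral => t _.
have i1 : leb.-integrable [set: R] (fun t => (g t * F t)%:E).
  have mG : measurable_fun [set: measurableTypeR R] (fun t => (g t * F t)%:E).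
    by have := measurable_fubini_G iH1; apply: eq_measurable_fun => t _; exact: inner1.
  apply/integrableP; split => //.
  have := (integrable21ltyP _ _ mH1).1 iH1; apply: le_lt_trans.
  apply: ge0_le_integral => //; first exact: measurableT_comp.
    apply: (measurable_fun_fubini_tonelli_G (abse \o H1)) => //.
      exact: measurableT_comp.
    by move=> p; exact: abse_ge0.
  move=> t _; rewrite -inner1; apply: le_abse_integral => //.
  exact: measurable_fun_pair1.
have i2 : leb.-integrable [set: R] (fun t => (f t * G t)%:E).
  have := integrable_fubini_F iH2; apply: eq_integrable => // t _.
  exact: inner2.
apply: EFin_inj; rewrite EFinD -eH.
rewrite /Rintegral !fineK; last 2 first.
- exact: integrable_fin_num.
- exact: integrable_fin_num.
rewrite -e1 -e2 -integralD//; apply: eq_integral => p _.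
by rewrite /H1 /H2; case: ifP => _; rewrite ?adde0 ?add0e.
Qed.

End TriangleFubini.

Section AbsolutelyContinuous.
Context (R : realType).
Local Notation leb := (@lebesgue_measure R).
Local Notation D := (`]0%R, 1%R[%classic : set (measurableTypeR R)).
Implicit Types (F G f g : R -> R).

(** Absolute continuity with a prescribed derivative: carrying [f] along
    dispenses with differentiation almost everywhere. *)
Definition abs_continuous F f := leb.-integrable D (EFin \o f) /\
  forall z, 0 <= z <= 1 -> F z = F 0 + (\int[leb]_(s in `]0%R, z[) f s)%R.

Lemma subset_unit_itv (z : R) : z <= 1 -> `]0, z[%classic `<=` D.
Proof. by move=> z1; apply: subset_itvl; rewrite bnd_simp. Qed.

Let mD : measurable D. Proof. exact: measurable_itv. Qed.

Let integrable_sub f z : z <= 1 -> leb.-integrable D (EFin \o f) ->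
  leb.-integrable `]0, z[ (EFin \o f).
Proof. by move=> z1; apply: integrableS => //; exact: subset_unit_itv. Qed.

Lemma abs_continuous_eq F f F' f' : abs_continuous F f ->
  (forall z, 0 <= z <= 1 -> F' z = F z) -> (forall z, D z -> f' z = f z) ->
  abs_continuous F' f'.
Proof.
move=> [fi FE] FF' ff'; split.
  by apply: eq_integrable fi => // z; rewrite inE => Dz /=; rewrite ff'.
move=> z z01; rewrite !FF' ?lexx ?ler01// FE//; congr (_ + _).
apply: eq_Rintegral => s; rewrite inE => sz; rewrite ff'//.
by apply: subset_unit_itv sz; case/andP: z01.
Qed.

Lemma abs_continuous_cst (k : R) : abs_continuous (fun=> k) (fun=> 0).
Proof.
split; first exact: integrable0.
by move=> z _; rewrite /Rintegral integral0 addr0.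
Qed.

Lemma abs_continuousD F f G g : abs_continuous F f -> abs_continuous G g ->
  abs_continuous (F \+ G) (f \+ g).
Proof.
move=> [fi FE] [gi GE]; split.
  by have := integrableD mD fi gi; apply: eq_integrable.
move=> z /[dup] z01 /andP[_ z1]; rewrite /= FE// GE// addrACA; congr (_ + _).
by rewrite RintegralD//; exact: integrable_sub.
Qed.

Lemma Rintegral_patch f z : 0 <= z <= 1 -> leb.-integrable D (EFin \o f) ->
  (\int[leb]_(s in `]0%R, z[) f s)%R = (\int[leb]_(s in `[0%R, z]) (f \_ D) s)%R.
Proof.
move=> /andP[z0 z1] fi.
have fDi : leb.-integrable `]0, z[ (EFin \o (f \_ D)).
  have := integrable_sub z1 fi; apply: eq_integrable => // s; rewrite inE => sz.
  by rewrite /= patchE mem_set//; exact: subset_unit_itv sz.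
rewrite [RHS]/Rintegral integral_itv_bndoo; last first.
  by have /integrableP[] := fDi.
apply: eq_Rintegral => s; rewrite inE => sz.
by rewrite patchE mem_set//; exact: subset_unit_itv sz.
Qed.

Lemma abs_continuous_continuous F f : abs_continuous F f ->
  {within `[0%R, 1%R]%classic, continuous F}.
Proof.
move=> [fi FE].
have fDi : leb.-integrable `[0, 1] (EFin \o (f \_ D)).
  have := (integrable_mkcond _ mD).1 fi.
  by rewrite restrict_EFin; apply: integrableS.
have cP := parameterized_integral_continuous ler01 fDi.
apply: (@subspace_eq_continuous _ _ _
   (fun z => F 0 + parameterized_integral leb 0 z (f \_ D))).
  by move=> z; rewrite inE/= in_itv/= => z01; rewrite [RHS]FE// Rintegral_patch.
move=> z; apply: cvgD; first exact: cvg_cst.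
exact: cP.
Qed.

Lemma integrableM_continuous f G : leb.-integrable D (EFin \o f) ->
  {within `[0%R, 1%R]%classic, continuous G} ->
  leb.-integrable D (EFin \o (f \* G)).
Proof.
move=> fi cG; have [mG _] := continuous_sqint cG.
have := continuous_compact cG (@segment_compact R 0 1).
move=> /compact_bounded[M [_ /(_ (M + 1))]]; rewrite ltrDl ltr01 => /(_ isT) GM.
have := integrableMl mD fi mG; apply.
exists (M + 1); split; first exact: num_real.
move=> K MK z Dz /=; rewrite ltW// (le_lt_trans _ MK)//; apply: GM => /=.
by exists z => //; exact: subset_itv_oo_cc.
Qed.

Let integrable_ext f z : z <= 1 -> leb.-integrable D (EFin \o f) ->
  leb.-integrable [set: R] (EFin \o (f \_ `]0%R, z[)).
Proof.
move=> z1 fi; rewrite -restrict_EFin.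
have mz : measurable (`]0%R, z[%classic : set (measurableTypeR R)) by exact: measurable_itv.
exact: (integrable_mkcond _ mz).1 (integrable_sub z1 fi).
Qed.

Let Rint_half f z t : 0 < z -> z <= 1 -> 0 <= t < z ->
  leb.-integrable D (EFin \o f) ->
  (\int[leb]_(s in `]-oo, t]) (f \_ `]0%R, z[) s)%R = (\int[leb]_(s in `]0%R, t[) f s)%R /\
  (\int[leb]_(s in `]-oo, t[) (f \_ `]0%R, z[) s)%R = (\int[leb]_(s in `]0%R, t[) f s)%R.
Proof.
move=> z0 z1 /andP[t0 tz] fi.
have [mf _] := integrableP _ _ _ fi.
have e : (\int[leb]_(s in `]-oo, t[) (f \_ `]0%R, z[) s)%R
    = (\int[leb]_(s in `]0%R, t[) f s)%R.
  rewrite Rintegral_mkcond [RHS]Rintegral_mkcond; apply: eq_Rintegral => s _.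
  rewrite !patchE !mem_setE !in_itv/=.
  by case: (ltP 0 s) => s0/=; case: (ltP s t) => st //; rewrite (lt_trans st tz).
split=> //; rewrite -e -Rintegral_itv_bndo_bndc//.
apply: (@integrableS _ _ _ leb setT) => //.
exact: integrable_ext.
Qed.

(** The product rule is [Rintegral_triangle] applied to the derivatives
    truncated at [z]. *)
Lemma abs_continuousM F f G g : abs_continuous F f -> abs_continuous G g ->
  abs_continuous (F \* G) (f \* G \+ g \* F).
Proof.
move=> aF aG; have [fi FE] := aF; have [gi GE] := aG.
have fGi := integrableM_continuous fi (abs_continuous_continuous aG).
have gFi := integrableM_continuous gi (abs_continuous_continuous aF).
split; first by have := integrableD mD fGi gFi; apply: eq_integrable.
move=> z /[dup] z01 /andP[z0 z1].
have [->|zn0] := eqVneq z 0.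
  by rewrite set_itv_ge ?Rintegral_set0 ?addr0// bnd_simp ltxx.
have {zn0}z_gt0 : 0 < z by rewrite lt_def zn0.
have ext h : leb.-integrable D (EFin \o h) -> leb.-integrable [set: R] (EFin \o (h \_ `]0%R, z[)).
  exact: integrable_ext.
have := Rintegral_triangle (ext f fi) (ext g gi).
rewrite -!Rintegral_mkcond.
have -> : (\int[leb]_t ((g \_ `]0%R, z[) t * \int[leb]_(s in `]-oo, t]) (f \_ `]0%R, z[) s))%R
    = (\int[leb]_(t in `]0%R, z[) (g t * (F t - F 0)))%R.
  rewrite [RHS]Rintegral_mkcond; apply: eq_Rintegral => t _; rewrite !patchE.
  case: ifPn => tz; last by rewrite mul0r.
  move: tz; rewrite mem_setE in_itv/= => /andP[t0 tz].
  have [|-> _] := Rint_half z_gt0 z1 _ fi (t := t); first by rewrite (ltW t0).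
  by rewrite FE ?(ltW t0) ?(le_trans (ltW tz))// addrAC subrr add0r.
have -> : (\int[leb]_t ((f \_ `]0%R, z[) t * \int[leb]_(s in `]-oo, t[) (g \_ `]0%R, z[) s))%R
    = (\int[leb]_(t in `]0%R, z[) (f t * (G t - G 0)))%R.
  rewrite [RHS]Rintegral_mkcond; apply: eq_Rintegral => t _; rewrite !patchE.
  case: ifPn => tz; last by rewrite mul0r.
  move: tz; rewrite mem_setE in_itv/= => /andP[t0 tz].
  have [|_ ->] := Rint_half z_gt0 z1 _ gi (t := t); first by rewrite (ltW t0).
  by rewrite GE ?(ltW t0) ?(le_trans (ltW tz))// addrAC subrr add0r.
have mz : measurable (`]0%R, z[%classic : set (measurableTypeR R)) by exact: measurable_itv.
have split (h : R -> R) k (K : R -> R) : leb.-integrable D (EFin \o h) ->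
   leb.-integrable D (EFin \o (h \* K)) ->
   (\int[leb]_(t in `]0%R, z[) (h t * (K t - k)))%R =
   (\int[leb]_(t in `]0%R, z[) (h t * K t))%R - (\int[leb]_(t in `]0%R, z[) h t)%R * k.
  move=> hi hKi; rewrite -RintegralZr//; last exact: integrable_sub.
  rewrite -RintegralB//; last 2 first.
  - exact: integrable_sub hKi.
  - have := integrableZr mz k (integrable_sub z1 hi).
    by apply: eq_integrable.
  by apply: eq_Rintegral => t _; rewrite mulrBr.
rewrite !split// => e.
rewrite RintegralD//; last 2 first.
- exact: integrable_sub fGi.
- exact: integrable_sub gFi.
move: e; rewrite /= (FE z)// (GE z)//.
set a := Rintegral _ _ _; set c := Rintegral _ _ _.
set p := Rintegral _ _ _; set q := Rintegral _ _ _ => e.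
have -> : (F 0 + a) * (G 0 + c) = F 0 * G 0 + (a * c + a * G 0 + c * F 0) by ring.
by rewrite e; congr (_ + _); ring.
Qed.

Lemma abs_continuous_C1 F f :
  (forall z, 0 <= z <= 1 -> derivable F z 1 /\ derive1 F z = f z) ->
  {within `[0%R, 1%R]%classic, continuous f} -> abs_continuous F f.
Proof.
move=> dF cf; have [mf _] := continuous_sqint cf.
have fi : leb.-integrable D (EFin \o f).
  by apply: sqint_integrable; apply: continuous_sqint.
split => // z /[dup] z01 /andP[]; rewrite le_eqVlt => /predU1P[<- _|z0 z1].
  by rewrite set_itv_ge ?Rintegral_set0 ?addr0// bnd_simp ltxx.
have cw : {within `[0%R, z]%classic, continuous f}.
  by apply: continuous_subspaceW cf; apply: subset_itvl; rewrite bnd_simp.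
have cF x : 0 <= x <= 1 -> {for x, continuous F}.
  by move=> /dF[dFx _]; apply/differentiable_continuous/derivable1_diffP.
have := @continuous_FTC2 _ f F 0 z z0 cw _ _.
rewrite /Rintegral -(integral_itv_bndoo true false); last first.
  apply/measurable_EFinP; apply: measurable_funS mf => //.
  exact: subset_unit_itv.
move=> -> /=; first by rewrite subrKC.
  split=> [x||].
  - by rewrite in_itv/= => /andP[x0 xz]; have [] := dF x; rewrite ?(ltW x0) ?(le_trans (ltW xz)).
  - by apply: cvg_at_right_filter; apply: cF; rewrite lexx ler01.
  - by apply: cvg_at_left_filter; exact: cF.
move=> x; rewrite in_itv/= => /andP[x0 xz].
by have [] := dF x; rewrite ?(ltW x0) ?(le_trans (ltW xz)).
Qed.

Lemma abs_continuous_parts F f : abs_continuous F f ->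
  F 1 - F 0 = (\int[leb]_(z in D) f z)%R.
Proof. by move=> [_ ->]; rewrite ?ler01 ?lexx// addrAC subrr add0r. Qed.

End AbsolutelyContinuous.

(** * Weak derivatives *)

Section WeakDerivative.
Context (R : realType).
Local Notation leb := (@lebesgue_measure R).
Local Notation D := (`]0%R, 1%R[%classic : set (measurableTypeR R)).
Implicit Types (F G f g x u phi : R -> R).

Lemma test_abs_continuous phi : test_function phi -> abs_continuous phi (derive1 phi).
Proof.
move=> [dphi cphi _]; apply: abs_continuous_C1 => //.
exact: continuous_subspaceT.
Qed.

Lemma test_boundary phi : test_function phi -> phi 0 = 0 /\ phi 1 = 0.
Proof.
move=> [_ _ [a [c [a0 c1 phi0]]]].
by split; apply: phi0; rewrite in_itv/= negb_and -!ltNge ?a0 ?c1 ?orbT.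
Qed.

Lemma abs_continuous_weak F f phi : abs_continuous F f -> test_function phi ->
  (\int[leb]_(z in D) (F z * derive1 phi z) = - \int[leb]_(z in D) (f z * phi z))%R.
Proof.
move=> aF tphi; have aphi := test_abs_continuous tphi.
have [fi _] := aF; have [phii _] := aphi.
have := abs_continuous_parts (abs_continuousM aF aphi).
have [/= -> ->] := test_boundary tphi; rewrite !mulr0 subrr => /esym.
have i1 := integrableM_continuous fi (abs_continuous_continuous aphi).
have i2 := integrableM_continuous phii (abs_continuous_continuous aF).
rewrite RintegralD//.
move/eqP; rewrite addrC addr_eq0 => /eqP <-.
by apply: eq_Rintegral => z _ /=; rewrite mulrC.
Qed.

Lemma continuous_Rintegral0 (p : R -> R) : continuous p -> (forall z, 0 <= p z) ->
  (\int[leb]_(z in D) p z)%R = 0 -> forall z, D z -> p z = 0.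
Proof.
move=> cp p0 ip z; rewrite /= in_itv/= => /andP[z0 z1].
have pi (a c : R) : leb.-integrable `[a, c] (EFin \o p).
  apply: continuous_compact_integrable; first exact: segment_compact.
  exact: continuous_subspaceT.
pose P t := (\int[leb]_(s in `[0, t]) p s)%R.
have P1 : P 1 = 0.
  apply: etrans ip; rewrite /P /Rintegral integral_itv_bndoo//.
  by apply/measurable_EFinP; apply: measurable_funTS; exact: continuous_measurable_fun.
have P0 t : t \in `]0, 1[ -> P t = 0.
  rewrite in_itv/= => /andP[t0 t1]; apply/eqP; rewrite eq_le.
  rewrite [X in _ && X]Rintegral_ge0// andbT.
  have := @Rintegral_itvB _ p (BLeft 0) (BRight 1) t (pi 0 1).
  rewrite !bnd_simp (ltW t0) (ltW t1) => /(_ isT isT); rewrite -/(P t) -/(P 1) P1 => e.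
  have : 0 <= - P t by rewrite -sub0r e; apply: Rintegral_ge0.
  by rewrite oppr_ge0.
have [dP <-] := continuous_FTC1_closed (ltr_pwDr ltr01 (lexx z)) (pi 0 (z + 1)) z0 (cp z).
rewrite -/P derive1E (@near_eq_derive _ _ _ P (cst 0)) ?derive_cst//.
have : \forall t \near z, t \in `]0, 1[ by apply: near_in_itvoo; rewrite in_itv/= z0.
by apply: filterS => t; exact: P0.
Qed.

(* Extends functions on the unit interval continuously to the line. *)
Let clamp (z : R) := Num.max 0 (Num.min z 1).

Let clamp_id z : 0 <= z <= 1 -> clamp z = z.
Proof. by move=> /andP[z0 z1]; rewrite /clamp min_l// max_r. Qed.

Let clamp_itv z : 0 <= clamp z <= 1.
Proof. by rewrite /clamp le_max lexx/= ge_max ler01 ge_min lexx orbT. Qed.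

Let clamp_lip s t : `|clamp s - clamp t| <= `|s - t|.
Proof.
rewrite /clamp.
have n1 := ler_norm (s - t); have n2 := ler_norm (t - s); rewrite distrC in n2.
have n0 := normr_ge0 (s - t).
by case: (leP s 1) => s1; case: (leP t 1) => t1; rewrite ?(max_r ler01);
  case: (leP 0 s) => s0; case: (leP 0 t) => t0;
  rewrite ler_norml; apply/andP; split; lra.
Qed.

Lemma clamp_continuous u : {within `[0%R, 1%R]%classic, continuous u} ->
  continuous (u \o clamp).
Proof.
move=> /subspace_continuousP cu z.
have cz : `[0%R, 1%R]%classic (clamp z) by rewrite /= in_itv/= clamp_itv.
apply/cvgrPdist_lt => e e0.
have /cvgrPdist_lt/(_ e e0) := cu _ cz.
rewrite near_withinE => /nbhs_ballP[d /= d0 dP].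
near=> t; apply: dP; last by rewrite /= in_itv/= clamp_itv.
rewrite /ball/=; apply: le_lt_trans (clamp_lip _ _) _; near: t.
by apply: cvgr_dist_lt => //; exact: cvg_id.
Unshelve. all: by end_near. Qed.

(** The fundamental lemma of the calculus of variations, tested with the
    primitive of [chi (u - c)], where [chi] is a cut-off and [c] the mean of
    [u] with respect to [chi]. *)
Lemma weak_derivative0 u : {within `[0%R, 1%R]%classic, continuous u} ->
  (forall phi, test_function phi -> (\int[leb]_(z in D) (u z * derive1 phi z))%R = 0) ->
  forall z, 0 <= z <= 1 -> u z = u 0.
Proof.
move=> cu uphi; pose v := u \o clamp; have cv := clamp_continuous cu.
have vu z : D z -> v z = u z.
  by rewrite /= in_itv/= => /andP[? ?]; rewrite /v/= clamp_id// !ltW.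
have key e : 0 < e -> e < 2^-1 -> exists c, forall z, e < z < 1 - e -> v z = c.
  move=> e0 e12.
  pose chi z := Num.max 0 ((z - e) * (1 - e - z)).
  have cchi : continuous chi.
    move=> z; apply: (@continuous_max _ _ (fun=> 0) (fun z => (z - e) * (1 - e - z))).
      exact: cvg_cst.
    by apply: cvgM; apply: cvgB; try exact: cvg_cst; exact: cvg_id.
  have chi_ge0 z : 0 <= chi z by rewrite /chi le_max lexx.
  have chi0 z : z \notin `[e, 1 - e] -> chi z = 0.
    rewrite in_itv/= negb_and -!ltNge => /orP[ze|ze]; rewrite /chi max_l//.
      by rewrite mulr_le0_ge0//; lra.
    by rewrite mulr_ge0_le0//; lra.
  have chi_gt0 z : e < z < 1 - e -> 0 < chi z.
    by move=> /andP[ez ze]; rewrite /chi lt_max mulr_gt0 ?orbT// subr_gt0.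
  have ci (p : R -> R) : continuous p -> leb.-integrable D (EFin \o p).
    by move=> cp; apply: sqint_integrable; apply: continuous_sqint; exact: continuous_subspaceT.
  have cchiv : continuous (chi \* v) by move=> z; apply: cvgM; [exact: cchi|exact: cv].
  pose m := (\int[leb]_(z in D) chi z)%R.
  have m0 : m != 0.
    apply/eqP => mE; have := continuous_Rintegral0 cchi chi_ge0 mE.
    move=> /(_ 2^-1); rewrite /= in_itv/= invr_gt0 ltr0n invf_lt1// ltr1n => /(_ isT) h.
    by have := chi_gt0 2^-1; rewrite h ltxx => /(_ _)/negP; apply; lra.
  (* With this constant, [k] has integral zero and its primitive has compact
     support. *)
  pose c := (\int[leb]_(z in D) (chi z * v z))%R / m.
  pose k z := chi z * (v z - c).
  have ck : continuous k.
    by move=> z; apply: cvgM; [exact: cchi|apply: cvgB; [exact: cv|exact: cvg_cst]].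
  have k0 z : z \notin `[e, 1 - e] -> k z = 0 by move=> /chi0; rewrite /k => ->; rewrite mul0r.
  have kD z : z \notin D -> k z = 0.
    rewrite mem_setE => zD; apply: k0; apply: contra zD; rewrite !in_itv/= => /andP[? ?].
    by apply/andP; split; lra.
  have ki : leb.-integrable [set: R] (EFin \o k).
    have mD : measurable D by exact: measurable_itv.
    have := (integrable_mkcond _ mD).1 (ci k ck); apply: eq_integrable => // z _.
    by rewrite patchE; case: ifPn => // zD; rewrite /= kD.
  have ik : (\int[leb]_(z in D) k z)%R = 0.
    rewrite (_ : Rintegral _ _ _ = (\int[leb]_(z in D) (chi z * v z - chi z * c))%R); last first.
      by apply: eq_Rintegral => z _; rewrite /k mulrBr.
    rewrite RintegralB//; [|exact: (ci (chi \* v))|]; last first.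
      by apply: (ci (fun z => chi z * c)) => z; apply: cvgM; [exact: cchi|exact: cvg_cst].
    rewrite RintegralZr//; last exact: ci.
    by rewrite -/m /c mulrC mulfVK ?subrr.
  pose phi z := (\int[leb]_(s in `]-oo, z]) k s)%R.
  have dphi z : derivable phi z 1 /\ derive1 phi z = k z.
    apply: (@continuous_FTC1 _ k -oo%O z (z + 1)) => //.
    - by rewrite ltrDl.
    - exact: integrableS ki.
    - by rewrite ltNyr.
    - exact: ck.
  have phiE : derive1 phi = k by apply/funext => z; have [] := dphi z.
  have tphi : test_function phi.
    split; [by move=> z; have [] := dphi z|by rewrite phiE|].
    exists e, (1 - e); split => //; first by rewrite ltrBlDr ltrDl.
    move=> z; rewrite in_itv/= negb_and -!ltNge => /orP[ze|ze].
      rewrite /phi (_ : Rintegral _ _ _ = (\int[leb]_(s in `]-oo, z]) 0)%R); last first.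
        apply: eq_Rintegral => s; rewrite inE/= in_itv/= => sz.
        by rewrite k0// in_itv/= negb_and -!ltNge (le_lt_trans sz ze).
      by rewrite /Rintegral integral0.
    rewrite -ik /phi Rintegral_mkcond [RHS]Rintegral_mkcond; apply: eq_Rintegral => s _.
    rewrite !patchE; case: ifPn => sz; case: ifPn => sD //.
      by rewrite kD.
    by rewrite k0//; apply: contra sz; rewrite mem_setE !in_itv/= => /andP[_ ?]; lra.
  exists c => z ez; apply/eqP; rewrite -subr_eq0; apply: contraTT isT => vc.
  (* Tested with [phi], the weak derivative gives the weighted variance of
     [v]. *)
  have iq : (\int[leb]_(z in D) (chi z * (v z - c) ^+ 2))%R = 0.
    have := uphi _ tphi; rewrite phiE.
    rewrite (_ : Rintegral _ _ _ = (\int[leb]_(z in D) (chi z * (v z - c) ^+ 2 + c * k z))%R); last first.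
      by apply: eq_Rintegral => s; rewrite inE => /vu <-; rewrite /k; ring.
    rewrite RintegralD//.
    - rewrite RintegralZl//; last exact: ci.
      by rewrite ik mulr0 addr0.
    - apply: (ci (fun z => chi z * (v z - c) ^+ 2)) => s; apply: cvgM; first exact: cchi.
      by apply: cvgM; apply: cvgB; [exact: cv|exact: cvg_cst|exact: cv|exact: cvg_cst].
    - apply: (ci (fun z => c * k z)) => s; apply: cvgM; [exact: cvg_cst|exact: ck].
  have cq : continuous (fun z => chi z * (v z - c) ^+ 2).
    move=> s; apply: cvgM; first exact: cchi.
    by apply: cvgM; apply: cvgB; [exact: cv|exact: cvg_cst|exact: cv|exact: cvg_cst].
  have := continuous_Rintegral0 cq _ iq; move=> /(_ _ z); rewrite /= in_itv/=.
  have z01 : 0 < z < 1 by move: ez => /andP[? ?]; apply/andP; split; lra.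
  move=> /(_ _ z01)/eqP; rewrite mulf_eq0 sqrf_eq0 (negbTE vc) orbF gt_eqF ?chi_gt0//.
  by move=> H; have := H (fun s => mulr_ge0 (chi_ge0 s) (sqr_ge0 _)).
have vhalf z : 0 < z < 1 -> v z = v 2^-1.
  move=> /andP[z0 z1]; pose e := Num.min 4^-1 (Num.min (z / 2) ((1 - z) / 2)).
  have e0 : 0 < e by rewrite /e !lt_min invr_gt0 ltr0n !divr_gt0// subr_gt0.
  have e1 : e <= 4^-1 by rewrite /e ge_min lexx.
  have : e <= Num.min (z / 2) ((1 - z) / 2) by rewrite /e ge_min lexx orbT.
  rewrite le_min => /andP[e2 e3].
  have [|c cP] := key e e0; first by lra.
  by rewrite !cP//; apply/andP; split; lra.
have vlim (a : R) (s : nat -> R) : s @ \oo --> a -> (forall n, 0 < s n < 1) -> v a = v 2^-1.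
  move=> sa s01; have vs : (v \o s) @ \oo --> v a by apply: (cvg_comp _ _ sa); exact: cv.
  apply: (cvg_unique _ vs); first exact: Rhausdorff.
  by apply: cvg_near_cst; apply: nearW => n; exact: vhalf.
have h01 (n : nat) : 0 < (n.+2%:R : R)^-1 < 1 by rewrite invr_gt0 ltr0n invf_lt1// ltr1n.
have hcvg : (fun n : nat => (n.+2%:R : R)^-1) @ \oo --> (0 : R).
  have := @cvg_harmonic R; rewrite -(cvg_shiftS (@harmonic R)); exact.
have v0 : v 0 = v 2^-1 by exact: vlim hcvg h01.
have v1 : v 1 = v 2^-1.
  apply: (vlim _ (fun n => 1 - (n.+2%:R : R)^-1)) => [|n].
    by rewrite -[X in _ --> X]subr0; apply: cvgB => //; exact: cvg_cst.
  by move: (h01 n); move: (n.+2%:R^-1 : R) => h /andP[? ?]; apply/andP; split; lra.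
have main z : 0 <= z <= 1 -> v z = v 2^-1.
  move=> /andP[]; rewrite le_eqVlt => /predU1P[<- _//|z0].
  by rewrite le_eqVlt => /predU1P[->//|z1]; rewrite vhalf// z0.
have vE s : 0 <= s <= 1 -> v s = u s by move=> s01; rewrite /v /= clamp_id.
by move=> z z01; rewrite -(vE z z01) -vE ?lexx ?ler01// main// v0.
Qed.

(** The weak derivative of [x] minus the primitive of [g] vanishes. *)
Lemma weak_abs_continuous x g : {within `[0%R, 1%R]%classic, continuous x} ->
  leb.-integrable D (EFin \o g) ->
  (forall phi, test_function phi -> (\int[leb]_(z in D) (x z * derive1 phi z) =
    - \int[leb]_(z in D) (g z * phi z))%R) ->
  abs_continuous x g.
Proof.
move=> cx gi xg; pose F z := (\int[leb]_(s in `]0%R, z[) g s)%R.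
have F0 : F 0 = 0 by rewrite /F set_itv_ge ?Rintegral_set0// bnd_simp ltxx.
have aF : abs_continuous F g by split=> // z _; rewrite F0 add0r.
have cF := abs_continuous_continuous aF.
have cxF : {within `[0%R, 1%R]%classic, continuous (x \- F)}.
  by move=> z; apply: cvgB; [exact: cx|exact: cF].
split=> // z z01; rewrite -/(F z).
suff : (x \- F) z = (x \- F) 0 by rewrite /= F0 subr0 => <-; rewrite subrK.
apply: (weak_derivative0 cxF) => // phi tphi.
have [phii _] := test_abs_continuous tphi.
have ixp := integrableM_continuous phii cx.
have iFp := integrableM_continuous phii cF.
rewrite (_ : Rintegral _ _ _ =
  (\int[leb]_(z in D) (derive1 phi z * x z - derive1 phi z * F z))%R); last first.
  by apply: eq_Rintegral => s _ /=; rewrite mulrBl !(mulrC (derive1 phi s)).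
rewrite RintegralB//; apply/eqP; rewrite subr_eq0; apply/eqP.
have comm (y : R -> R) : (\int[leb]_(z in D) (derive1 phi z * y z))%R =
    (\int[leb]_(z in D) (y z * derive1 phi z))%R.
  by apply: eq_Rintegral => s _; rewrite mulrC.
by rewrite !comm xg// (abs_continuous_weak aF).
Qed.

End WeakDerivative.

(** * Density of smooth functions in L^2 *)

Section Density.
Context (R : realType).
Local Notation leb := (@lebesgue_measure R).
Local Notation D := (`]0%R, 1%R[%classic : set (measurableTypeR R)).
Implicit Types (F G f g x y : R -> R).

Definition mean_square x : R := (\int[leb]_(z in D) (x z ^+ 2))%R.

Let mD : measurable D. Proof. exact: measurable_itv. Qed.

Lemma mean_square_ge0 x : 0 <= mean_square x.
Proof. by apply: Rintegral_ge0 => z _; exact: sqr_ge0. Qed.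

Lemma mean_square_EFin x : sqint x ->
  (\int[leb]_(z in D) (x z ^+ 2)%:E = (mean_square x)%:E)%E.
Proof. by move=> [_ ix]; rewrite fineK//; exact: integrable_fin_num. Qed.

Lemma mean_squareD_le x y : sqint x -> sqint y ->
  mean_square (x \+ y) <= 2 * mean_square x + 2 * mean_square y.
Proof.
move=> sx sy; have [_ ix] := sx; have [_ iy] := sy; have [_ ixy] := sqintD sx sy.
rewrite /mean_square -!RintegralZl// -RintegralD//; last 2 first.
- by have := integrableZl mD 2 ix; apply: eq_integrable.
- by have := integrableZl mD 2 iy; apply: eq_integrable.
apply: le_Rintegral => //.
  by have := integrableD mD (integrableZl mD 2 ix) (integrableZl mD 2 iy); apply: eq_integrable.
move=> z _ /=; move: (x z) (y z) => p q.
by have := sqr_ge0 (p - q); rewrite sqrrB sqrrD !mulr2n; lra.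
Qed.

Lemma dominated_mean_square (u : nat -> R -> R) x (k : R -> R) e :
  (forall n, measurable_fun D (u n)) -> measurable_fun D x -> sqint k ->
  (forall n z, D z -> `|u n z - x z| <= `|k z|) ->
  (forall z, D z -> (fun n => u n z) @ \oo --> x z) -> 0 < e ->
  exists n, mean_square (u n \- x) <= e.
Proof.
move=> mu mx [mk ik] uk ux e0.
have [] := @dominated_convergence _ _ _ leb D mD
  (fun n => EFin \o (fun z => (u n z - x z) ^+ 2)) (EFin \o (fun=> 0))
  (EFin \o (fun z => k z ^+ 2)).
- move=> n; apply/measurable_EFinP; apply: measurable_funX.
  exact: measurable_funB.
- exact: measurable_cst.
- apply: aeW => z Dz; apply: cvg_EFin; first exact: nearW.
  rewrite (_ : 0 = (x z - x z) * (x z - x z)); last by rewrite subrr mulr0.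
  by apply: cvgM; (apply: cvgB; [exact: ux|exact: cvg_cst]).
- exact: ik.
- apply: aeW => z n Dz; rewrite /= lee_fin ger0_norm ?sqr_ge0//.
  rewrite -(real_normK (num_real (u n z - x z))) -(real_normK (num_real (k z))).
  by rewrite ler_pXn2r ?nnegrE//; exact: uk.
move=> _ + _ => /ecvg0_lt/(_ e0)[n _ /(_ n (leqnn n))] /= ne.
exists n; rewrite -lee_fin -mean_square_EFin; last first.
  split; first exact: measurable_funB.
  apply: (@le_integrable _ _ _ leb D mD _ (EFin \o (fun z => k z ^+ 2))) => //.
    by apply/measurable_EFinP; apply: measurable_funX; exact: measurable_funB.
  move=> z Dz; rewrite /= lee_fin !ger0_norm ?sqr_ge0//.
  rewrite -(real_normK (num_real (u n z - x z))) -(real_normK (num_real (k z))).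
  by rewrite ler_pXn2r ?nnegrE//; exact: uk.
apply/ltW; apply: le_lt_trans ne; rewrite le_eqVlt; apply/orP; left; apply/eqP.
by apply: eq_integral => z _; rewrite /= subr0 ger0_norm ?sqr_ge0.
Qed.

Definition clip (M a : R) := Num.max (- M) (Num.min M a).

Lemma clip_bound M a : 0 <= M -> `|clip M a| <= M.
Proof.
move=> M0; rewrite ler_norml /clip le_max lexx/= ge_max ge_min lexx/= andbT.
by rewrite (le_trans _ M0)// oppr_le0.
Qed.

Lemma clip_id M a : `|a| <= M -> clip M a = a.
Proof. by rewrite ler_norml => /andP[? ?]; rewrite /clip min_r// max_r. Qed.

Lemma clip_close M a c : `|a| <= M -> `|clip M c - a| <= `|c - a|.
Proof.
rewrite ler_norml => /andP[a1 a2]; rewrite /clip.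
have n1 := ler_norm (c - a); have n2 := ler_norm (a - c); rewrite distrC in n2.
have n0 := normr_ge0 (c - a).
by case: (leP M c) => Mc; [case: (leP (- M) M)|case: (leP (- M) c)] => Mc'; rewrite ler_norml; apply/andP; split; lra.
Qed.

Lemma clip_dist M a : 0 <= M -> `|clip M a - a| <= `|a|.
Proof.
move=> M0; have := @clip_close M 0 a; rewrite normr0 subr0 => /(_ M0) _.
rewrite /clip; have n1 := ler_norm a; have n2 := ler_norm (- a); rewrite normrN in n2.
by case: (leP M a) => Mc; [case: (leP (- M) M)|case: (leP (- M) a)] => Mc'; rewrite ler_norml; apply/andP; split; lra.
Qed.

Lemma clip_continuous M f : continuous f -> continuous (clip M \o f).
Proof.
move=> cf z; apply: (@continuous_max _ _ (fun=> - M) (fun z => Num.min M (f z))).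
  exact: cvg_cst.
by apply: (@continuous_min _ _ (fun=> M) f); [exact: cvg_cst|exact: cf].
Qed.

Lemma clip_measurable M f (E : set (measurableTypeR R)) :
  measurable_fun E f -> measurable_fun E (clip M \o f).
Proof.
move=> mf; apply: (@measurable_maxr _ _ _ E (fun=> - M) (fun z => Num.min M (f z))).
  exact: measurable_cst.
by apply: (@measurable_minr _ _ _ E (fun=> M) f); [exact: measurable_cst|].
Qed.

Lemma density_bounded x e : sqint x -> 0 < e -> exists M y,
  [/\ 0 <= M, measurable_fun D y, forall z, `|y z| <= M & mean_square (y \- x) <= e].
Proof.
move=> sx e0; have [mx _] := sx.
have [|||n nP] := @dominated_mean_square (fun n => clip n%:R \o x) x x e _ mx sx _ _ e0.
- by move=> n; exact: clip_measurable.
- by move=> n z _ /=; exact: clip_dist.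
- move=> z _; apply: cvg_near_cst.
  exists (Num.Def.archi_bound `|x z|) => // n /= nN; rewrite clip_id//.
  by rewrite (le_trans (ltW (archi_boundP (normr_ge0 _))))// ler_nat.
exists n%:R, (clip n%:R \o x); split=> //; first exact: clip_measurable.
by move=> z; exact: clip_bound.
Qed.

(** A continuous function close to [y] in [L^1] is truncated at the bound of
    [y]; for bounded functions, closeness in [L^1] is closeness in mean
    square. *)
Lemma density_continuous M y e : 0 <= M -> measurable_fun D y ->
  (forall z, `|y z| <= M) -> 0 < e ->
  exists c, [/\ continuous c, forall z, `|c z| <= M & mean_square (c \- y) <= e].
Proof.
move=> M0 my yM e0.
have iy : leb.-integrable D (EFin \o y) by apply: (bounded_integrable my) => z _; exact: yM.
have fD : (leb D < +oo)%E by rewrite unit_itv_measure ltry.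
have [c [cc ci cy]] := approximation_continuous_integrable mD fD iy.
have M1 : 0 < 2 * M + 1 by rewrite ltr_wpDl// mulr_ge0.
have [n _ /(_ n (leqnn n))/= ne] := ecvg0_lt cy (divr_gt0 e0 M1).
exists (clip M \o c n); split; first exact: clip_continuous.
  by move=> z; exact: clip_bound.
have mc : measurable_fun D (c n).
  by apply: measurable_funTS; exact: continuous_measurable_fun.
have mcl := clip_measurable M mc.
have sc : sqint (clip M \o c n \- y).
  apply: (sqint_bounded (M := M + M)); first exact: measurable_funB.
  by move=> z _ /=; rewrite (le_trans (ler_normB _ _))// lerD// clip_bound.
rewrite -lee_fin -mean_square_EFin//.
apply: (@le_trans _ _ (\int[leb]_(z in D) ((2 * M + 1)%:E * `|(y z - c n z)%:E|))%E).
  apply: ge0_le_integral => //.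
  - by move=> z _; rewrite lee_fin sqr_ge0.
  - by apply/measurable_EFinP; apply: measurable_funX; exact: measurable_funB.
  - apply: measurable_funeM; apply: measurableT_comp => //.
    by apply/measurable_EFinP; exact: measurable_funB.
  move=> z _; rewrite /= -EFinM lee_fin -(real_normK (num_real _)) expr2.
  apply: ler_pM => //; last by rewrite (distrC (y z)) clip_close.
  rewrite (le_trans (ler_normB _ _))// (le_trans (lerD (clip_bound (c n z) M0) (yM z)))//.
  by rewrite mulr_natl mulr2n lerDl.
rewrite ge0_integralZl//; last 2 first.
- apply: measurableT_comp => //.
  by apply/measurable_EFinP; exact: measurable_funB.
- by rewrite lee_fin ltW.
have -> : e = (2 * M + 1) * (e / (2 * M + 1)) by field; rewrite gt_eqF.
by rewrite EFinM lee_pmul2l//; exact: ltW.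
Qed.

Definition H1_pair F f := abs_continuous F f /\ sqint f.

Lemma H1_pair_sqint F f : H1_pair F f -> sqint F.
Proof. by move=> [/abs_continuous_continuous/continuous_sqint]. Qed.

Lemma continuous_bounded G : {within `[0%R, 1%R]%classic, continuous G} ->
  exists M, forall z, D z -> `|G z| <= M.
Proof.
move=> cG; have := continuous_compact cG (@segment_compact R 0 1).
move=> /compact_bounded[M [_ /(_ (M + 1))]]; rewrite ltrDl ltr01 => /(_ isT) GM.
by exists (M + 1) => z Dz; apply: GM => /=; exists z => //; exact: subset_itv_oo_cc.
Qed.

Lemma H1_pairM F f G g : H1_pair F f -> H1_pair G g ->
  H1_pair (F \* G) (f \* G \+ g \* F).
Proof.
move=> [aF sf] [aG sg]; split; first exact: abs_continuousM.
have mul H h x : abs_continuous H h -> sqint x -> sqint (x \* H).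
  move=> aH sx; have cH := abs_continuous_continuous aH.
  have [M HM] := continuous_bounded cH; have [mH _] := continuous_sqint cH.
  rewrite (_ : x \* H = H \* x); first exact: (sqint_boundedM mH HM).
  by apply/funext => z /=; rewrite mulrC.
by apply: sqintD; [exact: mul aG sf|exact: mul aF sg].
Qed.

Lemma H1_pairD F f G g : H1_pair F f -> H1_pair G g -> H1_pair (F \+ G) (f \+ g).
Proof. by move=> [aF sf] [aG sg]; split; [exact: abs_continuousD|exact: sqintD]. Qed.

Lemma H1_pair_cst (k : R) : H1_pair (fun=> k) (fun=> 0).
Proof. by split; [exact: abs_continuous_cst|exact: sqint_cst]. Qed.

Lemma H1_pair_C1 F f : (forall z : R, 0 <= z <= 1 -> is_derive z 1 F (f z)) ->
  {within `[0%R, 1%R]%classic, continuous f} -> H1_pair F f.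
Proof.
move=> dF cf; split; last exact: continuous_sqint.
apply: abs_continuous_C1 => // z z01; have dFz := dF z z01.
by rewrite derive1E (@derive_val _ _ _ _ _ _ _ dFz); split => //; exact: ex_derive.
Qed.

Lemma H1_pair_exp F f n : H1_pair F f -> exists g, H1_pair (fun z => F z ^+ n) g.
Proof.
move=> hF; elim: n => [|n [g hg]].
  by exists (fun=> 0); rewrite (_ : (fun z => _) = fun=> 1); [exact: H1_pair_cst|
    apply/funext => z; rewrite expr0].
exists (f \* (fun z => F z ^+ n) \+ g \* F).
rewrite (_ : (fun z => _) = F \* (fun z => F z ^+ n)); first exact: H1_pairM.
by apply/funext => z; rewrite exprS.
Qed.

End Density.

Section DensityH1.
Context (R : realType).
Local Notation leb := (@lebesgue_measure R).
Local Notation D := (`]0%R, 1%R[%classic : set (measurableTypeR R)).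
Implicit Types (F G f g x y c : R -> R).

Lemma primitive_is_derive c (t : R) : continuous c -> 0 < t ->
  is_derive t 1 (primitive c) (c t).
Proof.
move=> cc t0; have ci : leb.-integrable `[0, t + 1] (EFin \o c).
  apply: continuous_compact_integrable; first exact: segment_compact.
  exact: continuous_subspaceT.
have [d e] := continuous_FTC1_closed (ltr_pwDr ltr01 (lexx t)) ci t0 (cc t).
by rewrite derive1E in e; exact: DeriveDef d e.
Qed.

Lemma steklov_H1 c (h : R) : continuous c -> 0 < h ->
  exists g, H1_pair (fun z => steklov c h (z + 1)) g.
Proof.
move=> cc h0; exists (fun z => (c (z + 1 + h) - c (z + 1)) / h).
apply: H1_pair_C1.
  move=> z /andP[z0 z1]; rewrite /steklov.
  have shift a : 0 < z + a -> is_derive z 1 (fun z => primitive c (z + a)) (c (z + a)).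
    move=> za; have dg : is_derive z 1 (fun z : R => z + a) 1.
      have := @is_deriveD _ _ _ id (cst a) z 1 _ _ (is_derive_id _ _) (is_derive_cst _ _ _).
      by rewrite addr0.
    have := @is_derive1_comp _ _ (fun z => z + a) z _ _ (primitive_is_derive cc za) dg.
    by rewrite mulr1.
  have s1 : is_derive z 1 (fun z => primitive c (z + 1 + h)) (c (z + 1 + h)).
    rewrite -addrA (_ : (fun z => _) = fun z => primitive c (z + (1 + h))); last first.
      by apply/funext => s; rewrite addrA.
    by apply: shift; lra.
  have s2 : is_derive z 1 (fun z => primitive c (z + 1)) (c (z + 1)) by apply: shift; lra.
  rewrite (_ : (fun z => _) = h^-1 *:
     ((fun z => primitive c (z + 1 + h)) - (fun z => primitive c (z + 1)))); last first.
    by apply/funext => s; rewrite /GRing.scale/= mulrC.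
  rewrite mulrC; apply: is_deriveZ; exact: is_deriveB.
apply: continuous_subspaceT => z; apply: cvgM; last exact: cvg_cst.
have cs a : {for z, continuous (fun z => c (z + a))}.
  apply: (@continuous_comp _ _ _ (fun z => z + a) c); last exact: cc.
  by apply: cvgD; [exact: cvg_id|exact: cvg_cst].
apply: cvgB; last exact: cs.
have -> : (fun z => c (z + 1 + h)) = (fun z => c (z + (1 + h))).
  by apply/funext => s; rewrite addrA.
by rewrite -addrA; exact: cs.
Qed.

(** A polynomial, so that its regularity follows from the product rule. *)
Definition cutoff (n : nat) (z : R) : R := (1 - (1 - z) ^+ n.+1) * (1 - z ^+ n.+1).

Lemma cutoff_H1 n : exists g, H1_pair (cutoff n) g.
Proof.
have id1 : H1_pair (fun z : R => z) (fun=> 1).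
  by apply: H1_pair_C1; apply: continuous_subspaceT => z; exact: cvg_cst.
have neg F f : H1_pair F f -> exists g, H1_pair (fun z => 1 - F z) g.
  move=> hF; exists ((fun=> 0) \+ ((fun=> 0) \* F \+ f \* (fun=> -1))).
  rewrite (_ : (fun z => _) = (fun=> 1) \+ ((fun=> -1) \* F)).
    by apply: H1_pairD; [exact: H1_pair_cst|apply: H1_pairM => //; exact: H1_pair_cst].
  by apply/funext => z /=; rewrite mulN1r.
have [g1 h1] := neg _ _ id1.
have [g2 h2] := H1_pair_exp n.+1 h1; have [g3 h3] := neg _ _ h2.
have [g4 h4] := H1_pair_exp n.+1 id1; have [g5 h5] := neg _ _ h4.
by exists (g3 \* (fun z => 1 - z ^+ n.+1) \+ g5 \* (fun z => 1 - (1 - z) ^+ n.+1));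
  exact: H1_pairM.
Qed.

Lemma cutoff_bound n z : 0 <= z <= 1 -> `|cutoff n z| <= 1.
Proof.
move=> /andP[z0 z1]; rewrite /cutoff.
have b (w : R) : 0 <= w -> w <= 1 -> 0 <= 1 - w ^+ n.+1 <= 1.
  by move=> w0 w1; rewrite subr_ge0 exprn_ile1//= lerBlDr lerDl exprn_ge0.
have /andP[a0 a1] : 0 <= 1 - (1 - z) ^+ n.+1 <= 1 by apply: b; lra.
have /andP[b0 b1] := b z z0 z1.
by rewrite ger0_norm ?mulr_ge0// mulr_ile1.
Qed.

Lemma cutoff_cvg z : 0 < z < 1 -> (fun n => cutoff n z) @ \oo --> (1 : R).
Proof.
move=> /andP[z0 z1].
have l (w : R) : 0 < w < 1 -> (fun n : nat => 1 - w ^+ n.+1) @ \oo --> (1 : R).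
  move=> /andP[w0 w1]; rewrite -[X in _ --> X]subr0; apply: cvgB; first exact: cvg_cst.
  have := @cvg_expr R w; rewrite gtr0_norm// => /(_ w1).
  by rewrite -(cvg_shiftS (GRing.exp w)); exact.
rewrite -[X in _ --> X]mulr1; apply: cvgM; apply: l; first by apply/andP; split; lra.
by rewrite z0.
Qed.

(** Truncate, approximate by a continuous function, take a Steklov mean and
    multiply by a cut-off. The Steklov mean is that of a translate by 1,
    because [primitive] integrates from 0 and is differentiable only at
    positive times. *)
Lemma density_H1 x e : sqint x -> 0 < e -> exists F f,
  [/\ H1_pair F f, F 0 = 0, F 1 = 0 & mean_square (F \- x) <= e].
Proof.
move=> sx e0; have e16 : 0 < e / 16 by rewrite divr_gt0.
have [M [y [M0 my yM yx]]] := density_bounded sx e16.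
have [c [cc cM cy]] := density_continuous M0 my yM e16.
pose c1 t := c (t - 1).
have cc1 : continuous c1.
  move=> t; rewrite /c1; apply: (@continuous_comp _ _ _ (fun t : R => t - 1) c); last exact: cc.
  by apply: cvgB; [exact: cvg_id|exact: cvg_cst].
have mc1 : measurable_fun [set: measurableTypeR R] c1 by exact: continuous_measurable_fun.
have cM1 t : `|c1 t| <= M by exact: cM.
pose h n : R := n.+1%:R^-1.
have h0 n : 0 < h n by rewrite invr_gt0.
pose S n z := steklov c1 (h n) (z + 1).
have Sb n z : `|S n z| <= M by exact: steklov_bound.
have /choice[s sP] : forall n, exists s, H1_pair (S n) s by move=> n; exact: steklov_H1.
have /choice[k kP] : forall n, exists k, H1_pair (cutoff n) k by move=> n; exact: cutoff_H1.
have FP n := H1_pairM (kP n) (sP n).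
have mcD : measurable_fun D c by apply: measurable_funTS; exact: continuous_measurable_fun.
have [||||n nP] := @dominated_mean_square _ (fun n => cutoff n \* S n) c (fun=> M + M) (e / 4)
    _ mcD (sqint_cst _) _ _.
- by move=> n; have [] := H1_pair_sqint (FP n).
- move=> n z; rewrite /= in_itv/= => /andP[z0 z1].
  rewrite (le_trans (ler_normB _ _))// [leRHS]ger0_norm ?addr_ge0// lerD// normrM.
  have c1' : `|cutoff n z| <= 1 by apply: cutoff_bound; rewrite !ltW.
  by rewrite -[M]mul1r ler_pM.
- move=> z; rewrite /= in_itv/= => /andP[z0 z1].
  rewrite -[c z]mul1r; apply: cvgM; first by apply: cutoff_cvg; rewrite z0.
  have z11 : 0 < z + 1 by rewrite addr_gt0.
  have d := primitive_is_derive cc1 z11.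
  rewrite (_ : c z = c1 (z + 1)); last by rewrite /c1 addrK.
  apply: steklov_cvg_derivable; first exact: ex_derive.
  by rewrite derive1E (@derive_val _ _ _ _ _ _ _ d).
- by rewrite divr_gt0.
exists (cutoff n \* S n), (k n \* S n \+ s n \* cutoff n); split.
- exact: FP.
- by rewrite /= /cutoff subr0 expr1n subrr !mul0r.
- by rewrite /= /cutoff expr1n subrr mulr0 mul0r.
have sF := H1_pair_sqint (FP n).
have sc : sqint c by apply: continuous_sqint; exact: continuous_subspaceT.
have sy : sqint y by apply: (sqint_bounded my (M := M)) => z _; exact: yM.
have := mean_squareD_le (sqintB sF sc) (sqintD (sqintB sc sy) (sqintB sy sx)).
have := mean_squareD_le (sqintB sc sy) (sqintB sy sx).
rewrite (_ : ((cutoff n \* S n) \- c) \+ ((c \- y) \+ (y \- x)) = (cutoff n \* S n) \- x).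
  by move: nP cy yx => /= nP cy yx; lra.
by apply/funext => z /=; ring.
Qed.

End DensityH1.

(** * Completeness of L^2 *)

Section Completeness.
Context (R : realType).
Local Notation leb := (@lebesgue_measure R).
Local Notation D := (`]0%R, 1%R[%classic : set (measurableTypeR R)).
Implicit Types (x y : R -> R).

Let mD : measurable D. Proof. exact: measurable_itv. Qed.

Lemma abs_series_cvg (w : nat -> R) :
  (\sum_(0 <= k <oo) `|w k.+1 - w k|%:E < +oo)%E -> cvgn w.
Proof.
set S := limn _ => Sy.
have S0 : (0 <= S)%E by apply: nneseries_ge0 => k _ _; rewrite lee_fin.
have Sf : S \is a fin_num by rewrite ge0_fin_numE.
have cs : cvgn [normed series (fun k => w k.+1 - w k)].
  apply: nondecreasing_is_cvgn.
    by apply: (@nondecreasing_series _ (fun k => `|w k.+1 - w k|) xpredT) => k _ _.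
  exists (fine S) => _ [n _ <-]; rewrite -lee_fin fineK// /series/= -sumEFin.
  exact: (nneseries_lim_ge (u_ := fun k => `|w k.+1 - w k|%:E)).
have := normed_cvg cs.
have wE : w = (fun n => w 0%N + series (fun k => w k.+1 - w k) n).
  by apply/funext => n; rewrite /series/= telescope_sumr// subrKC.
rewrite [X in _ -> cvgn X]wE.
by move=> cv; apply: is_cvgD => //; exact: is_cvg_cst.
Qed.

Lemma limn_einf_le (w : nat -> \bar R) (c : \bar R) :
  (forall n, (w n <= c)%E) -> (limn_einf w <= c)%E.
Proof.
move=> wc; rewrite limn_einf_lim; apply: lime_le; first exact: is_cvg_einfs.
apply: nearW => n; apply: le_trans (wc n).
by apply: ereal_inf_lbound; exists n => /=.
Qed.

Lemma limn_einf_ge0 (w : nat -> \bar R) :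
  (forall n, (0 <= w n)%E) -> (0 <= limn_einf w)%E.
Proof.
move=> w0; rewrite limn_einf_lim; apply: lime_ge; first exact: is_cvg_einfs.
by apply: nearW => n; apply: le_ereal_inf_tmp => _ [k _ <-].
Qed.

(** Integrate Young's inequality [|x| <= a / 2 + x ^ 2 / (2 a)]. *)
Lemma integral_abs_le x (a : R) : 0 < a -> sqint x -> mean_square x <= a ^+ 2 ->
  (\int[leb]_(z in D) `|x z|%:E <= a%:E)%E.
Proof.
move=> a0 sx xa; have [mx ix] := sx.
have fD : leb D = 1%E := unit_itv_measure R.
apply: (@le_trans _ _ (\int[leb]_(z in D) ((a / 2)%:E + (2 * a)^-1%:E * (x z ^+ 2)%:E))%E).
  apply: ge0_le_integral => //.
  - by apply/measurable_EFinP; exact: measurableT_comp.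
  - apply: emeasurable_funD => //; apply: measurable_funeM.
    by apply/measurable_EFinP; exact: measurable_funX.
  move=> z _; rewrite -EFinM -EFinD lee_fin -(real_normK (num_real (x z))).
  rewrite -subr_ge0.
  have -> : a / 2 + (2 * a)^-1 * `|x z| ^+ 2 - `|x z| = (`|x z| - a) ^+ 2 / (2 * a).
    by field; rewrite gt_eqF.
  by rewrite divr_ge0 ?sqr_ge0// mulr_ge0// ltW.
rewrite ge0_integralD//; last 3 first.
- by move=> z _; rewrite lee_fin divr_ge0// ltW.
- by move=> z _; rewrite -EFinM lee_fin mulr_ge0 ?sqr_ge0// invr_ge0 mulr_ge0// ltW.
- by apply: measurable_funeM; apply/measurable_EFinP; exact: measurable_funX.
rewrite (_ : (\int[_]_(_ in D) (a / 2)%:E = (a / 2)%:E)%E); last first.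
  by apply: etrans (integral_cst _ mD _) _; rewrite -[RHS]mule1; congr (_ * _)%E.
rewrite ge0_integralZl//; last 3 first.
- by apply/measurable_EFinP; exact: measurable_funX.
- by move=> z _; rewrite lee_fin sqr_ge0.
- by rewrite lee_fin invr_ge0 mulr_ge0// ltW.
rewrite mean_square_EFin// -EFinM -EFinD lee_fin.
have : (2 * a)^-1 * mean_square x <= (2 * a)^-1 * a ^+ 2.
  by rewrite ler_pM2l// invr_gt0 mulr_gt0.
have -> : (2 * a)^-1 * a ^+ 2 = a / 2 by field; rewrite gt_eqF.
lra.
Qed.

(** A subsequence with summable distances converges almost everywhere, and
    Fatou's lemma makes the convergence take place in mean square. *)
Lemma sqint_complete (u : nat -> R -> R) : (forall n, sqint (u n)) ->
  (forall e, 0 < e -> exists N, forall n m, (N <= n)%N -> (N <= m)%N ->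
    mean_square (u n \- u m) <= e) ->
  exists2 x, sqint x & forall e, 0 < e -> exists N, forall n, (N <= n)%N ->
    mean_square (u n \- x) <= e.
Proof.
move=> su uC; pose a k : R := 1 / (2 ^ k.+1)%:R.
have a0 k : 0 < a k by rewrite divr_gt0// ltr0n expn_gt0.
have /choice[N NP] : forall k, exists N, forall n m, (N <= n)%N -> (N <= m)%N ->
    mean_square (u n \- u m) <= a k ^+ 2.
  by move=> k; apply: uC; rewrite exprn_gt0.
pose p := fix p k := if k is j.+1 then maxn (p j) (N k) else N 0%N.
have pN k : (N k <= p k)%N by case: k => //= k; exact: leq_maxr.
have pS k : (p k <= p k.+1)%N by exact: leq_maxl.
have pm j k : (j <= k)%N -> (p j <= p k)%N.
  by elim: k => [|k IH]; rewrite leq_eqVlt => /predU1P[->//|]// /IH/leq_trans; apply.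
pose v k := u (p k).
have sv k : sqint (v k) by exact: su.
have vC j k : (j <= k)%N -> mean_square (v j \- v k) <= a j ^+ 2.
  by move=> jk; apply: NP; [exact: pN|rewrite (leq_trans (pN j))// pm].
have mv k : measurable_fun D (v k) by have [] := sv k.
have dint : (\int[leb]_(z in D) (\sum_(0 <= k <oo) `|v k.+1 z - v k z|%:E) < +oo)%E.
  rewrite integral_nneseries//; last first.
    by move=> n; apply/measurable_EFinP; apply: measurableT_comp => //; exact: measurable_funB.
  apply: (@le_lt_trans _ _ (\sum_(0 <= k <oo) (a k)%:E)%E).
    apply: lee_nneseries => [k _ _|k _]; first exact: integral_ge0.
    apply: le_trans (integral_abs_le (a0 k) (sqintB (sv k) (sv k.+1)) (vC k k.+1 (leqnSn k))).
    rewrite le_eqVlt; apply/orP; left; apply/eqP.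
    by apply: eq_integral => z _ /=; rewrite distrC.
  by apply: le_lt_trans (epsilon_trick0 xpredT ler01) _; rewrite ltry.
have vcvg : {ae leb, forall z, D z -> cvgn (fun k => v k z)}.
  have mdiff k : measurable_fun D (fun z => `|v k.+1 z - v k z|%:E).
    by apply/measurable_EFinP; apply: measurableT_comp => //; exact: measurable_funB.
  have iS : leb.-integrable D (fun z => (\sum_(0 <= k <oo) `|v k.+1 z - v k z|%:E)%E).
    apply/integrableP; split.
      by apply: ge0_emeasurable_sum => // k z _ _; rewrite lee_fin.
    by under eq_integral do rewrite gee0_abs ?nneseries_ge0//.
  have := integrable_ae mD iS; apply: filterS.
  move=> z + Dz => /(_ Dz) zfin; apply: abs_series_cvg.
  by rewrite -ge0_fin_numE// nneseries_ge0.
pose x z := fine (limn_esup (fun k => (v k z)%:E)).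
have mx : measurable_fun D x.
  apply: (measurableT_comp (f := @fine R)).
    by apply: fine_measurable.
  by apply: measurable_fun_limn_esup => k; exact/measurable_EFinP.
have vx : {ae leb, forall z, D z -> (fun k => v k z) @ \oo --> x z}.
  apply: filterS vcvg.
  move=> z + Dz => /(_ Dz) cz.
  have ez : (fun k => (v k z)%:E) @ \oo --> (limn (fun k => v k z))%:E.
    by apply: cvg_EFin => //; exact: nearW.
  by rewrite /x (cvg_limn_einf_sup ez).2.
have ex n : (\int[leb]_(z in D) ((v n z - x z) ^+ 2)%:E <= (a n ^+ 2)%:E)%E.
  pose q m z := ((v n z - v (m + n)%N z) ^+ 2)%:E.
  have mq m : measurable_fun D (q m).
    by apply/measurable_EFinP; apply: measurable_funX; exact: measurable_funB.
  have q0 m z : (0 <= q m z)%E by rewrite lee_fin sqr_ge0.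
  apply: (@le_trans _ _ (\int[leb]_(z in D) limn_einf (q ^~ z))%E).
    apply: ae_ge0_le_integral => //.
    - by move=> z _; rewrite lee_fin sqr_ge0.
    - by apply/measurable_EFinP; apply: measurable_funX; exact: measurable_funB.
    - by move=> z _; exact: limn_einf_ge0.
    - apply: measurableT_comp => //; apply: measurable_fun_limn_esup => m.
      exact: measurableT_comp.
    apply: filterS vx.
    move=> z + Dz => /(_ Dz) cz.
    have cv2 : (q ^~ z) @ \oo --> ((v n z - x z) ^+ 2)%:E.
      apply: cvg_EFin; first exact: nearW.
      have cz' : (fun m => v (m + n)%N z) @ \oo --> x z by rewrite (cvg_shiftn n (fun m => v m z)).
      by apply: cvgM; (apply: cvgB => //; exact: cvg_cst).
    by rewrite (cvg_limn_einf_sup cv2).1.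
  apply: (@le_trans _ _ (limn_einf (fun m => \int[leb]_(z in D) q m z))%E).
    by apply: fatou => // m z _; exact: q0.
  apply: limn_einf_le => m.
  by rewrite (mean_square_EFin (sqintB (sv n) (sv (m + n)%N))) lee_fin vC// leq_addl.
have sx : sqint x.
  have svx : sqint (v 0%N \- x).
    split; first exact: measurable_funB.
    apply/integrableP; split; first by apply/measurable_EFinP; apply: measurable_funX; exact: measurable_funB.
    under eq_integral do rewrite gee0_abs ?lee_fin ?sqr_ge0//.
    by rewrite (le_lt_trans (ex 0%N))// ltry.
  have := sqintB (sv 0%N) svx.
  by rewrite (_ : _ \- _ = x)//; apply/funext => z /=; rewrite opprB subrKC.
exists x => // e e0; have [K KP] : exists K, 2 * a K ^+ 2 + 2 * a K ^+ 2 <= e.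
  pose K := Num.Def.archi_bound (4 / e); exists K.
  have aK : a K <= e / 4.
    rewrite /a div1r -[e / 4]invrK lef_pV2 ?posrE ?invr_gt0 ?divr_gt0 ?ltr0n ?expn_gt0//.
    rewrite invfM invrK mulrC.
    have := archi_boundP (ltW (divr_gt0 (ltr0n R 4) e0)); rewrite -/K => /ltW/le_trans; apply.
    by rewrite ler_nat (leq_trans (ltnW (ltn_expl K (ltnSn 1))))// leq_exp2l.
  have a1 : a K <= 1.
    by rewrite /a div1r invf_le1 ?ltr0n ?expn_gt0// ler1n expn_gt0.
  have : a K ^+ 2 <= a K by rewrite expr2 ler_piMr// ltW.
  lra.
exists (p K) => n pn.
have := mean_squareD_le (sqintB (su n) (sv K)) (sqintB (sv K) sx).
rewrite (_ : (u n \- v K) \+ (v K \- x) = u n \- x); last first.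
  by apply/funext => z /=; rewrite addrA subrK.
have : mean_square (u n \- v K) <= a K ^+ 2.
  by apply: NP => //; rewrite (leq_trans (pN K)).
have : mean_square (v K \- x) <= a K ^+ 2.
  by rewrite -lee_fin -(mean_square_EFin (sqintB (sv K) sx)); exact: ex.
lra.
Qed.

End Completeness.

(** * The Hilbert space L^2(0,1;R^n) *)

Section L2Space.
Context (R : realType) (n : nat).
Local Notation leb := (@lebesgue_measure R).
Local Notation D := (`]0%R, 1%R[%classic : set (measurableTypeR R)).

Let mD : measurable D. Proof. exact: measurable_itv. Qed.

Lemma inL2P (X : R -> 'cV[R]_n) : inL2 X <-> forall i, sqint (fun z => X z i 0).
Proof. by split=> XL i; apply/Lfun2P; exact: XL. Qed.

Definition inL2_pred : {pred R -> 'cV[R]_n} := fun X => `[< inL2 X >].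

Lemma inL2_submod_closed : submod_closed inL2_pred.
Proof.
split; first by apply/asboolP/inL2P => i; under eq_fun do rewrite mxE; exact: sqint_cst.
move=> a X Y /asboolP/inL2P sX /asboolP/inL2P sY; apply/asboolP/inL2P => i.
rewrite (_ : (fun z => _) = (fun z => a * X z i 0) \+ (fun z => Y z i 0)).
  by apply: sqintD => //; exact: sqintZ.
by apply/funext => z; rewrite !mxE.
Qed.

HB.instance Definition _ :=
  GRing.isSubmodClosed.Build R (R -> 'cV[R]_n) inL2_pred inL2_submod_closed.

(** Representatives are kept apart: distance zero, for the forms below, is
    equality almost everywhere. *)
Record L2space := MkL2 { L2val : R -> 'cV[R]_n ; _ : L2val \in inL2_pred }.

HB.instance Definition _ := [isSub for L2val].
HB.instance Definition _ := [Choice of L2space by <:].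
HB.instance Definition _ := [SubChoice_isSubLmodule of L2space by <:].

Lemma L2valP (x : L2space) : inL2 (L2val x).
Proof. by case: x => X /= /asboolP. Qed.

Definition toL2 X (hX : inL2 X) : L2space := MkL2 (asboolT hX).

Lemma sqint_coord (x : L2space) i : sqint (fun z => L2val x z i 0).
Proof. exact: (inL2P _).1 (L2valP x) i. Qed.

Section WeightedDot.
Variables (a : 'I_n -> R) (nu : R).
Hypothesis a0 : forall i, 0 <= a i.

Let wt i z := a i * expR (nu * z).

Let wt_bound i z : D z -> `|wt i z| <= a i * expR `|nu|.
Proof.
rewrite /= in_itv/= => /andP[z0 z1]; rewrite /wt normrM (ger0_norm (a0 i)) ler_wpM2l//.
rewrite ger0_norm ?expR_ge0// ler_expR (le_trans (ler_norm _))// normrM (gtr0_norm z0).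
by rewrite ler_piMr// ltW.
Qed.

Lemma measurable_weight i : measurable_fun D (wt i).
Proof.
apply: measurable_funM; first exact: measurable_cst.
apply: (measurableT_comp (f := @expR R)).
  by apply: continuous_measurable_fun; exact: continuous_expR.
by apply: measurable_funM => //; exact: measurable_cst.
Qed.

Definition weighted_dot (x y : L2space) : R :=
  (\int[leb]_(z in D) \sum_i wt i z * (L2val x z i 0 * L2val y z i 0))%R.

Lemma weighted_coord_integrable (x y : L2space) i : leb.-integrable D
  (fun z => (wt i z * (L2val x z i 0 * L2val y z i 0))%:E).
Proof.
have := sqint_mul (sqint_boundedM (measurable_weight i) (@wt_bound i) (sqint_coord x i))
  (sqint_coord y i).
by apply: eq_integrable => // z _; rewrite /= mulrA.
Qed.

Let weighted_sumE (x y : L2space) :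
  (fun z => (\sum_i wt i z * (L2val x z i 0 * L2val y z i 0))%:E) =
  (fun z => (\sum_i (wt i z * (L2val x z i 0 * L2val y z i 0))%:E)%E).
Proof. by apply/funext => z; rewrite sumEFin. Qed.

Lemma weighted_integrable (x y : L2space) : leb.-integrable D
  (fun z => (\sum_i wt i z * (L2val x z i 0 * L2val y z i 0))%:E).
Proof.
rewrite weighted_sumE; apply: integrable_sum => // i _.
exact: weighted_coord_integrable.
Qed.

Lemma weighted_dotE x y : weighted_dot x y =
  \sum_i (\int[leb]_(z in D) (wt i z * (L2val x z i 0 * L2val y z i 0)))%R.
Proof.
have iF := @weighted_coord_integrable x y.
apply: EFin_inj; rewrite /weighted_dot /Rintegral fineK; last first.
  by apply: integrable_fin_num => //; exact: weighted_integrable.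
rewrite weighted_sumE integral_sum// -sumEFin; apply: eq_bigr => i _.
by rewrite fineK//; apply: integrable_fin_num => //; exact: iF.
Qed.

Lemma weighted_dotC x y : weighted_dot x y = weighted_dot y x.
Proof.
rewrite !weighted_dotE; apply: eq_bigr => i _; apply: eq_Rintegral => z _.
by rewrite [L2val x z i 0 * _]mulrC.
Qed.

Lemma weighted_dotDl x y w : weighted_dot (x + y) w = weighted_dot x w + weighted_dot y w.
Proof.
rewrite !weighted_dotE -big_split/=; apply: eq_bigr => i _.
rewrite -RintegralD//; try exact: weighted_coord_integrable.
by apply: eq_Rintegral => z _; rewrite !mxE mulrDl mulrDr.
Qed.

Lemma weighted_dotZl (k : R) x y : weighted_dot (k *: x) y = k * weighted_dot x y.
Proof.
rewrite !weighted_dotE mulr_sumr; apply: eq_bigr => i _.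
rewrite -RintegralZl//; last exact: weighted_coord_integrable.
by apply: eq_Rintegral => z _; rewrite !mxE; ring.
Qed.

Lemma weighted_dot_ge0 x : 0 <= weighted_dot x x.
Proof.
apply: Rintegral_ge0 => z _; apply: sumr_ge0 => i _.
by rewrite -expr2 mulr_ge0 ?sqr_ge0// mulr_ge0 ?expR_ge0.
Qed.

(** The quadratic Lyapunov functional of boundary control of hyperbolic
    systems, with exponential weights. *)
Definition weighted_semidot : semidot L2space :=
  Semidot weighted_dotC weighted_dotDl weighted_dotZl weighted_dot_ge0.

End WeightedDot.

Definition L2dot := weighted_semidot 0 (fun _ : 'I_n => ler01).

Lemma sqr_L2norm x : snorm L2dot x ^+ 2 = \sum_i mean_square (fun z => L2val x z i 0).
Proof.
rewrite sqr_snorm /= weighted_dotE; last by move=> i; exact: ler01.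
apply: eq_bigr => i _.
by apply: eq_Rintegral => z _; rewrite mul0r expR0 !mul1r expr2.
Qed.

Lemma normL2E x : normL2 (L2val x) = snorm L2dot x.
Proof.
rewrite /normL2 /snorm /= /weighted_dot; congr Num.sqrt.
apply: eq_Rintegral => z _; apply: eq_bigr => i _.
by rewrite mul0r expR0 !mul1r expr2.
Qed.

Lemma weighted_bounds (a : 'I_n -> R) nu (a0 : forall i, 0 <= a i) (m M : R) :
  0 <= nu -> 0 <= m -> 0 <= M -> (forall i, m <= a i) -> (forall i, a i * expR nu <= M) ->
  forall x, Num.sqrt m * snorm L2dot x <= snorm (weighted_semidot nu a0) x <=
    Num.sqrt M * snorm L2dot x.
Proof.
move=> nu0 m0 M0 am aM x; rewrite /snorm -!sqrtrM//.
have i1 i := @weighted_coord_integrable a nu a0 x x i.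
have i2 i := @weighted_coord_integrable (fun=> 1) 0 (fun _ => ler01) x x i.
have bnd i z : D z -> m <= a i * expR (nu * z) <= M.
  rewrite /= in_itv/= => /andP[z0 z1]; apply/andP; split.
    rewrite (le_trans (am i))// ler_peMr// -expR0 ler_expR.
    by rewrite mulr_ge0// ltW.
  rewrite (le_trans _ (aM i))// ler_wpM2l// ler_expR.
  by rewrite ler_piMr// ltW.
have i1m i : leb.-integrable D (fun z =>
    (m * (1 * expR (0 * z) * (L2val x z i 0 * L2val x z i 0)))%:E).
  by have := integrableZl mD m (i2 i); apply: eq_integrable.
have i1M i : leb.-integrable D (fun z =>
    (M * (1 * expR (0 * z) * (L2val x z i 0 * L2val x z i 0)))%:E).
  by have := integrableZl mD M (i2 i); apply: eq_integrable.
have e1 (k : R) i : k * (\int[leb]_(z in D) (1 * expR (0 * z) * (L2val x z i 0 * L2val x z i 0)))%R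
    = (\int[leb]_(z in D) (k * (1 * expR (0 * z) * (L2val x z i 0 * L2val x z i 0))))%R.
  by rewrite -RintegralZl//; exact: i2.
apply/andP; split; apply: ler_wsqrtr; rewrite /= (weighted_dotE _ a0)
  (@weighted_dotE (fun=> 1) 0 (fun _ => ler01)) mulr_sumr;
  apply: ler_sum => i _; rewrite e1.
- apply: (le_Rintegral mD (i1m i) (i1 i)) => z Dz.
  rewrite mul0r expR0 !mul1r ler_wpM2r -?expr2 ?sqr_ge0//.
  by have /andP[] := bnd i z Dz.
- apply: (le_Rintegral mD (i1 i) (i1M i)) => z Dz.
  rewrite mul0r expR0 !mul1r ler_wpM2r -?expr2 ?sqr_ge0//.
  by have /andP[] := bnd i z Dz.
Qed.

End L2Space.

Section L2Properties.
Context (R : realType) (n : nat).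
Local Notation leb := (@lebesgue_measure R).
Local Notation D := (`]0%R, 1%R[%classic : set (measurableTypeR R)).
Local Notation L2 := (L2space R n).
Local Notation L2norm := (snorm (L2dot R n)).

Let mD : measurable D. Proof. exact: measurable_itv. Qed.

Lemma mean_square_L2norm (x : L2) i : mean_square (fun z => L2val x z i 0) <= L2norm x ^+ 2.
Proof.
rewrite sqr_L2norm (bigD1 i)//= lerDl; apply: sumr_ge0 => j _.
exact: mean_square_ge0.
Qed.

Lemma eqL2_norm0 (x y : L2) : eqL2 (L2val x) (L2val y) <-> L2norm (x - y) = 0.
Proof.
split=> [xy|xy0].
  apply/eqP; rewrite -(sqrf_eq0 (L2norm (x - y))) sqr_L2norm; apply/eqP.
  apply: big1 => i _; rewrite /mean_square /Rintegral.
  have [_ ii] := sqint_coord (x - y) i.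
  rewrite (ae_eq_integral (fun=> 0%E))//; first by rewrite integral0.
  - by have /integrableP[] := ii.
  move: xy; apply: filterS => z + Dz => /(_ Dz) xyz.
  by rewrite /= !mxE xyz subrr expr0n.
have ii := weighted_integrable 0 (fun _ : 'I_n => ler01) (x - y) (x - y).
have [mi _] := integrableP _ _ _ ii.
have : (\int[leb]_(z in D)
    `|(\sum_i 1 * expR (0 * z) * (L2val (x - y)%R z i 0 * L2val (x - y)%R z i 0))%R%:E| = 0)%E.
  under eq_integral => z _.
    rewrite gee0_abs; last first.
      rewrite lee_fin; apply: sumr_ge0 => i _.
      by rewrite mul1r mulr_ge0 ?expR_ge0// -expr2 sqr_ge0.
    over.
  have := sqr_snorm (L2dot R n) (x - y); rewrite xy0 expr0n/= => e.
  by rewrite -[LHS]fineK; [congr EFin; exact: (esym e)|exact: integrable_fin_num].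
move/(ae_eq_integral_abs leb mD mi); apply: filterS => z + Dz => /(_ Dz)[] /= s0.
apply/colP => i; apply/eqP; rewrite -subr_eq0 -sqrf_eq0.
have p0 j : true -> 0 <= 1 * expR (0 * z) *
    (L2val (x - y) z j 0 * L2val (x - y) z j 0).
  by move=> _; rewrite mul0r expR0 !mul1r -expr2 sqr_ge0.
by have := psumr_eq0P p0 s0 (i := i) isT; rewrite mul0r expR0 !mul1r !mxE -expr2 => ->.
Qed.

Lemma L2norm_complete (u : nat -> L2) :
  (forall e, 0 < e -> exists N, forall p q, (N <= p)%N -> (N <= q)%N ->
    L2norm (u p - u q) <= e) ->
  exists x, forall e, 0 < e -> exists N, forall p, (N <= p)%N -> L2norm (u p - x) <= e.
Proof.
move=> uC.
have /choice[x xP] : forall i, exists x : R -> R, sqint x /\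
    forall e, 0 < e -> exists N, forall p, (N <= p)%N ->
      mean_square ((fun z => L2val (u p) z i 0) \- x) <= e.
  move=> i; have [||x sx xP] := @sqint_complete _ (fun p z => L2val (u p) z i 0).
  - by move=> p; exact: sqint_coord.
  - move=> e e0; have se0 : 0 < Num.sqrt e by rewrite sqrtr_gt0.
    have [N NP] := uC _ se0; exists N => p q Np Nq.
    have := mean_square_L2norm (u p - u q) i.
    rewrite (_ : (fun z => _) = (fun z => L2val (u p) z i 0) \- (fun z => L2val (u q) z i 0)).
      move/le_trans; apply; rewrite -[e in leRHS]sqr_sqrtr ?(ltW e0)//.
      by rewrite ler_pXn2r ?nnegrE ?snorm_ge0 ?sqrtr_ge0//; exact: NP.
    by apply/funext => z; rewrite !mxE.
  by exists x.
have hX : inL2 (fun z => \col_i x i z).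
  by apply/inL2P => i; under eq_fun do rewrite mxE; have [] := xP i.
exists (toL2 hX) => e e0.
have d0 : 0 < e ^+ 2 / n.+1%:R by rewrite divr_gt0// exprn_gt0.
have /choice[N NP] : forall i, exists N, forall p, (N <= p)%N ->
    mean_square ((fun z => L2val (u p) z i 0) \- x i) <= e ^+ 2 / n.+1%:R.
  by move=> i; have [_] := xP i; exact.
exists (\max_i N i) => p Np.
rewrite -(@ler_pXn2r _ 2) ?nnegrE ?snorm_ge0 ?(ltW e0)// sqr_L2norm.
apply: (le_trans (y := \sum_(i < n) (e ^+ 2 / n.+1%:R))).
  apply: ler_sum => i _; apply: le_trans (NP i p _).
    rewrite le_eqVlt; apply/orP; left; apply/eqP; congr mean_square.
    by apply/funext => z; rewrite !mxE.
  by rewrite (leq_trans _ Np)// leq_bigmax.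
rewrite sumr_const card_ord.
have -> : (e ^+ 2 / n.+1%:R) *+ n = e ^+ 2 * (n%:R / n.+1%:R).
  by rewrite -[LHS]mulr_natr mulrAC mulrA.
rewrite ler_piMr ?sqr_ge0//.
by rewrite ler_pdivrMr// mul1r ler_nat.
Qed.

End L2Properties.

Section MatrixAction.
Context (R : realType) (n q : nat) (N : 'M[R]_(n, q)).
Local Notation leb := (@lebesgue_measure R).
Local Notation D := (`]0%R, 1%R[%classic : set (measurableTypeR R)).

(** A crude bound of the squared operator norm. *)
Definition mx_bound : R := \sum_i (\sum_j `|N i j|) ^+ 2.

Lemma mx_bound_ge0 : 0 <= mx_bound.
Proof. by apply: sumr_ge0 => i _; exact: sqr_ge0. Qed.

Lemma mulmx_sqr_le (v : 'cV[R]_q) :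
  \sum_i (N *m v) i 0 ^+ 2 <= mx_bound * \sum_j v j 0 ^+ 2.
Proof.
set s := \sum_j v j 0 ^+ 2; have s0 : 0 <= s by apply: sumr_ge0 => j _; exact: sqr_ge0.
have vs j : `|v j 0| <= Num.sqrt s.
  rewrite -sqrtr_sqr; apply: ler_wsqrtr; rewrite /s (bigD1 j)//= lerDl.
  by apply: sumr_ge0 => k _; exact: sqr_ge0.
rewrite /mx_bound mulr_suml; apply: ler_sum => i _.
rewrite -[s]sqr_sqrtr// -exprMn -(real_normK (num_real ((N *m v) i 0))).
rewrite ler_pXn2r ?nnegrE ?mulr_ge0 ?sqrtr_ge0 ?sumr_ge0//.
rewrite mxE (le_trans (ler_norm_sum _ _ _))// mulr_suml; apply: ler_sum => j _.
by rewrite normrM ler_wpM2l.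
Qed.

Lemma mulmx_inL2 (X : R -> 'cV[R]_q) : inL2 X -> inL2 (fun z => N *m X z).
Proof.
move=> /inL2P sX; apply/inL2P => i; under eq_fun do rewrite mxE.
by apply: sqint_sum => j; exact: sqintZ.
Qed.

(** Total, so that a forcing term is a curve in [L^2] before its values are
    known to be square-integrable. *)
Definition mx_lift (X : R -> 'cV[R]_q) : L2space R n :=
  if pselect (inL2 X) is left h then toL2 (mulmx_inL2 h) else 0.

Lemma mx_liftE X : inL2 X -> L2val (mx_lift X) = fun z => N *m X z.
Proof. by move=> h; rewrite /mx_lift; case: pselect. Qed.

Lemma mx_lift_norm (x : L2space R q) (y : L2space R n) :
  (forall z, L2val y z = N *m L2val x z) ->
  snorm (L2dot R n) y <= Num.sqrt mx_bound * snorm (L2dot R q) x.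
Proof.
move=> yx; rewrite -(@ler_pXn2r _ 2) ?nnegrE ?mulr_ge0 ?snorm_ge0 ?sqrtr_ge0//.
have K0 := mx_bound_ge0.
rewrite exprMn (sqr_sqrtr K0) !sqr_snorm /= /weighted_dot.
have ix := weighted_integrable 0 (fun _ : 'I_q => ler01) x x.
have mD : measurable D by exact: measurable_itv.
have iy := weighted_integrable 0 (fun _ : 'I_n => ler01) y y.
rewrite -(RintegralZl _ mD ix); apply: (le_Rintegral mD iy).
  by have := integrableZl mD mx_bound ix; apply: eq_integrable.
move=> z _; have := mulmx_sqr_le (L2val x z); rewrite -yx.
have e p (v : 'cV[R]_p) : \sum_i 1 * expR (0 * z) * (v i 0 * v i 0) = \sum_i v i 0 ^+ 2.
  by apply: eq_bigr => i _; rewrite mul0r expR0 !mul1r expr2.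
by rewrite !e.
Qed.

End MatrixAction.

Section TimeLift.
Context (R : realType) (n q : nat) (N : 'M[R]_(n, q)) (I : set R).
Local Notation leb := (@lebesgue_measure R).
Local Notation L2norm n := (snorm (L2dot R n)).
Hypothesis mI : measurable (I : set (measurableTypeR R)).

Lemma finite_rank_sum (V : lmodType R) r (c : 'I_r -> R -> R) (v : 'I_r -> V) :
  (forall j, bounded_mfun (c j)) ->
  finite_rank (@bounded_mfun R) (fun t => \sum_j c j t *: v j).
Proof.
elim: r c v => [|r IH] c v bc.
  by under eq_fun do rewrite big_ord0; exact: finite_rank0.
under eq_fun do rewrite big_ord_recl; apply: finite_rankD => //.
by apply: (IH (fun j => c (lift ord0 j)) (fun j => v (lift ord0 j))) => j.
Qed.

(** Extending the forcing by zero off [I] gives the same time axis to bounded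
    and unbounded [I]. *)
Definition time_lift (d : R -> R -> 'cV[R]_q) (t : R) : L2space R n :=
  if `[< I t >] then mx_lift N (d t) else 0.

Lemma time_liftE d t : I t -> inL2 (d t) -> L2val (time_lift d t) = opN N (d t).
Proof. by move=> It dt; rewrite /time_lift asboolT//; exact: mx_liftE. Qed.

Lemma time_lift_strongly_measurable d : L1L2 I d ->
  strongly_measurable (L2dot R n) (time_lift d).
Proof.
move=> [dL [s sstep sd] _].
have /choice[u uP] : forall k, exists u : R -> L2space R n,
    finite_rank (@bounded_mfun R) u /\ (forall t, inL2 (s k t)) /\
    forall t, u t = (\1_I t : R) *: mx_lift N (s k t).
  move=> k; have [r [E [v [mE vL sE]]]] := sstep k.
  have sL t : inL2 (s k t).
    apply/inL2P => i; under eq_fun do rewrite sE summxE.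
    apply: sqint_sum => j; under eq_fun do rewrite mxE.
    by apply: sqintZ; have /inL2P := vL j; exact.
  exists (fun t => \sum_j (\1_(E j `&` I) t : R) *: mx_lift N (v j)); split.
    apply: finite_rank_sum => j; split; first exact/measurable_indicP/measurableI.
    exists 1 => t; rewrite indicE.
    by case: (_ \in _); rewrite ?normr1 ?normr0.
  split=> // t; apply: val_inj; apply/funext => z; apply/colP => i.
  transitivity (\sum_j (\1_(E j `&` I) t : R) * (N *m v j z) i 0).
    elim/big_ind2 : _ => [|x1 x2 y1 y2 e1 e2|j _].
    - by rewrite /= mxE.
    - by rewrite /= mxE e1 e2.
    - by rewrite /= [LHS]mxE (mx_liftE N (vL j)).
  rewrite /= [RHS]mxE (mx_liftE N (sL t)) sE mulmx_sumr summxE mulr_sumr.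
  apply: eq_bigr => j _; rewrite indicI /= -scalemxAr [in RHS]mxE mulrA.
  by rewrite [\1_(E j) t * _]mulrC.
exists u => [k|t]; first by have [] := uP k.
have uE k := (uP k).2.2 t.
have [It|nIt] := boolP `[< I t >].
  have It' : I t by exact/asboolP.
  have bnd k : L2norm n (time_lift d t - u k t) <=
      Num.sqrt (mx_bound N) * normL2 (d t \- s k t).
    have sL := (uP k).2.1 t; have hd := dL t It'.
    have -> : d t \- s k t = L2val (toL2 hd - toL2 sL) by [].
    rewrite normL2E; apply: mx_lift_norm => z.
    rewrite uE indicE mem_set// scale1r /time_lift It.
    change (L2val (mx_lift N (d t)) z - L2val (mx_lift N (s k t)) z =
      N *m (d t z - s k t z)).
    by rewrite (mx_liftE N hd) (mx_liftE N sL) mulmxBr.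
  apply: (@squeeze_cvgr _ _ _ _ (fun=> 0) (fun k => Num.sqrt (mx_bound N) * normL2 (d t \- s k t))).
  - by apply: nearW => k; rewrite snorm_ge0 bnd.
  - exact: cvg_cst.
  - rewrite -[X in _ --> X](mulr0 (Num.sqrt (mx_bound N))).
    by apply: cvgM; [exact: cvg_cst|exact: sd].
apply: cvg_near_cst; apply: nearW => k.
rewrite uE /time_lift (negbTE nIt) indicE memNset; last exact/asboolPn.
by rewrite scale0r subrr snorm0.
Qed.

End TimeLift.

Section TimeLiftIntegral.
Context (R : realType) (n q : nat) (N : 'M[R]_(n, q)) (I : set R).
Local Notation leb := (@lebesgue_measure R).
Local Notation L2norm n := (snorm (L2dot R n)).
Hypothesis mI : measurable (I : set (measurableTypeR R)).

Lemma time_lift_integrable (d : R -> R -> 'cV[R]_q) (T : R) : L1L2 I d ->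
  (\int[leb]_(t in `]0%R, T]) (L2norm n (time_lift N I d t))%:E < +oo)%E.
Proof.
move=> hd; have [dL _ dint] := hd.
pose d1 := time_lift 1%:M I d.
have m1 := strongly_measurable_snorm (time_lift_strongly_measurable 1%:M mI hd).
have mN := strongly_measurable_snorm (time_lift_strongly_measurable N mI hd).
have d1E : (fun t => (L2norm q (d1 t))%:E) = (fun t => (normL2 (d t))%:E) \_ I.
  apply/funext => t; rewrite patchE; case: ifPn => [|tI].
    rewrite inE => It; rewrite -normL2E (time_liftE 1%:M It (dL t It)).
    by congr (normL2 _)%:E; apply/funext => z; rewrite /opN mul1mx.
  rewrite /d1 /time_lift asboolF ?snorm0//.
  by move=> It; move: tI; rewrite mem_set.
apply: (@le_lt_trans _ _ (\int[leb]_(t in `]0%R, T]) ((Num.sqrt (mx_bound N))%:E * (L2norm q (d1 t))%:E))%E).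
  apply: ge0_le_integral => //.
  - by move=> t _; rewrite lee_fin snorm_ge0.
  - by apply/measurable_EFinP; exact: measurable_funTS.
  - by apply: measurable_funeM; apply/measurable_EFinP; exact: measurable_funTS.
  move=> t _; rewrite -EFinM lee_fin /d1 /time_lift.
  have [It|nIt] := boolP `[< I t >]; last by rewrite !snorm0 mulr0.
  have dt := dL t (asboolW It).
  apply: mx_lift_norm => z; rewrite (mx_liftE N dt) (mx_liftE 1%:M dt).
  by rewrite mul1mx.
rewrite ge0_integralZl//; last 2 first.
- by apply/measurable_EFinP; exact: measurable_funTS.
- by move=> t _; rewrite lee_fin snorm_ge0.
apply: lte_mul_pinfty; [by rewrite lee_fin sqrtr_ge0|by []|].
apply: le_lt_trans dint; rewrite [leRHS]integral_mkcond -d1E.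
apply: ge0_subset_integral => //; first exact/measurable_EFinP.
by move=> t _; rewrite lee_fin snorm_ge0.
Qed.

End TimeLiftIntegral.

Section NormChange.
Context (R : realType) (V : lmodType R) (b b' : semidot V) (C : R).
Hypotheses (C0 : 0 <= C) (bC : forall x, snorm b' x <= C * snorm b x).
Local Notation leb := (@lebesgue_measure R).

Lemma strongly_measurable_norm f : strongly_measurable b f -> strongly_measurable b' f.
Proof.
move=> [u fu uf]; exists u => // t.
apply: (@squeeze_cvgr _ _ _ _ (fun=> 0) (fun k => C * snorm b (f t - u k t))).
- by apply: nearW => k; rewrite snorm_ge0 bC.
- exact: cvg_cst.
- by rewrite -[X in _ --> X](mulr0 C); apply: cvgM; [exact: cvg_cst|exact: uf].
Qed.

Lemma integral_norm_le f s (a c : R) : strongly_measurable b f ->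
  finite_rank (@bounded_mfun R) s ->
  (\int[leb]_(t in `]a, c]) (snorm b' (f t - s t))%:E <=
   C%:E * \int[leb]_(t in `]a, c]) (snorm b (f t - s t))%:E)%E.
Proof.
move=> mf fs.
have m1 := measurable_snormB mf fs.
have m2 := measurable_snormB (strongly_measurable_norm mf) fs.
rewrite -ge0_integralZl//; last 2 first.
- by apply/measurable_EFinP; exact: measurable_funTS.
- by move=> t _; rewrite lee_fin snorm_ge0.
apply: ge0_le_integral => //.
- by move=> t _; rewrite lee_fin snorm_ge0.
- by apply/measurable_EFinP; exact: measurable_funTS.
- by apply: measurable_funeM; apply/measurable_EFinP; exact: measurable_funTS.
- by move=> t _; rewrite -EFinM lee_fin.
Qed.

End NormChange.

(** * The boundary condition *)

Section FixedPoint.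
Context (R : realType) (n : nat).
Implicit Types c : 'cV[R]_n.

Definition sum_sqr c : R := \sum_i c i 0 ^+ 2.

Lemma sum_sqr_ge0 c : 0 <= sum_sqr c.
Proof. by apply: sumr_ge0 => i _; exact: sqr_ge0. Qed.

Lemma sqr_le_sum_sqr c i : c i 0 ^+ 2 <= sum_sqr c.
Proof.
rewrite /sum_sqr (bigD1 i)//= lerDl; apply: sumr_ge0 => j _; exact: sqr_ge0.
Qed.

Lemma sum_sqrD_le c c' : sum_sqr (c + c') <= 2 * sum_sqr c + 2 * sum_sqr c'.
Proof.
rewrite !mulr_sumr -big_split/=; apply: ler_sum => i _; rewrite mxE.
move: (c i 0) (c' i 0) => p q.
by have := sqr_ge0 (p - q); rewrite sqrrB sqrrD !mulr2n; lra.
Qed.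

(** Banach's fixed point theorem: the increments of the iterates of [0] decay
    geometrically. *)
Lemma contraction_fixed_point (Phi : 'cV[R]_n -> 'cV[R]_n) :
  (forall c c', sum_sqr (Phi c - Phi c') <= 4^-1 * sum_sqr (c - c')) ->
  exists c, c = Phi c.
Proof.
move=> ctr; pose u k := iter k Phi 0.
pose s := Num.sqrt (sum_sqr (u 1%N - u 0%N)).
have s0 : 0 <= s by exact: sqrtr_ge0.
have uS k : sum_sqr (u k.+1 - u k) <= (2 * s / (2 ^ k.+1)%:R) ^+ 2.
  elim: k => [|k IH].
    have -> : 2 * s / (2 ^ 1)%:R = s by rewrite expn1; field.
    by rewrite sqr_sqrtr ?sum_sqr_ge0.
  apply: le_trans (ctr _ _) _; rewrite (le_trans (ler_wpM2l _ IH))//.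
  rewrite le_eqVlt; apply/orP; left; apply/eqP.
  rewrite (expnS 2 k.+1) natrM invfM !exprMn.
  rewrite (_ : 4^-1 = 2^-1 ^+ 2 :> R); last by rewrite exprVn -natrX.
  by ring.
have uC i : cvgn (fun k => u k i 0).
  apply: abs_series_cvg.
  apply: (@le_lt_trans _ _ (2 * s)%:E); last exact: ltry.
  apply: le_trans (epsilon_trick0 xpredT (mulr_ge0 (ler0n R 2) s0)).
  apply: lee_nneseries => [k _ _|k _]; rewrite lee_fin//.
  have e0 : 0 <= 2 * s / (2 ^ k.+1)%:R by rewrite divr_ge0 ?mulr_ge0.
  rewrite -(@ler_pXn2r _ 2) ?nnegrE// real_normK ?num_real//.
  by apply: le_trans (uS k); have := sqr_le_sum_sqr (u k.+1 - u k) i; rewrite !mxE.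
pose c : 'cV[R]_n := \col_i limn (fun k => u k i 0).
have uc i : (fun k => u k i 0) @ \oo --> c i 0 by rewrite mxE; exact: uC.
exists c; apply/colP => i; apply/eqP; rewrite -subr_eq0 -sqrf_eq0.
have lim1 : (fun k => (u k.+1 i 0 - Phi c i 0) ^+ 2) @ \oo --> (c i 0 - Phi c i 0) ^+ 2.
  have uc1 : (fun k => u k.+1 i 0) @ \oo --> c i 0.
    by rewrite (cvg_shiftS (fun k => u k i 0)).
  by apply: cvgM; (apply: cvgB; [exact: uc1|exact: cvg_cst]).
have lim2 : (fun k => 4^-1 * sum_sqr (u k - c)) @ \oo --> (0 : R).
  rewrite -[X in _ --> X](mulr0 4^-1); apply: cvgM; first exact: cvg_cst.
  rewrite [X in _ --> X](_ : 0 = \sum_(j < n) (0 : R)); last by rewrite big1.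
  apply: cvg_big => [|j _]; first exact: add_continuous.
  rewrite -[X in _ --> X](mulr0 (0 : R)).
  have -> : (fun k => (u k - c) j 0 ^+ 2) = (fun k => (u k j 0 - c j 0) * (u k j 0 - c j 0)).
    by apply/funext => k; rewrite !mxE.
  have d0 : (fun k => u k j 0 - c j 0) @ \oo --> (0 : R).
    by rewrite -[X in _ --> X](subrr (c j 0)); apply: cvgB; [exact: uc|exact: cvg_cst].
  exact: cvgM.
apply/eqP; apply: (cvg_unique _ lim1); first exact: Rhausdorff.
apply: (@squeeze_cvgr _ _ _ _ (fun=> 0) (fun k => 4^-1 * sum_sqr (u k - c))) => //.
  apply: nearW => k; rewrite sqr_ge0/=; apply: le_trans (ctr _ _).
  by have := sqr_le_sum_sqr (Phi (u k) - Phi c) i; rewrite !mxE.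
exact: cvg_cst.
Qed.

End FixedPoint.

Section BoundaryMap.
Context (R : realType) (n m : nat).
Variables (Hcl : 'M[R]_n) (B : 'M[R]_(n, m)) (K : 'M[R]_(m, n)) (ubar : 'cV[R]_m).
Hypothesis ubar_gt0 : forall i, 0 < ubar i 0.

Lemma clip_lipschitz (M a c : R) : 0 < M -> `|clip M a - clip M c| <= `|a - c|.
Proof.
move=> M0; rewrite /clip.
have n1 := ler_norm (a - c); have n2 := ler_norm (c - a); rewrite distrC in n2.
have n0 := normr_ge0 (a - c).
have mM : - M <= M by lra.
have e d : (Num.max (- M) (Num.min M d) = d /\ - M <= d <= M) \/
    (Num.max (- M) (Num.min M d) = M /\ M <= d) \/ (Num.max (- M) (Num.min M d) = - M /\ d <= - M).
  case: (leP M d) => Md; first by right; left; rewrite max_r.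
  case: (leP (- M) d) => dM; first by left; rewrite (ltW Md).
  by right; right; rewrite (ltW dM).
rewrite ler_norml.
by case: (e a) => [[-> /andP[? ?]]|[[-> ?]|[-> ?]]]; case: (e c) => [[-> /andP[? ?]]|[[-> ?]|[-> ?]]];
  apply/andP; split; lra.
Qed.

Lemma sat_clip u i : sat ubar u i 0 = clip (ubar i 0) (u i 0).
Proof.
rewrite mxE /clip; have M0 := ubar_gt0 i; move: (ubar i 0) (u i 0) M0 => M a M0.
have [a0|a0|->] := ltgtP a 0.
- rewrite ltr0_sg// ltr0_norm// mulrN1.
  case: (leP M a) => Ma; first by lra.
  by case: (leP (- M) a) => Ma'; case: (leP (- a) M) => Ma''; lra.
- rewrite gtr0_sg// gtr0_norm// mulr1.
  by case: (leP M a) => Ma; [case: (leP (- M) M) => ?|case: (leP (- M) a) => ?]; case: (leP a M) => ?; lra.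
- rewrite sgr0 mulr0 min_r ?(ltW M0)// max_r//; lra.
Qed.

(** Clipping is 1-Lipschitz, so that clipping minus the identity is
    2-Lipschitz. *)
Lemma deadzone_lipschitz u u' :
  sum_sqr (deadzone ubar u - deadzone ubar u') <= 4 * sum_sqr (u - u').
Proof.
rewrite mulr_sumr; apply: ler_sum => i _.
have -> : (deadzone ubar u - deadzone ubar u') i 0 =
    (clip (ubar i 0) (u i 0) - clip (ubar i 0) (u' i 0)) - (u i 0 - u' i 0).
  by rewrite -!sat_clip !mxE; ring.
have -> : (u - u') i 0 = u i 0 - u' i 0 by rewrite !mxE.
have := clip_lipschitz (u i 0) (u' i 0) (ubar_gt0 i).
move: (_ - _ : R) (u i 0 - u' i 0) => p q pq.
have p2 : p ^+ 2 <= q ^+ 2.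
  by rewrite -(real_normK (num_real p)) -(real_normK (num_real q)) ler_pXn2r ?nnegrE.
by have := sqr_ge0 (p + q); rewrite sqrrB sqrrD !mulr2n; lra.
Qed.

Definition boundary_map (c : 'cV[R]_n) : 'cV[R]_n := Hcl *m c + B *m deadzone ubar (K *m c).

(** The factor 8 is the 2 of [sum_sqrD_le] times the 4 of
    [deadzone_lipschitz]. *)
Definition boundary_const : R := 2 * mx_bound Hcl + 8 * (mx_bound B * mx_bound K).

Lemma boundary_const_ge0 : 0 <= boundary_const.
Proof.
by rewrite /boundary_const addr_ge0 ?mulr_ge0 ?mx_bound_ge0.
Qed.

Lemma boundary_map_lipschitz c c' :
  sum_sqr (boundary_map c - boundary_map c') <= boundary_const * sum_sqr (c - c').
Proof.
have -> : boundary_map c - boundary_map c' = Hcl *m (c - c') +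
    B *m (deadzone ubar (K *m c) - deadzone ubar (K *m c')).
  by rewrite /boundary_map !mulmxBr opprD addrACA.
apply: le_trans (sum_sqrD_le _ _) _; 
have -> : boundary_const * sum_sqr (c - c') = 2 * (mx_bound Hcl * sum_sqr (c - c')) +
  8 * (mx_bound B * (mx_bound K * sum_sqr (c - c'))) by rewrite /boundary_const; ring.
apply: lerD; first by rewrite ler_wpM2l// mulmx_sqr_le.
have -> : 8 * (mx_bound B * (mx_bound K * sum_sqr (c - c'))) =
  2 * (mx_bound B * (4 * (mx_bound K * sum_sqr (c - c')))) by ring.
rewrite ler_wpM2l// (le_trans (mulmx_sqr_le _ _))// ler_wpM2l ?mx_bound_ge0//.
apply: le_trans (deadzone_lipschitz _ _) _; rewrite ler_wpM2l// -mulmxBr.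
exact: mulmx_sqr_le.
Qed.

Lemma boundary_map0 : boundary_map 0 = 0.
Proof.
rewrite /boundary_map mulmx0 add0r mulmx0.
rewrite (_ : deadzone ubar 0 = 0) ?mulmx0//; apply/colP => i.
by rewrite !mxE normr0 sgr0 mulr0 subr0.
Qed.

End BoundaryMap.

(** * The hyperbolic operator *)

Section EnergyIdentity.
Context (R : realType).
Local Notation leb := (@lebesgue_measure R).
Local Notation D := (`]0%R, 1%R[%classic : set (measurableTypeR R)).

Let mD : measurable D. Proof. exact: measurable_itv. Qed.

Lemma Rintegral_ae_eq (f g : R -> R) : measurable_fun D f -> measurable_fun D g ->
  ae_eq leb D f g -> (\int[leb]_(z in D) f z)%R = (\int[leb]_(z in D) g z)%R.
Proof.
move=> mf mg fg; congr fine; apply: ae_eq_integral => //; try exact/measurable_EFinP.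
by move: fg; apply: filterS => z + Dz => /(_ Dz) /= ->.
Qed.

Lemma ae_eq_map2 (f f' g g' h h' : R -> R) :
  (forall z, f z = f' z -> g z = g' z -> h z = h' z) ->
  ae_eq leb D f f' -> ae_eq leb D g g' -> ae_eq leb D h h'.
Proof.
move=> H; apply: filterS2 => z + + Dz => /(_ Dz) + /(_ Dz); exact: H.
Qed.

Lemma exp_H1 (nu : R) : H1_pair (fun z => expR (nu * z)) (fun z => nu * expR (nu * z)).
Proof.
have dE z : is_derive z (1 : R) (fun z => expR (nu * z)) (nu * expR (nu * z)).
  have dl : is_derive z 1 (fun z : R => nu * z) nu.
    have dz := is_deriveZ nu (is_derive_id z (1 : R)); apply: is_derive_eq dz _.
    exact: mulr1.
  by have de := is_derive1_comp (is_derive_expR (nu * z)) dl; apply: is_derive_eq de (mulrC _ _).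
apply: H1_pair_C1.
apply: continuous_subspaceT => z; apply: cvgM; first exact: cvg_cst.
apply: continuous_comp; last exact: continuous_expR.
by apply: cvgM; [exact: cvg_cst|exact: cvg_id].
Qed.

Lemma weighted_energy_integrable (nu : R) F f : abs_continuous F f ->
  leb.-integrable D (fun z => (expR (nu * z) * (F z * F z))%:E) /\
  leb.-integrable D (fun z => (expR (nu * z) * (F z * f z))%:E).
Proof.
move=> aF; have [aE _] := exp_H1 nu.
have cE := abs_continuous_continuous aE.
have cFF := abs_continuous_continuous (abs_continuousM aF aF).
have cEFF : {within `[0%R, 1%R]%classic, continuous ((fun z => expR (nu * z)) \* (F \* F))}.
  by move=> z; apply: cvgM; [exact: cE|exact: cFF].
split.
  exact: sqint_integrable (continuous_sqint cEFF).
have [fi _] := aF; have cEF : {within `[0%R, 1%R]%classic, continuous ((fun z => expR (nu * z)) \* F)}.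
  by move=> z; apply: cvgM; [exact: cE|exact: abs_continuous_continuous aF z].
have := integrableM_continuous fi cEF.
by apply: eq_integrable => // z _; rewrite /= mulrC mulrA.
Qed.

(** Integrate the derivative of [exp (nu z) F ^ 2 / 2]. *)
Lemma weighted_energy (nu : R) F f : abs_continuous F f ->
  (\int[leb]_(z in D) (expR (nu * z) * (F z * f z)))%R =
  2^-1 * (expR nu * F 1 ^+ 2 - F 0 ^+ 2)
  - 2^-1 * nu * (\int[leb]_(z in D) (expR (nu * z) * (F z * F z)))%R.
Proof.
move=> aF; have [aE _] := exp_H1 nu.
have aFF := abs_continuousM aF aF; have [iFF _] := aFF.
have cE := abs_continuous_continuous aE.
have cFF := abs_continuous_continuous aFF.
have [i1 i2] := weighted_energy_integrable nu aF.
have := abs_continuous_parts (abs_continuousM aE aFF).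
rewrite /= mulr1 mulr0 expR0 mul1r.
rewrite (_ : Rintegral _ _ _ = nu * (\int[leb]_(z in D) (expR (nu * z) * (F z * F z)))%R +
    2 * (\int[leb]_(z in D) (expR (nu * z) * (F z * f z)))%R); last first.
  rewrite -!RintegralZl// -RintegralD//.
  - by apply: eq_Rintegral => z _; ring.
  - by have := integrableZl mD nu i1; apply: eq_integrable.
  - by have := integrableZl mD 2 i2; apply: eq_integrable.
by rewrite -!expr2 => e; lra.
Qed.

End EnergyIdentity.

Section Operator.
Context (R : realType) (n m : nat).
Local Notation leb := (@lebesgue_measure R).
Local Notation D := (`]0%R, 1%R[%classic : set (measurableTypeR R)).
Variables (Lam Hcl : 'M[R]_n) (B : 'M[R]_(n, m)) (K : 'M[R]_(m, n)) (ubar : 'cV[R]_m).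
Hypotheses (Lam_diag : is_diag_mx Lam) (Lam_gt0 : forall k, 0 < Lam k k)
  (ubar_gt0 : forall i, 0 < ubar i 0).
Local Notation L2 := (L2space R n).
Local Notation bmap := (boundary_map Hcl B K ubar).

Let mD : measurable D. Proof. exact: measurable_itv. Qed.

Lemma diag_mulE (c : 'cV[R]_n) k : (Lam *m c) k 0 = Lam k k * c k 0.
Proof.
rewrite mxE (bigD1 k)//= big1 ?addr0// => j jk.
by rewrite (is_diag_mxP Lam_diag) ?mul0r// eq_sym.
Qed.

(** The weak derivative passes to the continuous representative, which is
    therefore absolutely continuous; boundary values enter integrations by
    parts from here on. *)
Lemma graphA_abs_continuous X Y : graphA Lam Hcl B K ubar X Y -> exists Xc G,
  [/\ eqL2 X Xc, inL2 G, forall k, abs_continuous (fun z => Xc z k 0) (fun z => G z k 0),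
      Xc 0 = bmap (Xc 1) & eqL2 Y (fun z => - (Lam *m G z))].
Proof.
move=> [[[XL _] [Xc [Xcc XXc] bc]] [G [GL XG YG]]].
exists Xc, G; split => // k.
have /sqint_integrable Gi := (inL2P G).1 GL k.
apply: weak_abs_continuous => // phi tphi.
rewrite -(XG k phi tphi).
have [_ cphi _] := tphi.
have mphi : measurable_fun D (derive1 phi).
  apply: (measurable_funS (E := [set: measurableTypeR R])) => //.
  exact: continuous_measurable_fun.
apply: Rintegral_ae_eq.
- by apply: measurable_funM => //; have [] := continuous_sqint (Xcc k).
- by apply: measurable_funM => //; have [] := (inL2P X).1 XL k.
- by move: XXc; apply: filterS => z + Dz => /(_ Dz) ->.
Qed.

Lemma graphA_intro (Xc G : R -> 'cV[R]_n) : (forall k, H1_pair (fun z => Xc z k 0) (fun z => G z k 0)) ->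
  Xc 0 = bmap (Xc 1) -> graphA Lam Hcl B K ubar Xc (fun z => - (Lam *m G z)).
Proof.
move=> hXG bc.
have XL : inL2 Xc by apply/inL2P => k; exact: H1_pair_sqint.
have GL : inL2 G by apply/inL2P => k; have [] := hXG k.
have XG : weak_derivative Xc G.
  by move=> k phi tphi; have [aX _] := hXG k; exact: abs_continuous_weak.
split; last by exists G; split => //; exact: ae_eq_refl.
split; first by split => //; exists G.
exists Xc => //; split => [k|]; last exact: ae_eq_refl.
by have [aX _] := hXG k; exact: abs_continuous_continuous aX.
Qed.

(** This weight cancels the speed in the product of [x] with its image under
    the operator. *)
Definition speed_weight k := (Lam k k)^-1.

Lemma speed_weight_ge0 k : 0 <= speed_weight k.
Proof. by rewrite /speed_weight invr_ge0 ltW. Qed.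

Local Notation nu := (boundary_const Hcl B K).
Local Notation dotA := (weighted_semidot nu speed_weight_ge0).

Definition operatorA (x y : L2) := graphA Lam Hcl B K ubar (L2val x) (L2val y).

(** The sum of the speeds times any [speed_weight] is at least 1, which bounds
    the energy without speed weights by the squared norm. *)
Definition growth_rate : R := 2^-1 * nu * \sum_k Lam k k.

Lemma growth_rate_ge0 : 0 <= growth_rate.
Proof.
rewrite /growth_rate mulr_ge0//; last by apply: sumr_ge0 => k _; exact: ltW.
by rewrite mulr_ge0// boundary_const_ge0.
Qed.

(** Let [d] be the difference of two elements of the domain. By the energy
    identity, the pairing is the boundary term [sum (d_k(0) ^ 2 - exp nu
    d_k(1) ^ 2) / 2] plus a multiple of the energy without speed weights. The
    squared Lipschitz constant of the boundary condition is [nu <= exp nu], so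
    that the boundary term is at most zero. *)
Lemma operatorA_dissipative : dissipative dotA growth_rate operatorA.
Proof.
move=> x y x' y' /graphA_abs_continuous[X [G [xX GL aX bX yG]]].
move=> /graphA_abs_continuous[X' [G' [xX' GL' aX' bX' yG']]].
pose d k z := X z k 0 - X' z k 0; pose g k z := G z k 0 - G' z k 0.
have ad k : abs_continuous (d k) (g k).
  have aD := abs_continuousD (aX k) (abs_continuousM (abs_continuous_cst (-1)) (aX' k)).
  by apply: (abs_continuous_eq aD) => z _; rewrite /d /g /=; ring.
have nu0 : 0 <= nu by exact: boundary_const_ge0.
pose e k := (\int[leb]_(z in D) (expR (nu * z) * (d k z * d k z)))%R.
have e0 k : 0 <= e k.
  by apply: Rintegral_ge0 => z _; rewrite mulr_ge0 ?expR_ge0// -expr2 sqr_ge0.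
have msub (x1 x2 : L2) k : measurable_fun D (fun z => L2val x1 z k 0 - L2val x2 z k 0).
  by apply: measurable_funB; [have [] := sqint_coord x1 k|have [] := sqint_coord x2 k].
have mE : measurable_fun D (fun z => expR (nu * z)).
  by have [/abs_continuous_continuous/continuous_sqint[]] := exp_H1 nu.
have md k : measurable_fun D (d k).
  by have /abs_continuous_continuous/continuous_sqint[] := ad k.
have mg k : measurable_fun D (g k).
  by have [/integrableP[/measurable_EFinP]] := ad k.
have xd k : ae_eq leb D (fun z => L2val x z k 0 - L2val x' z k 0) (d k).
  by move: xX xX'; apply: filterS2 => z + + Dz => /(_ Dz) -> /(_ Dz) ->.
have yg k : ae_eq leb D (fun z => L2val y z k 0 - L2val y' z k 0) (fun z => - (Lam k k * g k z)).
  move: yG yG'; apply: filterS2 => z + + Dz => /(_ Dz) -> /(_ Dz) ->.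
  by rewrite ![(- (Lam *m _)) k 0]mxE !diag_mulE /g; ring.
have -> : dotA (x - x') (x - x') = \sum_k (Lam k k)^-1 * e k.
  rewrite /= weighted_dotE; last exact: speed_weight_ge0.
  apply: eq_bigr => k _; rewrite /e -RintegralZl//; last by have [] := weighted_energy_integrable nu (ad k).
  apply: Rintegral_ae_eq.
  - by have /integrableP[/measurable_EFinP] :=
      weighted_coord_integrable nu speed_weight_ge0 (x - x') (x - x') k.
  - by apply: measurable_funM => //; apply: measurable_funM => //; exact: measurable_funM.
  refine (ae_eq_map2 _ (xd k) (xd k)); move=> z + _.
  by rewrite !mxE => ->; rewrite -mulrA.
have -> : dotA (x - x') (y - y') = \sum_k - (\int[leb]_(z in D) (expR (nu * z) * (d k z * g k z)))%R.
  rewrite /= weighted_dotE; last exact: speed_weight_ge0.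
  apply: eq_bigr => k _; rewrite -mulN1r -RintegralZl//; last by have [] := weighted_energy_integrable nu (ad k).
  apply: Rintegral_ae_eq.
  - by have /integrableP[/measurable_EFinP] :=
      weighted_coord_integrable nu speed_weight_ge0 (x - x') (y - y') k.
  - by apply: measurable_funM => //; apply: measurable_funM => //; exact: measurable_funM.
  apply: (ae_eq_map2 _ (xd k) (yg k)) => z.
  rewrite !mxE => -> ->; rewrite /speed_weight; field.
  by rewrite gt_eqF.
under eq_bigr do rewrite weighted_energy//.
have bd : \sum_k d k 0 ^+ 2 <= expR nu * \sum_k d k 1 ^+ 2.
  have := boundary_map_lipschitz Hcl B K ubar_gt0 (X 1) (X' 1).
  rewrite -bX -bX' /sum_sqr; under eq_bigr do rewrite !mxE.
  under [X in _ <= _ * X -> _]eq_bigr do rewrite !mxE.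
  move=> /le_trans; apply; rewrite ler_wpM2r ?sumr_ge0// => [k _|]; first exact: sqr_ge0.
  by have := expR_ge1Dx nu; lra.
have -> : \sum_k - (2^-1 * (expR nu * d k 1 ^+ 2 - d k 0 ^+ 2) - 2^-1 * nu * e k) =
    2^-1 * (\sum_k d k 0 ^+ 2 - expR nu * \sum_k d k 1 ^+ 2) + 2^-1 * nu * \sum_k e k.
  rewrite [expR nu * _]mulr_sumr -sumrB !mulr_sumr -big_split/=.
  by apply: eq_bigr => k _; ring.
have ee : \sum_k e k <= (\sum_k Lam k k) * \sum_k (Lam k k)^-1 * e k.
  rewrite mulr_sumr; apply: ler_sum => k _; rewrite mulrA ler_peMl//.
  rewrite ler_pdivlMr// mul1r (bigD1 k)//= lerDl.
  by apply: sumr_ge0 => j _; exact: ltW.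
rewrite /growth_rate -[leRHS]mulrA.
have : 2^-1 * nu * \sum_k e k <= 2^-1 * nu * ((\sum_k Lam k k) * \sum_k (Lam k k)^-1 * e k).
  by rewrite ler_wpM2l// mulr_ge0.
lra.
Qed.

End Operator.

Section OperatorProperties.
Context (R : realType) (n m : nat).
Local Notation leb := (@lebesgue_measure R).
Local Notation D := (`]0%R, 1%R[%classic : set (measurableTypeR R)).
Variables (Lam Hcl : 'M[R]_n) (B : 'M[R]_(n, m)) (K : 'M[R]_(m, n)) (ubar : 'cV[R]_m).
Hypotheses (Lam_diag : is_diag_mx Lam) (Lam_gt0 : forall k, 0 < Lam k k)
  (ubar_gt0 : forall i, 0 < ubar i 0).
Local Notation L2 := (L2space R n).
Local Notation L2norm := (snorm (L2dot R n)).
Local Notation bmap := (boundary_map Hcl B K ubar).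
Local Notation nu := (boundary_const Hcl B K).
Local Notation dotA := (weighted_semidot nu (speed_weight_ge0 Lam_gt0)).
Local Notation opA := (operatorA Lam Hcl B K ubar).

Let mD : measurable D. Proof. exact: measurable_itv. Qed.

Let speed_le k : Lam k k <= 1 + \sum_j Lam j j.
Proof.
rewrite (bigD1 k)//= addrCA lerDl addr_ge0//.
by apply: sumr_ge0 => j _; exact: ltW.
Qed.

Let speed_sum_gt0 : 0 < 1 + \sum_j Lam j j.
Proof. by rewrite ltr_pwDl//; apply: sumr_ge0 => j _; exact: ltW. Qed.

Lemma weighted_norm_equiv : exists c C : R, [/\ 0 <= c, 0 <= C,
  forall x, L2norm x <= c * snorm dotA x & forall x, snorm dotA x <= C * L2norm x].
Proof.
have nu0 : 0 <= nu by exact: boundary_const_ge0.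
have a0 : 0 <= (1 + \sum_j Lam j j)^-1 by rewrite invr_ge0 ltW.
pose M := (\sum_i speed_weight Lam i) * expR nu.
have M0 : 0 <= M.
  by rewrite mulr_ge0 ?expR_ge0//; apply: sumr_ge0 => i _; exact: speed_weight_ge0.
have am i : (1 + \sum_j Lam j j)^-1 <= speed_weight Lam i.
  by rewrite /speed_weight lef_pV2 ?posrE.
have aM i : speed_weight Lam i * expR nu <= M.
  rewrite /M ler_wpM2r ?expR_ge0// (bigD1 i)//= lerDl.
  by apply: sumr_ge0 => j _; exact: speed_weight_ge0.
have bnd := weighted_bounds (speed_weight_ge0 Lam_gt0) nu0 a0 M0 am aM.
exists (Num.sqrt (1 + \sum_j Lam j j)), (Num.sqrt M); split.
- exact: sqrtr_ge0.
- exact: sqrtr_ge0.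
- move=> x; have /andP[+ _] := bnd x; rewrite sqrtrV; last exact: ltW.
  by rewrite ler_pdivrMl// sqrtr_gt0.
- by move=> x; have /andP[] := bnd x.
Qed.

Lemma weighted_norm_complete (u : nat -> L2) :
  (forall e, 0 < e -> exists N, forall p q, (N <= p)%N -> (N <= q)%N ->
    snorm dotA (u p - u q) <= e) ->
  exists x, forall e, 0 < e -> exists N, forall p, (N <= p)%N -> snorm dotA (u p - x) <= e.
Proof.
have [c [C [c0 C0 cE CE]]] := weighted_norm_equiv => uC.
have scale (k e : R) : 0 <= k -> 0 < e -> 0 < e / (k + 1) /\ k * (e / (k + 1)) <= e.
  move=> k0 e0; have k1 : 0 < k + 1 by lra.
  rewrite divr_gt0//; split=> //.
  by rewrite mulrCA ler_piMr ?(ltW e0)// ler_pdivrMr// mul1r; lra.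
have [|x xP] := @L2norm_complete R n u.
  move=> e e0; have [d0 ce] := scale c e c0 e0; have [N NP] := uC _ d0.
  exists N => p q Np Nq; apply: le_trans (cE _) (le_trans _ ce).
  by rewrite ler_wpM2l// NP.
exists x => e e0; have [d0 Ce] := scale C e C0 e0; have [N NP] := xP _ d0.
exists N => p Np; apply: le_trans (CE _) (le_trans _ Ce).
by rewrite ler_wpM2l// NP.
Qed.

(** Functions that vanish at both end points satisfy the boundary condition. *)
Lemma operatorA_dense v e : 0 < e -> exists x y, opA x y /\ snorm dotA (x - v) <= e.
Proof.
move=> e0; have [c [C [c0 C0 cE CE]]] := weighted_norm_equiv.
pose d := (e / (C + 1)) ^+ 2 / (n%:R + 1).
have C1 : 0 < C + 1 by lra.
have n1 : 0 < n%:R + 1 :> R by rewrite ltr_wpDl.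
have eC : 0 < e / (C + 1) by rewrite divr_gt0.
have d0 : 0 < d by rewrite divr_gt0// exprn_gt0.
have /choice[F /choice[f FP]] : forall k, exists F f, [/\ H1_pair F f, F 0 = 0, F 1 = 0 &
    mean_square (F \- (fun z => L2val v z k 0)) <= d].
  by move=> k; apply: density_H1 => //; exact: sqint_coord.
pose X z : 'cV[R]_n := \col_k F k z; pose G z : 'cV[R]_n := \col_k f k z.
have XE k : (fun z => X z k 0) = F k by apply/funext => z; rewrite mxE.
have GE k : (fun z => G z k 0) = f k by apply/funext => z; rewrite mxE.
have hX k : H1_pair (fun z => X z k 0) (fun z => G z k 0).
  by rewrite XE GE; have [] := FP k.
have X0 : X 0 = 0 by apply/colP => k; rewrite !mxE; have [] := FP k.
have X1 : X 1 = 0 by apply/colP => k; rewrite !mxE; have [] := FP k.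
have XL : inL2 X by apply/inL2P => k; exact: H1_pair_sqint.
have GL : inL2 G by apply/inL2P => k; have [] := hX k.
have YL : inL2 (fun z => - (Lam *m G z)).
  by have := L2valP (- mx_lift Lam G); rewrite /= mx_liftE.
exists (toL2 XL), (toL2 YL); split.
  by apply: (@graphA_intro _ _ _ _ _ _ _ _ X G) => //; rewrite X0 X1 boundary_map0.
apply: le_trans (CE _) _.
have : L2norm (toL2 XL - v) ^+ 2 <= (e / (C + 1)) ^+ 2.
  rewrite sqr_L2norm; apply: (@le_trans _ _ (\sum_(k < n) d)).
    apply: ler_sum => k _; have [_ _ _] := FP k; apply: le_trans.
    rewrite le_eqVlt; apply/orP; left; apply/eqP; congr mean_square.
    by apply/funext => z; rewrite /= !mxE.
  rewrite sumr_const card_ord -mulr_natr /d mulrAC ler_pdivrMr// ler_wpM2l ?sqr_ge0//.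
  by rewrite lerDl.
rewrite ler_pXn2r ?nnegrE ?snorm_ge0 ?(ltW eC)// => le1.
apply: le_trans (ler_wpM2l C0 le1) _.
by rewrite mulrCA ler_piMr ?(ltW e0)// ler_pdivrMr// mul1r lerDl.
Qed.

(** For smaller steps the outflow values depend so little on the inflow
    values, by [exp (- 1 / (h lam)) <= h lam], that the boundary condition is
    a contraction. *)
Definition step_bound : R := (2 * (1 + nu) * (1 + \sum_j Lam j j))^-1.

Lemma step_bound_gt0 : 0 < step_bound.
Proof.
rewrite invr_gt0 mulr_gt0// mulr_gt0// ltr_pwDl//; exact: boundary_const_ge0.
Qed.

(** Variation of constants for [w' = mu (v - w)]. The contribution [r] of the
    source to the outflow value does not depend on the inflow value [c]. *)
Lemma transport_resolvent (mu : R) (v : R -> R) : sqint v -> exists r, forall c, exists w,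
  [/\ H1_pair w (fun z => mu * (v z - w z)), w 0 = c & w 1 = expR (- mu) * (c + r)].
Proof.
move=> sv; have [aE _] := exp_H1 mu; have [aE' _] := exp_H1 (- mu).
pose p z := mu * expR (mu * z) * v z.
pose P c z := c + (\int[leb]_(s in `]0%R, z[) p s)%R.
exists (\int[leb]_(s in D) p s)%R => c.
have P0 : P c 0 = c by rewrite /P set_itv_ge ?Rintegral_set0 ?addr0// bnd_simp ltxx.
have aP : abs_continuous (P c) p.
  split; last by move=> z _; rewrite P0.
  have vi := sqint_integrable sv.
  have cE := abs_continuous_continuous (abs_continuousM (abs_continuous_cst mu) aE).
  have := integrableM_continuous vi cE.
  by apply: eq_integrable => // z _; rewrite /= /p mulrC.
pose w z := expR (- mu * z) * P c z.
have aw : abs_continuous w (fun z => mu * (v z - w z)).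
  apply: (abs_continuous_eq (abs_continuousM aE' aP)) => // z _.
  rewrite /= /w /p (_ : mu * expR (mu * z) * v z * expR (- mu * z) = mu * v z); first by ring.
  rewrite -!mulrA (mulrC (v z)) (mulrA (expR _)) -expRD mulNr subrr expR0 mul1r//.
exists w; split.
- split=> //; apply: sqintZ; apply: sqintB => //.
  exact: continuous_sqint (abs_continuous_continuous aw).
- by rewrite /w mulr0 expR0 mul1r P0.
- by rewrite /w mulr1.
Qed.

(** The resolvent equation is a family of uncoupled linear differential
    equations, except for the boundary condition, which is a fixed point
    equation for the inflow values. *)
Lemma operatorA_range h f u : 0 < h < step_bound ->
  exists x, euler_step dotA opA h f u x.
Proof.
move=> /andP[h0 hb]; pose mu k := (h * Lam k k)^-1; pose v := u + h *: f.
have hl k : 0 < h * Lam k k by rewrite mulr_gt0.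
have mu0 k : 0 < mu k by rewrite invr_gt0.
have /choice[r rP] := fun k => transport_resolvent (mu k) (sqint_coord v k).
have nu0 : 0 <= nu by exact: boundary_const_ge0.
pose S : R := 1 + \sum_j Lam j j; have S0 : 0 < S := speed_sum_gt0.
have emu k : expR (- mu k) <= h * S.
  rewrite expRN; apply: (@le_trans _ _ (h * Lam k k)); last by rewrite ler_pM2l// speed_le.
  rewrite -[leRHS]invrK -/(mu k) lef_pV2 ?posrE ?expR_gt0 ?mu0//.
  by have := expR_ge1Dx (mu k); lra.
pose Phi (c : 'cV[R]_n) : 'cV[R]_n := bmap (\col_k (expR (- mu k) * (c k 0 + r k))).
have [c cP] : exists c, c = Phi c.
  apply: contraction_fixed_point => c c'.
  apply: le_trans (boundary_map_lipschitz _ _ _ ubar_gt0 _ _) _.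
  apply: (@le_trans _ _ (nu * ((h * S) ^+ 2 * sum_sqr (c - c')))).
    rewrite ler_wpM2l// mulr_sumr; apply: ler_sum => k _; rewrite !mxE.
    rewrite -mulrBr opprD addrACA subrr addr0 exprMn ler_wpM2r ?sqr_ge0//.
    by rewrite ler_pXn2r ?nnegrE ?expR_ge0// (le_trans _ (emu k)) ?expR_ge0.
  rewrite mulrA ler_wpM2r ?sum_sqr_ge0//.
  have hS : h * S <= (2 * (1 + nu))^-1.
    rewrite -ler_pdivlMr// -invfM; exact: ltW hb.
  have n1 : 0 < 1 + nu by lra.
  apply: (@le_trans _ _ (nu * (2 * (1 + nu))^-1 ^+ 2)).
    by rewrite ler_wpM2l// ler_pXn2r ?nnegrE ?(le_trans _ hS)// mulr_ge0// ltW.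
  rewrite exprVn ler_pdivrMr; last by rewrite exprn_gt0// mulr_gt0.
  rewrite (_ : 4^-1 * (2 * (1 + nu)) ^+ 2 = 1 + 2 * nu + nu ^+ 2); last by field.
  by have := sqr_ge0 nu; lra.
have /choice[w wP] := fun k => rP k (c k 0).
pose X z : 'cV[R]_n := \col_k w k z.
pose G z : 'cV[R]_n := \col_k (mu k * (L2val v z k 0 - w k z)).
have XE k : (fun z => X z k 0) = w k by apply/funext => z; rewrite mxE.
have hX k : H1_pair (fun z => X z k 0) (fun z => G z k 0).
  rewrite XE (_ : (fun z => G z k 0) = fun z => mu k * (L2val v z k 0 - w k z)).
    by have [] := wP k.
  by apply/funext => z; rewrite mxE.
have X0 : X 0 = c by apply/colP => k; rewrite mxE; have [] := wP k.
have X1 : X 1 = \col_k (expR (- mu k) * (c k 0 + r k)).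
  by apply/colP => k; rewrite !mxE; have [] := wP k.
have XL : inL2 X by apply/inL2P => k; exact: H1_pair_sqint.
have GL : inL2 G by apply/inL2P => k; have [] := hX k.
have YL : inL2 (fun z => - (Lam *m G z)).
  by have := L2valP (- mx_lift Lam G); rewrite /= mx_liftE.
exists (toL2 XL); exists (toL2 YL).
  by apply: (@graphA_intro _ _ _ _ _ _ _ _ X G) => //; rewrite X0 X1.
rewrite (_ : _ - _ = 0) ?snorm0//; apply: val_inj; apply/funext => z; apply/colP => k.
have YE : (- (Lam *m G z)) k 0 = - (Lam k k * (mu k * (L2val v z k 0 - w k z))).
  by rewrite mxE diag_mulE// mxE.
have vE : L2val v z k 0 = L2val u z k 0 + h * L2val f z k 0 by rewrite !mxE.
transitivity (w k z - L2val u z k 0 - h * ((- (Lam *m G z)) k 0 + L2val f z k 0)).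
  by rewrite !mxE.
rewrite YE vE mxE /mu; field.
by rewrite !gt_eqF.
Qed.

End OperatorProperties.

Section MildCurve.
Context (R : realType) (V : lmodType R) (b : semidot V).
Variables (A : V -> V -> Prop) (f : R -> V) (x0 : V).
Local Notation nrm := (snorm b).

Hypothesis approx : forall T del, 0 < T -> 0 < del ->
  exists M t fi w, approximation b A f x0 del M t fi w /\ t M = T.

(** Two close times are both close to one grid point. *)
Lemma mild_curve_continuous X : mild_curve b A f x0 X -> forall T e, 0 < T -> 0 < e ->
  exists2 del, 0 < del & forall s r, 0 <= s <= T -> 0 <= r <= T -> `|s - r| <= del ->
    nrm (X s - X r) <= e.
Proof.
move=> mX T e T0 e0; have T1 : 0 < T + 1 by lra.
have e2 : 0 < e / 2 by lra.
have [del del0 close] := mX _ _ T1 e2.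
have d0 : 0 < Num.min 1 (del / 2) by rewrite lt_min ltr01 divr_gt0.
have [M [t [fi [w [aw tM]]]]] := approx T0 d0.
have d1 : Num.min 1 (del / 2) <= 1 by rewrite ge_min lexx.
have d2 : Num.min 1 (del / 2) <= del / 2 by rewrite ge_min lexx orbT.
move: (Num.min _ _) d0 d1 d2 aw => d d0 d1 d2 aw.
have dd : d <= del by lra.
exists (del / 2) => [|s r /andP[s0 sT] /andP[r0 rT]]; first by lra.
rewrite ler_norml => /andP[sr rs].
have [|i iM /andP[si is_]] := approximation_index d0 aw (s := s); first by rewrite s0 tM.
have := close _ _ _ _ (approximation_le dd aw) i s iM s0.
have := close _ _ _ _ (approximation_le dd aw) i r iM r0.
have := snorm_triang b (w i) (X s) (X r); rewrite (snormB b (w i)).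
move=> tri hr hs; suff : nrm (X r - w i) <= e / 2 /\ nrm (X s - w i) <= e / 2 by case; lra.
by split; [apply: hr|apply: hs]; rewrite ?ler_norml; try (apply/andP; split); lra.
Qed.

Lemma mild_curve_initial X : mild_curve b A f x0 X -> nrm (X 0 - x0) = 0.
Proof.
move=> mX; apply/eqP; rewrite eq_le snorm_ge0 andbT; apply/ler_addgt0Pr => e e0.
rewrite add0r; have e2 : 0 < e / 2 by lra.
have [del del0 close] := mX _ _ ltr01 e2.
have d0 : 0 < Num.min del (e / 2) by rewrite lt_min del0.
have [M [t [fi [w [aw tM]]]]] := approx ltr01 d0.
have d1 : Num.min del (e / 2) <= del by rewrite ge_min lexx.
have d2 : Num.min del (e / 2) <= e / 2 by rewrite ge_min lexx orbT.
have [[t0 _] _ _ w0] := aw.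
have := close _ _ _ _ (approximation_le d1 aw) 0%N 0 (leq0n _) (lexx _) ler01.
rewrite t0 subrr normr0 ler01 => /(_ isT (ltW del0)).
by have := snorm_triang b (w 0%N) (X 0) x0; lra.
Qed.

(** The approximate solutions that are close to [Y] are close to [X] too. Their
    last grid point is only known to exceed [T - e], whence [s < T]. *)
Lemma mild_curve_unique X (Y : R -> V) T s : mild_curve b A f x0 X -> 0 <= s < T ->
  (forall e, 0 < e -> exists M t fi w, [/\ approximation b A f x0 e M t fi w,
    T - e < t M <= T, nrm (Y 0 - w 0%N) <= e &
    forall i r, (i < M)%N -> t i < r <= t i.+1 -> nrm (Y r - w i.+1) <= e]) ->
  nrm (Y s - X s) = 0.
Proof.
move=> mX /andP[s0 sT] YP; apply/eqP; rewrite eq_le snorm_ge0 andbT.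
apply/ler_addgt0Pr => e e0; rewrite add0r.
have T0 : 0 < T by exact: le_lt_trans sT.
have e2 : 0 < e / 2 by lra.
have [del del0 close] := mX _ _ T0 e2.
have d0 : 0 < Num.min (Num.min del (e / 2)) (T - s).
  by rewrite !lt_min del0 e2 subr_gt0.
have d1 : Num.min (Num.min del (e / 2)) (T - s) <= del by rewrite !ge_min lexx.
have d2 : Num.min (Num.min del (e / 2)) (T - s) <= e / 2 by rewrite !ge_min lexx orbT.
have d3 : Num.min (Num.min del (e / 2)) (T - s) <= T - s by rewrite !ge_min lexx !orbT.
move: (Num.min _ _) d0 d1 d2 d3 => d d0 d1 d2 d3.
have [M [t [fi [w [aw /andP[Td tMT] Y0 Yw]]]]] := YP d d0.
have [[t0 tM] _ _ _] := aw.
have near i : (i <= M)%N -> s <= t i <= s + d -> nrm (X s - w i) <= e / 2.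
  move=> iM /andP[si is_].
  apply: (close _ _ _ _ (approximation_le d1 aw)) => //; first exact: ltW.
    by rewrite (le_trans _ tMT)// (grid_ge (M := M)) ?iM ?leqnn// => j /tM[].
  by rewrite ler_norml; apply/andP; split; lra.
have [|sE|[i iM si]] := grid_cover t0 (s := s) (M := M); first by rewrite s0; lra.
  have := near 0%N (leq0n _); rewrite t0 sE lexx add0r ltW// => /(_ isT).
  by have := snorm_triang b (w 0%N) (Y 0) (X 0); rewrite (snormB b (w 0%N)); lra.
have [tlt tle] := tM i iM; have /andP[si1 si2] := si.
have := near i.+1 iM; rewrite si2 /= => /(_ _)/wrap[|]; first by lra.
have := Yw i s iM si.
by have := snorm_triang b (w i.+1) (Y s) (X s); rewrite (snormB b (w i.+1)); lra.
Qed.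

End MildCurve.

(** * Mild solution pairs *)

Lemma snorm_null_eq (R : realType) (V : lmodType R) (b : semidot V) (x y v : V) :
  snorm b (x - y) = 0 -> snorm b (x - v) = snorm b (y - v).
Proof.
move=> xy; apply/eqP; rewrite eq_le.
have := snorm_triang b y x v; have := snorm_triang b x y v.
by rewrite (snormB b y x) xy !add0r => -> ->.
Qed.

Section MildPairs.
Context (R : realType) (n m q : nat).
Local Notation leb := (@lebesgue_measure R).
Local Notation D := (`]0%R, 1%R[%classic : set (measurableTypeR R)).
Variables (Lam Hcl : 'M[R]_n) (B : 'M[R]_(n, m)) (N : 'M[R]_(n, q)) (K : 'M[R]_(m, n))
  (ubar : 'cV[R]_m) (I : set R) (X0 : R -> 'cV[R]_n) (d : R -> R -> 'cV[R]_q).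
Hypotheses (Lam_gt0 : forall k, 0 < Lam k k)
  (mI : measurable (I : set (measurableTypeR R))) (hX0 : inL2 X0) (hd : L1L2 I d).
Local Notation L2 := (L2space R n).
Local Notation L2norm := (snorm (L2dot R n)).
Local Notation dotA := (weighted_semidot (boundary_const Hcl B K) (speed_weight_ge0 Lam_gt0)).
Local Notation opA := (operatorA Lam Hcl B K ubar).
Local Notation f := (time_lift N I d).
Local Notation approx := (approximation dotA opA f (toL2 hX0)).

Variables (c C : R).
Hypotheses (c0 : 0 <= c) (C0 : 0 <= C) (cE : forall x, L2norm x <= c * snorm dotA x)
  (CE : forall x, snorm dotA x <= C * L2norm x).

Lemma time_lift_weighted_measurable : strongly_measurable dotA f.
Proof.
apply: (strongly_measurable_norm CE); exact: time_lift_strongly_measurable.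
Qed.

Lemma time_lift_weighted_integrable T : (\int[leb]_(t in `]0%R, T]) (snorm dotA (f t))%:E < +oo)%E.
Proof.
have mf := time_lift_strongly_measurable N mI hd.
have := integral_norm_le C0 CE 0 T mf (finite_rank_cst 0).
under eq_integral do rewrite subr0; under [X in (_ <= _ * X)%E -> _]eq_integral do rewrite subr0.
move=> /le_lt_trans; apply; apply: lte_mul_pinfty; rewrite ?lee_fin//.
exact: time_lift_integrable.
Qed.

(** The step function takes at [s] the value of the scheme at the end of the
    cell that contains [s]. At [s = 0] there is no such cell, and [xget] falls
    back on the index of the initial value. *)
Lemma approximation_eps_solution T eps del M t fi w : 0 < T ->
  (forall s, 0 < s <= T -> I s) -> approx del M t fi w -> t M = T ->
  del < eps -> c * del < eps ->
  exists W, eps_approx_solution Lam Hcl B K ubar T eps (fun s => opN N (d s)) X0 T W /\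
    forall s, 0 <= s <= T -> exists2 i, (i <= M)%N & W s = L2val (w i) /\ `|s - t i| <= del.
Proof.
move=> T0 IT [[t0 tM] ew sM w0] tMT de cde.
have M0 : (0 < M)%N by case: M tMT {tM ew sM} => // tMT; move: T0; rewrite -tMT t0 ltxx.
have tmono i j : (i <= j <= M)%N -> t i <= t j by apply: grid_ge => k /tM[].
pose hit s := [set k | exists2 i, k = i.+1 & (i < M)%N /\ t i < s <= t i.+1].
pose W s := L2val (w (xget 0%N (hit s))).
have W0 : W 0 = L2val (w 0%N).
  rewrite /W xgetPN// => k [i _ [iM /andP[+ _]]].
  by rewrite -t0 ltNge tmono ?(ltnW iM)//.
have hit1 i s k : (i < M)%N -> t i < s <= t i.+1 -> hit s k -> k = i.+1.
  move=> iM /andP[si si1] [j -> [jM /andP[sj sj1]]]; congr _.+1.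
  case: (ltngtP i j) => // ij.
    exfalso; have := tmono i.+1 j; rewrite ij ltnW// => /(_ isT); lra.
  exfalso; have := tmono j.+1 i; rewrite ij ltnW// => /(_ isT); lra.
have WS i s : (i < M)%N -> t i < s <= t i.+1 -> W s = L2val (w i.+1).
  move=> iM si; rewrite /W (@xget_unique _ _ _ i.+1) //; first by exists i.
  by move=> k; exact: hit1.
exists W; split; last first.
  move=> s; rewrite -tMT => /(grid_cover t0)[->|[i iM si]].
    by exists 0%N => //; split=> //; rewrite t0 subrr normr0 (le_trans (snorm_ge0 _ _) w0).
  exists i.+1 => //; split; first exact: WS.
  by have [tlt tle] := tM i iM; move: si => /andP[? ?]; rewrite ler_norml; apply/andP; split; lra.
exists M, t, (fun i => L2val (fi i)), (fun i => L2val (w i)); split => //.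
- split=> //; split; last by rewrite lexx andbT; have := snorm_ge0 dotA (w 0%N - toL2 hX0); lra.
  by move=> i /tM[ti tle]; split=> //; exact: le_lt_trans de.
- split; first by move=> i _; exact: L2valP.
  apply: (@le_lt_trans _ _ (c * del)%:E); last by rewrite lte_fin.
  have mA := time_lift_weighted_measurable.
  apply: (@le_trans _ _ (\sum_(i < M) c%:E * \int[leb]_(s in `]t i, t i.+1]) (snorm dotA (f s - fi i.+1))%:E)%E).
    apply: lee_sum => i _.
    apply: le_trans (integral_norm_le c0 cE _ _ mA (finite_rank_cst (fi i.+1))).
    rewrite le_eqVlt; apply/orP; left; apply/eqP; apply: eq_integral => s.
    rewrite inE/= in_itv/= => /andP[si si1].
    have Is : I s.
      apply: IT; rewrite (le_lt_trans _ si); last by rewrite -t0 tmono ?(ltnW (ltn_ord i))//.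
      by rewrite (le_trans si1)// -tMT tmono// ltn_ord leqnn.
    have [dL _ _] := hd; rewrite -normL2E; congr (normL2 _)%:E.
    by rewrite -(time_liftE N Is (dL s Is)).
  rewrite -ge0_sume_distrr; last first.
    by move=> i _; apply: integral_ge0 => s _; rewrite lee_fin snorm_ge0.
  by rewrite EFinM lee_wpmul2l// lee_fin.
- by split=> // i iM s; exact: WS.
- move=> i iM; have [tlt [y Ay wy]] := ew i iM.
  exists (L2val y) => //.
  have wy0 : L2norm (w i.+1 - (w i + (t i.+1 - t i) *: (y + fi i.+1))) = 0.
    apply/eqP; rewrite eq_le snorm_ge0 andbT opprD addrA.
    by apply: le_trans (cE _) _; rewrite wy mulr0.
  have h0 : t i.+1 - t i != 0 by rewrite gt_eqF// subr_gt0.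
  move/eqL2_norm0: wy0; apply: filterS => z + Dz => /(_ Dz) -> /=.
  apply/colP => k; rewrite !mxE; move: (L2val (w i) z k 0) => a.
  by rewrite addrAC subrr add0r mulrA mulVf// mul1r.
- split; first exact: L2valP.
  have -> : L2val (w 0%N) \- X0 = L2val (w 0%N - toL2 hX0) by [].
  rewrite normL2E; apply: le_trans (cE _) (le_trans _ (ltW cde)).
  by rewrite ler_wpM2l.
Qed.

Let lift1 (X : R -> 'cV[R]_n) : L2 := mx_lift 1%:M X.

Let lift1E X : inL2 X -> L2val (lift1 X) = X.
Proof. by move=> h; rewrite /lift1 mx_liftE//; apply/funext => z; rewrite mul1mx. Qed.

(** Only time integrals of the forcing enter, so that [d'] may be replaced by
    [d]. The image [Y] of a step under the operator is known up to a null set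
    and need not be measurable; it is replaced by [- Lam G]. *)
Lemma eps_solution_approximation d' T eps tM W : L1L2 I d' ->
  {ae leb, forall t, I t -> eqL2 (d' t) (d t)} -> (forall s, 0 < s <= T -> I s) ->
  eps_approx_solution Lam Hcl B K ubar T eps (fun s => opN N (d' s)) X0 tM W ->
  exists M t fi w, [/\ approx ((1 + C) * eps) M t fi w, t M = tM, T - eps < tM <= T,
    W 0 = L2val (w 0%N) & forall i s, (i < M)%N -> t i < s <= t i.+1 -> W s = L2val (w i.+1)].
Proof.
move=> hd' dd IT [M [t [fi [wi [[M0 t0 tMe [tM' tMT]] [fL fS] [W0 WS] gS [w0L w0X]]]]]].
have eps0 : 0 <= eps by apply: le_trans w0X; rewrite sqrtr_ge0.
have epsC : eps <= (1 + C) * eps by rewrite ler_peMl// lerDl.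
have wL i : (i <= M)%N -> inL2 (wi i).
  by case: i => // i iM; have [Y [[[]]]] := gS i iM.
have tmono i j : (i <= j <= M)%N -> t i <= t j by apply: grid_ge => k /tM'[].
exists M, t, (fun i => lift1 (fi i)), (fun i => lift1 (wi i)); split => //; last 2 first.
- by rewrite W0 lift1E.
- by move=> i s iM si; rewrite (WS i iM s si) (lift1E (wL _ iM)).
split.
- by split=> // i /tM'[ti tie]; split=> //; exact: le_trans (ltW tie) epsC.
- move=> i iM; have [tlt _] := tM' i iM; split=> //.
  have [Y [dA [G [GL wG YG]]] wY] := gS i iM.
  pose y := - mx_lift Lam G.
  have yE z : L2val y z = - (Lam *m G z).
    change (L2val y z) with (- L2val (mx_lift Lam G) z); by rewrite mx_liftE.
  exists y.
    rewrite /operatorA (lift1E (wL _ iM)); split=> //; exists G; split => //.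
    by apply: nearW => z _; rewrite yE.
  apply/eqP; rewrite eq_le snorm_ge0 andbT; apply: le_trans (CE _) _.
  rewrite (_ : L2norm _ = 0) ?mulr0//.
  rewrite -addrA -opprD; apply/eqL2_norm0; rewrite (lift1E (wL _ iM)).
  move: wY YG; apply: filterS2 => z + + Dz => /(_ Dz) + /(_ Dz) YGz.
  move=> /(congr1 (fun v => (t i.+1 - t i) *: v)).
  rewrite scalerA mulfV ?gt_eqF ?subr_gt0// scale1r.
  move=> /eqP; rewrite subr_eq addrC => /eqP -> /=.
  change (wi i z + (t i.+1 - t i) *: (Y z + fi i.+1 z) =
    L2val (lift1 (wi i)) z + (t i.+1 - t i) *: (L2val y z + L2val (lift1 (fi i.+1)) z)).
  by rewrite yE YGz (lift1E (wL _ (ltnW iM))) (lift1E (fL _ iM)).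
- apply: (@le_trans _ _ (C * eps)%:E); last by rewrite lee_fin ler_wpM2r// lerDr.
  have mL := time_lift_strongly_measurable N mI hd.
  have mL' := time_lift_strongly_measurable N mI hd'.
  apply: (@le_trans _ _ (\sum_(i < M) C%:E * \int[leb]_(s in `]t i, t i.+1])
      (normL2 (opN N (d' s) \- fi i.+1))%:E)%E); last first.
    rewrite -ge0_sume_distrr; last first.
      by move=> i _; apply: integral_ge0 => s _; rewrite lee_fin sqrtr_ge0.
    by rewrite EFinM lee_wpmul2l ?lee_fin// ltW.
  apply: lee_sum => i _.
  apply: le_trans (integral_norm_le C0 CE _ _ mL (finite_rank_cst (lift1 (fi i.+1)))) _.
  apply: lee_wpmul2l; first by rewrite lee_fin.
  rewrite le_eqVlt; apply/orP; left; apply/eqP.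
  transitivity (\int[leb]_(s in `]t i, t i.+1])
      (L2norm (time_lift N I d' s - lift1 (fi i.+1)))%:E)%E.
    have Is s : `]t i, t i.+1]%classic s -> I s.
      rewrite /= in_itv/= => /andP[si si1].
      apply: IT; rewrite (le_lt_trans _ si); last by rewrite -t0 tmono ?(ltnW (ltn_ord i))//.
      rewrite (le_trans si1)//; case/andP: tMT => _; apply: le_trans; rewrite -tMe.
      by rewrite tmono// ltn_ord leqnn.
    apply: ae_eq_integral => //.
    - by apply/measurable_EFinP; apply: measurable_funTS; exact: measurable_snormB mL _ (finite_rank_cst _).
    - by apply/measurable_EFinP; apply: measurable_funTS; exact: measurable_snormB mL' _ (finite_rank_cst _).
    move: dd; apply: filterS; first exact: (ae_filter_ringOfSetsType leb).
    move=> s + sI => /(_ (Is s sI)) ds.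
    have Iss := Is s sI.
    have [dL _ _] := hd; have [dL' _ _] := hd'.
    have e0 : L2norm (time_lift N I d' s - time_lift N I d s) = 0.
      apply/eqL2_norm0; rewrite !time_liftE//; [|exact: dL|exact: dL'].
      by move: ds; apply: filterS => z + Dz => /(_ Dz); rewrite /opN => ->.
    have /= -> // := snorm_null_eq (lift1 (fi i.+1)) e0.
  apply: eq_integral => s; rewrite inE/= in_itv/= => /andP[si si1].
  have Is : I s.
    apply: IT; rewrite (le_lt_trans _ si); last by rewrite -t0 tmono ?(ltnW (ltn_ord i))//.
    rewrite (le_trans si1)//; case/andP: tMT => _; apply: le_trans; rewrite -tMe.
    by rewrite tmono// ltn_ord leqnn.
  have [dL _ _] := hd'; rewrite -normL2E; congr (normL2 _)%:E.
  change (L2val (time_lift N I d' s) \- L2val (lift1 (fi i.+1)) = opN N (d' s) \- fi i.+1).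
  by rewrite (time_liftE N Is (dL s Is)) (lift1E (fL _ (ltn_ord i))).
- apply: le_trans (CE _) _; rewrite -normL2E.
  change (C * normL2 (L2val (lift1 (wi 0%N)) \- X0) <= (1 + C) * eps).
  rewrite (lift1E w0L); apply: (@le_trans _ _ (C * eps)); first by rewrite ler_wpM2l.
  by rewrite ler_wpM2r// lerDr.
Qed.

End MildPairs.

Section ContinuityInTime.
Context (R : realType) (n : nat).
Implicit Types (I : set R) (X : R -> R -> 'cV[R]_n).

Lemma continuousL2P I X : (forall t, I t -> inL2 (X t)) ->
  continuousL2 I X <-> (forall t e, I t -> 0 < e -> exists2 del, 0 < del &
    forall s, I s -> `|t - s| < del -> normL2 (X s \- X t) < e).
Proof.
move=> XL; split=> [[_ cX] t e It e0|cX].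
  have /cvgrPdist_lt/(_ e e0) := cX t It.
  rewrite /within/= => /nbhs_ballP[del /= del0 sub].
  exists del => // s Is ts; have := sub s ts Is.
  by rewrite sub0r normrN ger0_norm// sqrtr_ge0.
split=> // t It; apply/cvgrPdist_lt => e e0; have [del del0 Xd] := cX t e It e0.
rewrite /within/=; apply/nbhs_ballP; exists del => //= s ts Is.
by rewrite sub0r normrN ger0_norm ?sqrtr_ge0//; exact: Xd.
Qed.

End ContinuityInTime.

Section Positivity.
Context (R : realType) (n : nat) (Lam : 'M[R]_n).

Lemma posdef_diag_gt0 k : posdef_mx Lam -> 0 < Lam k k.
Proof.
move=> [_ /(_ (delta_mx k 0))]; have -> : (delta_mx k 0 : 'cV[R]_n) != 0.
  by apply/eqP => /matrixP/(_ k 0)/eqP; rewrite !mxE !eqxx oner_eq0.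
move=> /(_ isT); rewrite trmx_delta -rowE -colE !mxE//.
Qed.

End Positivity.

Unset Implicit Arguments.

Theorem theorem1 (R : realType) (n m q : nat)
    (Lam H : 'M[R]_n) (B : 'M[R]_(n, m)) (N : 'M[R]_(n, q))
    (K : 'M[R]_(m, n)) (ubar : 'cV[R]_m)
    (Lam_diag : is_diag_mx Lam) (Lam_posdef : posdef_mx Lam)
    (ubar_gt0 : forall i, 0 < ubar i 0)
    (I : set R)
    (hI : (exists2 T : R, 0 < T & I = `[0, T]%classic) \/ I = `[0, +oo[%classic)
    (X0 : R -> 'cV[R]_n) (hX0 : inL2 X0)
    (d : R -> R -> 'cV[R]_q) (hd : L1L2 I d) :
  exists X : R -> R -> 'cV[R]_n,
    mild_solution_pair Lam (H + B *m K) B N K ubar I X0 X d /\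
    forall (X' : R -> R -> 'cV[R]_n) (d' : R -> R -> 'cV[R]_q),
      mild_solution_pair Lam (H + B *m K) B N K ubar I X0 X' d' ->
      {ae @lebesgue_measure R, forall t, I t -> eqL2 (d' t) (d t)} ->
      forall t, I t -> eqL2 (X' t) (X t).
Proof.
have Lam_gt0 k : 0 < Lam k k := posdef_diag_gt0 k Lam_posdef.
have mI : measurable (I : set (measurableTypeR R)).
  by case: hI => [[T _ ->]|->]; exact: measurable_itv.
have I_ge0 s : I s -> 0 <= s.
  by case: hI => [[T _ ->]|->]; rewrite /= in_itv/= => /andP[].
have I_sub T s : horizon I T -> 0 <= s <= T -> I s.
  by move=> [_ [->|->]] /andP[s0 sT]; rewrite /= in_itv/= s0.
set Hcl := H + B *m K.
have [c [C [c0 C0 cE CE]]] := weighted_norm_equiv Hcl B K Lam_gt0.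
pose x0 := toL2 hX0; pose f := time_lift N I d.
set dotA := weighted_semidot _ _ in cE CE.
pose opA := operatorA Lam Hcl B K ubar.
have f_meas : strongly_measurable dotA f := time_lift_weighted_measurable N mI hd CE.
have f_int := time_lift_weighted_integrable N mI hd C0 CE.
have om0 := growth_rate_ge0 Hcl B K Lam_gt0.
have A_diss : dissipative dotA (growth_rate Lam Hcl B K) opA.
  exact: operatorA_dissipative.
have h00 := step_bound_gt0 Hcl B K Lam_gt0.
have A_range h v u : 0 < h < step_bound Lam Hcl B K -> exists x, euler_step dotA opA h v u x.
  exact: operatorA_range.
have A_dense v e : 0 < e -> exists x y, opA x y /\ snorm dotA (x - v) <= e.
  exact: operatorA_dense.
have complete := @weighted_norm_complete _ _ _ _ Hcl B K Lam_gt0.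
have [Xs mX] : exists X, mild_curve dotA opA f x0 X.
  exact: (mild_limit x0 om0 A_diss h00 A_range A_dense f_meas f_int complete).
have approx T del : 0 < T -> 0 < del ->
    exists M t fi w, approximation dotA opA f x0 del M t fi w /\ t M = T.
  exact: (approximation_exists x0 f_meas h00 A_range A_dense f_int).
pose X t := L2val (Xs t).
have XB s t : normL2 (X s \- X t) = snorm (L2dot R n) (Xs s - Xs t) := normL2E (Xs s - Xs t).
have c1 : 0 < c + 1 by lra.
have cX : continuousL2 I X.
  apply/continuousL2P => [t _|t e It e0]; first exact: L2valP.
  have t1 : 0 < t + 1 by have := I_ge0 t It; lra.
  have [del del0 Xd] := mild_curve_continuous approx mX t1 (divr_gt0 e0 c1).
  exists (Num.min del 1) => [|s Is]; first by rewrite lt_min del0 ltr01.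
  rewrite lt_min distrC => /andP[sdel]; rewrite ltr_norml => /andP[_ st].
  rewrite XB; apply: le_lt_trans (cE _) _.
  apply: (@le_lt_trans _ _ (c * (e / (c + 1)))).
    have s0 := I_ge0 s Is; have t0 := I_ge0 t It.
    by rewrite ler_wpM2l// Xd ?(ltW sdel)//; apply/andP; split=> //; lra.
  by rewrite mulrCA gtr_pMr// ltr_pdivrMr// mul1r ltrDl.
have X_mild : mild_solution_pair Lam Hcl B N K ubar I X0 X d.
  split => //.
    apply/(eqL2_norm0 (Xs 0) x0)/eqP; rewrite eq_le snorm_ge0 andbT.
    by apply: le_trans (cE _) _; rewrite (mild_curve_initial approx mX) mulr0.
  move=> T hT eps eps0; have [T0 _] := hT.
  pose e := eps / (2 * (c + 1)).
  have e0 : 0 < e by rewrite divr_gt0// mulr_gt0.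
  have ee : (c + 1) * e = eps / 2 by rewrite /e; field; rewrite gt_eqF.
  have ce0 : 0 <= c * e by rewrite mulr_ge0// ltW.
  have [del del0 close] := mX T e T0 e0.
  have d0 : 0 < Num.min del e by rewrite lt_min del0.
  have d1 : Num.min del e <= del by rewrite ge_min lexx.
  have d2 : Num.min del e <= e by rewrite ge_min lexx orbT.
  move: (Num.min del e) d0 d1 d2 => r r0 r1 r2.
  have [M [t [fi [w [aw tM]]]]] := approx T r T0 r0.
  have cr : c * r <= c * e by rewrite ler_wpM2l.
  have [|||W [eW WX]] := approximation_eps_solution mI hd c0 cE CE T0 _ aw tM (eps := eps).
  - by move=> s /andP[s0 sT]; apply: (I_sub T) => //; rewrite (ltW s0).
  - lra.
  - lra.
  exists T, W; split=> // s sT; have /andP[s0 s1] := sT.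
  have [i iM [-> si]] := WX s sT.
  rewrite (_ : X s \- L2val (w i) = L2val (Xs s - w i))// normL2E.
  apply: le_trans (cE _) _; apply: (@le_trans _ _ (c * e)); last lra.
  rewrite ler_wpM2l//; apply: (close _ _ _ _ (approximation_le r1 aw) i s iM s0 s1).
    by have [[_ tS] _ _ _] := aw; rewrite -tM (grid_ge (M := M)) ?iM ?leqnn// => j /tS[].
  exact: le_trans r1.
exists X; split=> // X' d' [cX' hd' X'0 mX'] dd.
have [X'L _] := cX'.
(* Strictly before the horizon, [X'] is approached by approximate solutions. *)
have before T s : horizon I T -> 0 <= s < T -> eqL2 (X' s) (X s).
  move=> hT /andP[s0 sT]; have [T0 _] := hT.
  have inI r : 0 <= r <= T -> I r by exact: I_sub.
  pose Y r : L2space R n := mx_lift 1%:M (X' r).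
  have YE r : 0 <= r <= T -> L2val (Y r) = X' r.
    by move=> rT; rewrite /Y (mx_liftE _ (X'L r (inI r rT))); apply/funext => z; rewrite mul1mx.
  suff Ys : snorm dotA (Y s - Xs s) = 0.
    rewrite -YE; last by rewrite s0 ltW.
    apply/eqL2_norm0/eqP; rewrite eq_le snorm_ge0 andbT.
    by apply: le_trans (cE _) _; rewrite Ys mulr0.
  apply: (mild_curve_unique mX (T := T)); first by rewrite s0.
  move=> e e0; have C1 : 0 < 1 + C by lra.
  have eC : 0 < e / (1 + C) by rewrite divr_gt0.
  have Ce : (1 + C) * (e / (1 + C)) = e by rewrite mulrC divfK// gt_eqF.
  have eCe : e / (1 + C) <= e by rewrite ler_pdivrMr// ler_peMr ?(ltW e0)// lerDl.
  have CeC : C * (e / (1 + C)) <= e by have := ltW eC; lra.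
  have [tM [W [eW X'W]]] := mX' T hT _ eC.
  have [|M [t [fi [w [aw tME tMT W0 WS]]]]] := eps_solution_approximation mI hX0 hd C0 CE hd' dd _ eW.
    by move=> r /andP[r0 rT]; apply: inI; rewrite (ltW r0).
  have [[t0 tS] _ _ _] := aw.
  have tmono i j : (i <= j <= M)%N -> t i <= t j by apply: grid_ge => k /tS[].
  have tM0 : 0 <= tM by rewrite -tME -t0 tmono ?leqnn.
  have near r i : 0 <= r <= tM -> W r = L2val (w i) -> snorm dotA (Y r - w i) <= e.
    move=> rM Wr; have /andP[r0 r1] := rM; apply: le_trans (CE _) (le_trans _ CeC).
    rewrite ler_wpM2l// -normL2E.
    change (normL2 (L2val (Y r) \- L2val (w i)) <= e / (1 + C)).
    rewrite YE -?Wr ?X'W// r0 (le_trans r1)//; by case/andP: tMT.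
  exists M, t, fi, w; split.
  - by rewrite -Ce.
  - by rewrite tME; move: tMT => /andP[tMT ->]; rewrite andbT; apply: le_lt_trans tMT; lra.
  - by apply: near => //; rewrite lexx.
  - move=> i r iM ri; apply: near; last exact: WS.
    move: ri => /andP[ri ri1]; rewrite -tME.
    by rewrite (le_trans ri1) ?tmono ?iM ?leqnn// (le_trans _ (ltW ri))// -t0 tmono ?(ltnW iM).
case: hI => [[T T0 IE]|IE] t It; last first.
  apply: (before (t + 1)); first by split; [have := I_ge0 t It; lra|right].
  by rewrite I_ge0//=; lra.
have hT : horizon I T by split=> //; left.
have [t0 tT] : 0 <= t /\ t <= T by move: It; rewrite IE /= in_itv/= => /andP[].
move: tT; rewrite le_eqVlt => /predU1P[tT|tT]; last by apply: (before T) => //; rewrite t0.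
(* At the right end point of a bounded [I], both curves are continuous. *)
have X't := X'L t It.
apply/(eqL2_norm0 (toL2 X't) (Xs t))/eqP; rewrite eq_le snorm_ge0 andbT.
apply/ler_addgt0Pr => e e0; rewrite add0r.
have e2 : 0 < e / 2 by lra.
have [d1 d10 Xd1] := (continuousL2P X'L).1 cX' t _ It e2.
have [d2 d20 Xd2] := (continuousL2P (fun s _ => L2valP (Xs s))).1 cX t _ It e2.
pose r := Num.min (Num.min d1 d2) T / 2.
have r0 : 0 < r by rewrite divr_gt0// !lt_min d10 d20.
have [r1 r2 rT] : [/\ r < d1, r < d2 & r < T].
  have m1 : Num.min (Num.min d1 d2) T <= d1 by rewrite !ge_min lexx.
  have m2 : Num.min (Num.min d1 d2) T <= d2 by rewrite !ge_min lexx orbT.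
  have m3 : Num.min (Num.min d1 d2) T <= T by rewrite ge_min lexx orbT.
  by rewrite /r in r0 *; move: (Num.min _ _) m1 m2 m3 r0 => x *; split; lra.
pose s := t - r; have sT : 0 <= s < T by rewrite /s tT; apply/andP; split; lra.
have Is : I s by apply: (I_sub T) => //; case/andP: sT => -> /ltW.
have ts : `|t - s| = r by rewrite /s opprB addrCA subrr addr0 gtr0_norm.
have X's := X'L s Is.
have h1 : snorm (L2dot R n) (toL2 X't - toL2 X's) < e / 2.
  by rewrite snormB -normL2E; apply: Xd1 => //; rewrite ts.
have h2 : snorm (L2dot R n) (Xs s - Xs t) < e / 2 by rewrite -XB; apply: Xd2 => //; rewrite ts.
have h3 : snorm (L2dot R n) (toL2 X's - Xs s) = 0.
  by apply/eqL2_norm0; exact: before sT.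
apply: le_trans (snorm_triang _ (toL2 X's) _ _) _.
rewrite [leRHS]splitr; apply: lerD; first exact: ltW h1.
by apply: le_trans (snorm_triang _ (Xs s) _ _) _; rewrite h3 add0r; exact: ltW h2.
Qed.
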